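(* Let $a\in\{p,s\}$ and $j\in\{1,2\}$. If $\mathbf{y}=(y_1,y_2)\in\mathbb{R}^2_+\cup\mathbb{R}^2_-$ and $\mathbf{x}=r\hat{\mathbf{x}}=r(\cos\theta_x,\sin\theta_x)\in\mathbb{R}^2_-$ with $\theta_x\in(\pi,2\pi)$, then as $r\to\infty$ $$U_{a,j}(\mathbf{x},\mathbf{y})=\frac{e^{ik_{a,-}r}}{\sqrt{r}}U_{a,j}^\infty(\hat{\mathbf{x}},\mathbf{y})+O(r^{-3/4}),\qquad \nabla_{\mathbf{y}}U_{a,j}(\mathbf{x},\mathbf{y})=\frac{e^{ik_{a,-}r}}{\sqrt{r}}\nabla_{\mathbf{y}}U_{a,j}^\infty(\hat{\mathbf{x}},\mathbf{y})+O(r^{-3/4}),$$ where $$U_{a,j}^\infty(\hat{\mathbf{x}},\mathbf{y}):=e^{i3\pi/4}\sqrt{\frac{k_{a,-}}{2\pi}}\begin{cases}\sin\theta_x\,A_{a,j}(k_{a,-}\cos\theta_x,y_2)\,e^{-ik_{a,-}y_1\cos\theta_x}, & \mathbf{y}\in\mathbb{R}^2_+,\\ \sin\theta_x\,B_{a,j}(k_{a,-}\cos\theta_x,y_2)\,e^{-ik_{a,-}y_1\cos\theta_x}, & \mathbf{y}\in\mathbb{R}^2_-.\end{cases}$$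
   Context: $\mathbb{R}^2_\pm=\{x\in\mathbb{R}^2:x_2\gtrless0\}$. Constants: $\mu>0$, $2\lambda+2\mu>0$, $\rho_\pm>0$, $\rho_+\neq\rho_-$, $\omega>0$, $k_{p,\pm}=\omega\sqrt{\rho_\pm/(2\mu+\lambda)}$, $k_{s,\pm}=\omega\sqrt{\rho_\pm/\mu}$. For real $\xi$ and $a=p,s$: $\beta_{a,\pm}=\sqrt{\xi^2-k_{a,\pm}^2}$ if $|\xi|\ge k_{a,\pm}$ and $\beta_{a,\pm}=-i\sqrt{k_{a,\pm}^2-\xi^2}$ if $|\xi|<k_{a,\pm}$. Abbreviations: $\Lambda_a:=k_{a,+}^{-2}\beta_{a,+}+k_{a,-}^{-2}\beta_{a,-}$, $\delta_a:=k_{a,+}^{-2}-k_{a,-}^{-2}$, $C_0:=\frac{1}{\rho_+\omega^2}-\frac{1}{\rho_-\omega^2}$, $D:=-\Lambda_p\Lambda_s+\delta_p\delta_s\xi^2$. As functions of $(\xi,y_2)$, for $y_2>0$: $$A_{p,1}=\tfrac{C_0\xi}{D}i\big[k_{s,+}^{-2}\beta_{s,+}e^{-\beta_{s,+}y_2}-\tfrac{\delta_sk_{p,+}^{-2}\xi^2}{\Lambda_p}e^{-\beta_{p,+}y_2}\big],\quad A_{s,1}=\tfrac{C_0\xi}{D}\big[-\tfrac{\delta_pk_{s,+}^{-2}\beta_{s,+}\xi}{\Lambda_s}e^{-\beta_{s,+}y_2}+k_{p,+}^{-2}\xi e^{-\beta_{p,+}y_2}\big],$$ $$A_{p,2}=\tfrac{C_0\xi}{D}\big[k_{s,+}^{-2}\xi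 e^{-\beta_{s,+}y_2}-\tfrac{\delta_sk_{p,+}^{-2}\beta_{p,+}\xi}{\Lambda_p}e^{-\beta_{p,+}y_2}\big],\quad A_{s,2}=\tfrac{C_0\xi}{D}i\big[\tfrac{\delta_pk_{s,+}^{-2}\xi^2}{\Lambda_s}e^{-\beta_{s,+}y_2}-k_{p,+}^{-2}\beta_{p,+}e^{-\beta_{p,+}y_2}\big],$$ and for $y_2<0$: $$B_{p,1}=\tfrac{C_0\xi}{D}i\big[-k_{s,-}^{-2}\beta_{s,-}e^{\beta_{s,-}y_2}-\tfrac{\delta_sk_{p,-}^{-2}\xi^2}{\Lambda_p}e^{\beta_{p,-}y_2}\big],\quad B_{s,1}=\tfrac{C_0\xi}{D}\big[\tfrac{\delta_pk_{s,-}^{-2}\beta_{s,-}\xi}{\Lambda_s}e^{\beta_{s,-}y_2}+k_{p,-}^{-2}\xi e^{\beta_{p,-}y_2}\big],$$ $$B_{p,2}=\tfrac{C_0\xi}{D}\big[k_{s,-}^{-2}\xi e^{\beta_{s,-}y_2}+\tfrac{\delta_sk_{p,-}^{-2}\beta_{p,-}\xi}{\Lambda_p}e^{\beta_{p,-}y_2}\big],\quad B_{s,2}=\tfrac{C_0\xi}{D}i\big[\tfrac{\delta_pk_{s,-}^{-2}\xi^2}{\Lambda_s}e^{\beta_{s,-}y_2}+k_{p,-}^{-2}\beta_{p,-}e^{\beta_{p,-}y_2}\big].$$ The function $U_{a,j}$ is $$U_{a,j}(\mathbf{x},\mathbf{y})=\frac{1}{2\pi}\int_{-\infty}^{+\infty}\hat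 U_{a,j}(\xi,x_2,y_2)e^{i(x_1-y_1)\xi}d\xi,\qquad \hat U_{a,j}=\begin{cases}A_{a,j}e^{-\beta_{a,+}x_2}, & x_2>0,\ y_2>0,\\ A_{a,j}e^{\beta_{a,-}x_2}, & x_2<0,\ y_2>0,\\ B_{a,j}e^{-\beta_{a,+}x_2}, & x_2>0,\ y_2<0,\\ B_{a,j}e^{\beta_{a,-}x_2}, & x_2<0,\ y_2<0.\end{cases}$$ *)

(* Defs.v *)
From Stdlib Require Import Reals.
From Coquelicot Require Import Coquelicot.
Open Scope R_scope.

Inductive wave := Pw | Sw.
Inductive side := Up | Lo.
Inductive coord := X1 | X2.

(* Lame constants, mass densities of the half-planes x2 > 0 (Up) and
   x2 < 0 (Lo), and angular frequency. *)
Record medium := Medium {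
  mu : R;
  lam : R;
  rho : side -> R;
  omega : R
}.

Definition admissible (m : medium) : Prop :=
  0 < mu m /\ 0 < 2 * lam m + 2 * mu m /\
  (forall sg, 0 < rho m sg) /\ rho m Up <> rho m Lo /\ 0 < omega m.

Definition cexp (z : C) : C :=
  (exp (Re z) * cos (Im z), exp (Re z) * sin (Im z)).

Definition k (m : medium) (a : wave) (sg : side) : R :=
  match a with
  | Pw => omega m * sqrt (rho m sg / (2 * mu m + lam m))
  | Sw => omega m * sqrt (rho m sg / mu m)
  end.

Definition km2 (m : medium) (a : wave) (sg : side) : R := / (k m a sg ^ 2).

Definition beta (m : medium) (a : wave) (sg : side) (xi : R) : C :=
  if Rle_dec (k m a sg) (Rabs xi)
  then RtoC (sqrt (xi ^ 2 - k m a sg ^ 2))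
  else (- Ci * RtoC (sqrt (k m a sg ^ 2 - xi ^ 2)))%C.

Definition Lambda (m : medium) (a : wave) (xi : R) : C :=
  (RtoC (km2 m a Up) * beta m a Up xi + RtoC (km2 m a Lo) * beta m a Lo xi)%C.

Definition delta (m : medium) (a : wave) : R := km2 m a Up - km2 m a Lo.

Definition C0 (m : medium) : R :=
  1 / (rho m Up * omega m ^ 2) - 1 / (rho m Lo * omega m ^ 2).

Definition Ddet (m : medium) (xi : R) : C :=
  (- (Lambda m Pw xi * Lambda m Sw xi)
   + RtoC (delta m Pw * delta m Sw * xi ^ 2))%C.

(* Amplitudes for a source point y with y2 > 0. *)
Definition ampA (m : medium) (a : wave) (j : coord) (xi y2 : R) : C :=
  let Ep := cexp (- beta m Pw Up xi * RtoC y2)%C in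
  let Es := cexp (- beta m Sw Up xi * RtoC y2)%C in
  let bp := beta m Pw Up xi in
  let bs := beta m Sw Up xi in
  let kp := RtoC (km2 m Pw Up) in
  let ks := RtoC (km2 m Sw Up) in
  let dp := RtoC (delta m Pw) in
  let ds := RtoC (delta m Sw) in
  let Lp := Lambda m Pw xi in
  let Ls := Lambda m Sw xi in
  let x := RtoC xi in
  let c := (RtoC (C0 m * xi) / Ddet m xi)%C in
  match a, j with
  | Pw, X1 => c * Ci * (ks * bs * Es - ds * kp * x ^ 2 / Lp * Ep)
  | Sw, X1 => c * (- (dp * ks * bs * x / Ls) * Es + kp * x * Ep)
  | Pw, X2 => c * (ks * x * Es - ds * kp * bp * x / Lp * Ep)
  | Sw, X2 => c * Ci * (dp * ks * x ^ 2 / Ls * Es - kp * bp * Ep)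
  end%C.

(* Amplitudes for a source point y with y2 < 0. *)
Definition ampB (m : medium) (a : wave) (j : coord) (xi y2 : R) : C :=
  let Ep := cexp (beta m Pw Lo xi * RtoC y2)%C in
  let Es := cexp (beta m Sw Lo xi * RtoC y2)%C in
  let bp := beta m Pw Lo xi in
  let bs := beta m Sw Lo xi in
  let kp := RtoC (km2 m Pw Lo) in
  let ks := RtoC (km2 m Sw Lo) in
  let dp := RtoC (delta m Pw) in
  let ds := RtoC (delta m Sw) in
  let Lp := Lambda m Pw xi in
  let Ls := Lambda m Sw xi in
  let x := RtoC xi in
  let c := (RtoC (C0 m * xi) / Ddet m xi)%C in
  match a, j with
  | Pw, X1 => c * Ci * (- (ks * bs) * Es - ds * kp * x ^ 2 / Lp * Ep)
  | Sw, X1 => c * (dp * ks * bs * x / Ls * Es + kp * x * Ep)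
  | Pw, X2 => c * (ks * x * Es + ds * kp * bp * x / Lp * Ep)
  | Sw, X2 => c * Ci * (dp * ks * x ^ 2 / Ls * Es + kp * bp * Ep)
  end%C.

(* The value at y2 = 0 carries no meaning: sources lie off the interface. *)
Definition amp (m : medium) (a : wave) (j : coord) (xi y2 : R) : C :=
  if Rlt_dec 0 y2 then ampA m a j xi y2 else ampB m a j xi y2.

(* Likewise the value at x2 = 0 carries no meaning. *)
Definition Uhat (m : medium) (a : wave) (j : coord) (xi x2 y2 : R) : C :=
  (amp m a j xi y2 *
   (if Rlt_dec 0 x2 then cexp (- beta m a Up xi * RtoC x2)
    else cexp (beta m a Lo xi * RtoC x2)))%C.

Definition Uintegrand (m : medium) (a : wave) (j : coord) (x y : R * R)
    (xi : R) : C :=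
  (Uhat m a j xi (snd x) (snd y) * cexp (Ci * RtoC ((fst x - fst y) * xi)))%C.

Definition U_converges (m : medium) (a : wave) (j : coord) (x y : R * R) : Prop :=
  ex_RInt_gen (V := C_R_NormedModule) (Uintegrand m a j x y)
    (Rbar_locally m_infty) (Rbar_locally p_infty).

(* A default value when U_converges fails. *)
Definition U (m : medium) (a : wave) (j : coord) (x y : R * R) : C :=
  (RtoC (1 / (2 * PI)) *
   RInt_gen (V := C_R_CompleteNormedModule) (Uintegrand m a j x y)
     (Rbar_locally m_infty) (Rbar_locally p_infty))%C.

Definition dir (theta : R) : R * R := (cos theta, sin theta).

Definition Uinf (m : medium) (a : wave) (j : coord) (xhat y : R * R) : C :=
  (cexp (Ci * RtoC (3 * PI / 4)) * RtoC (sqrt (k m a Lo / (2 * PI))) *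
   (RtoC (snd xhat) * amp m a j (k m a Lo * fst xhat) (snd y) *
    cexp (- Ci * RtoC (k m a Lo * fst y * fst xhat))))%C.

Definition slice (f : R * R -> C) (i : coord) (y : R * R) (t : R) : C :=
  match i with X1 => f (t, snd y) | X2 => f (fst y, t) end.

Definition pt (i : coord) (y : R * R) : R :=
  match i with X1 => fst y | X2 => snd y end.

Definition ex_grad (f : R * R -> C) (y : R * R) : Prop :=
  forall i, ex_derive (V := C_R_NormedModule) (slice f i y) (pt i y).

(* Coquelicot's Derive is for real-valued functions, hence the split into real
   and imaginary parts; the value is a default one when ex_grad fails. *)
Definition grad (f : R * R -> C) (y : R * R) (i : coord) : C :=
  (Derive (fun t => Re (slice f i y t)) (pt i y),
   Derive (fun t => Im (slice f i y t)) (pt i y)).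

Definition bigO_infty (f : R -> C) (g : R -> R) : Prop :=
  exists M : R, Rbar_locally p_infty (fun r => Cmod (f r) <= M * Rabs (g r)).

(* Main.v *)
Require Import Defs.
From Stdlib Require Import Reals Lra Lia FunctionalExtensionality.
From Coquelicot Require Import Coquelicot.
Open Scope R_scope.

(** The source enters only through an amplitude c, a function of the frequency
    xi: after collecting factors, U(x, y) is 1/(2 pi) times the integral of
    c(xi) E_r(xi), where

      E_r(xi) = exp (beta(xi) r sin theta + i r xi cos theta),

    beta is the square-root branch with wave number kap = k_(a,-), and the
    amplitude of the derivative of U in y_1 or y_2 is obtained from c by a
    factor - i xi or by multiplying each exponential exp (z(xi) y_2) in it by
    z(xi).  So one asymptotic statement, [farfield_asymptotics], applied to c
    and to its derivatives in y, gives the whole theorem.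

    For |xi| >= kap the kernel decays like exp (r sin theta (|xi| - kap)), which
    gives convergence and an error O(1/r).  For |xi| <= kap put xi = kap cos phi:
    the kernel becomes exp (i kap r cos (phi - phi0)) with phi0 = 2 pi - theta
    the only critical point in [0, pi].  The method of stationary phase then
    produces c(kap cos theta) times a Fresnel integral.

    The difficulty is that c has square-root singularities at all four wave
    numbers, and one of them may sit exactly at the critical point.  This is
    why the error is only r^(-3/4): that is the size of the integral of
    sqrt |t| exp (i r t^2).  To handle all positions at once, regularity of c is
    measured by a single increasing function V, the sum of xi and of signed
    square roots based at the branch points; c is Lipschitz with respect to V on
    bounded sets.  Functions of this kind form an algebra ([amplitude]), which
    makes the very explicit formulas for c harmless, and V is increasing and
    locally Hoelder of exponent 1/2, which is all that stationary phase uses: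
    the bounded variation controls the integral away from the critical point
    ([dominated_integral]), and the Hoelder bound, summed over dyadic pieces,
    controls it near the critical point ([singular_oscillation]).

    Two facts about the medium are needed.  The determinant D has no real zero
    ([Ddet_neq_0]): when some shear branch is oscillating, the imaginary parts
    of the two factors Lambda have one sign and force Lambda_p = 0, which the
    distinct densities exclude; when all branches are evanescent,
    Lambda_p Lambda_s exceeds delta_p delta_s xi^2 by a fixed amount
    ([Ddet_evanescent]).  And the value of the Fresnel integral at infinity has
    to be computed ([fresnel_limit]). *)

(** * Calculus of complex-valued functions of a real variable *)
Notation CInt f a b := (RInt (V := C_R_CompleteNormedModule) f a b).
Notation contC := (continuous (T := R_UniformSpace) (U := C_R_NormedModule)).

Lemma Cmod_sum_bound (z : C) : Cmod z <= Rabs (fst z) + Rabs (snd z).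
Proof.
  destruct z as [u v]; simpl.
  replace (u, v) with (RtoC u + Ci * RtoC v)%C.
  - eapply Rle_trans; [apply Cmod_triangle|].
    rewrite Cmod_mult, Cmod_Ci, !Cmod_R. lra.
  - unfold Ci, RtoC, Cplus, Cmult; simpl. f_equal; ring.
Qed.

Lemma Re_le_Cmod (z : C) : Rabs (fst z) <= Cmod z.
Proof. eapply Rle_trans; [|apply Rmax_Cmod]. apply Rmax_l. Qed.

Lemma Im_le_Cmod (z : C) : Rabs (snd z) <= Cmod z.
Proof. eapply Rle_trans; [|apply Rmax_Cmod]. apply Rmax_r. Qed.

Lemma Cmod_minus_sym (z w : C) : Cmod (z - w) = Cmod (w - z).
Proof. rewrite <- Cmod_opp. f_equal. ring. Qed.

Lemma contC_pair (f : R -> C) (x : R) :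
  continuous (fun t => fst (f t)) x -> continuous (fun t => snd (f t)) x ->
  contC f x.
Proof.
  intros H1 H2. unfold continuous.
  apply filterlim_locally. intros eps.
  generalize (filter_and _ _ (proj1 (filterlim_locally _ _) H1 eps)
    (proj1 (filterlim_locally _ _) H2 eps)).
  apply filter_imp. intros t [A B]. now split.
Qed.

Lemma contC_fst (f : R -> C) (x : R) : contC f x -> continuous (fun t => fst (f t)) x.
Proof.
  intros H. apply (continuous_comp f (fst : R * R -> R)); [exact H|].
  destruct (f x). apply continuous_fst.
Qed.

Lemma contC_snd (f : R -> C) (x : R) : contC f x -> continuous (fun t => snd (f t)) x.
Proof.
  intros H. apply (continuous_comp f (snd : R * R -> R)); [exact H|].
  destruct (f x). apply continuous_snd.
Qed.

Lemma contC_minus (f g : R -> C) (x : R) :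
  contC f x -> contC g x -> contC (fun t => f t - g t)%C x.
Proof. intros; now apply (continuous_minus (V := C_R_NormedModule)). Qed.

Lemma contC_mult (f g : R -> C) (x : R) :
  contC f x -> contC g x -> contC (fun t => f t * g t)%C x.
Proof.
  intros Hf Hg.
  pose proof (contC_fst _ _ Hf). pose proof (contC_snd _ _ Hf).
  pose proof (contC_fst _ _ Hg). pose proof (contC_snd _ _ Hg).
  apply contC_pair; simpl.
  - apply (continuous_minus (V := R_NormedModule));
      apply (continuous_mult (K := R_AbsRing)); assumption.
  - apply (continuous_plus (V := R_NormedModule));
      apply (continuous_mult (K := R_AbsRing)); assumption.
Qed.

Lemma contC_RtoC (f : R -> R) (x : R) : continuous f x -> contC (fun t => RtoC (f t)) x.
Proof. intros H. apply contC_pair; simpl; [exact H|apply continuous_const]. Qed.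

Lemma contC_const (c : C) (x : R) : contC (fun _ => c) x.
Proof. apply continuous_const. Qed.

Lemma continuous_derivable (f : R -> R) (x : R) : ex_derive f x -> continuous f x.
Proof. apply (ex_derive_continuous (K := R_AbsRing) (V := R_NormedModule)). Qed.

Lemma contC_cexp (f : R -> C) (x : R) : contC f x -> contC (fun t => cexp (f t)) x.
Proof.
  intros Hf.
  pose proof (contC_fst _ _ Hf) as H1. pose proof (contC_snd _ _ Hf) as H2.
  assert (He : continuous (fun t => exp (fst (f t))) x).
  { apply (continuous_comp (fun t => fst (f t)) exp); [exact H1|].
    apply continuous_derivable; auto_derive; auto. }
  apply contC_pair; simpl; apply (continuous_mult (K := R_AbsRing)); try exact He.
  - apply (continuous_comp (fun t => snd (f t)) cos); [exact H2|].
    apply continuous_derivable; auto_derive; auto.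
  - apply (continuous_comp (fun t => snd (f t)) sin); [exact H2|].
    apply continuous_derivable; auto_derive; auto.
Qed.

Lemma ex_CInt (f : R -> C) (a b : R) :
  (forall x, Rmin a b <= x <= Rmax a b -> contC f x) ->
  ex_RInt (V := C_R_CompleteNormedModule) f a b.
Proof. intros H. apply (ex_RInt_continuous (V := C_R_CompleteNormedModule)). exact H. Qed.

Lemma ex_CInt_le (f : R -> C) (a b : R) :
  a <= b -> (forall x, a <= x <= b -> contC f x) ->
  ex_RInt (V := C_R_CompleteNormedModule) f a b.
Proof.
  intros Hab H. apply ex_CInt. rewrite Rmin_left, Rmax_right by lra. exact H.
Qed.

Lemma CInt_bound (f : R -> C) (a b M : R) :
  a <= b -> (forall x, a <= x <= b -> contC f x) ->
  (forall x, a <= x <= b -> Cmod (f x) <= M) ->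
  Cmod (CInt f a b) <= M * (b - a).
Proof.
  intros Hab Hc HM. rewrite Rmult_comm, Cmod_norm.
  apply (norm_RInt_le_const (V := C_R_NormedModule) f a b); [exact Hab| |].
  - intros x Hx. rewrite <- Cmod_norm. now apply HM.
  - apply (RInt_correct (V := C_R_CompleteNormedModule)), ex_CInt_le; assumption.
Qed.

Lemma CInt_bound_fun (f : R -> C) (g : R -> R) (a b lg : R) :
  a <= b -> (forall x, a <= x <= b -> contC f x) ->
  (forall x, a <= x <= b -> Cmod (f x) <= g x) ->
  is_RInt g a b lg -> Cmod (CInt f a b) <= lg.
Proof.
  intros Hab Hc HM Hg. rewrite Cmod_norm.
  apply (norm_RInt_le (V := C_R_NormedModule) f g a b); [exact Hab| | |exact Hg].
  - intros x Hx. rewrite <- Cmod_norm. now apply HM.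
  - apply (RInt_correct (V := C_R_CompleteNormedModule)), ex_CInt_le; assumption.
Qed.

Lemma CInt_Chasles (f : R -> C) (a b c : R) :
  a <= b <= c -> (forall x, a <= x <= c -> contC f x) ->
  CInt f a c = (CInt f a b + CInt f b c)%C.
Proof.
  intros Hab Hc. symmetry.
  apply (RInt_Chasles (V := C_R_CompleteNormedModule)); apply ex_CInt_le; try lra;
    intros; apply Hc; lra.
Qed.

Lemma CInt_minus (f g : R -> C) (a b : R) :
  a <= b -> (forall x, a <= x <= b -> contC f x) ->
  (forall x, a <= x <= b -> contC g x) ->
  CInt (fun t => f t - g t)%C a b = (CInt f a b - CInt g a b)%C.
Proof.
  intros Hab Hf Hg.
  apply (RInt_minus (V := C_R_CompleteNormedModule)); apply ex_CInt_le; auto.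
Qed.

Lemma is_CInt_fst (f : R -> C) (a b : R) (l : C) :
  is_RInt (V := C_R_NormedModule) f a b l ->
  is_RInt (V := R_NormedModule) (fun t => fst (f t)) a b (fst l).
Proof. apply (is_RInt_fct_extend_fst (U := R_NormedModule) (V := R_NormedModule)). Qed.

Lemma is_CInt_snd (f : R -> C) (a b : R) (l : C) :
  is_RInt (V := C_R_NormedModule) f a b l ->
  is_RInt (V := R_NormedModule) (fun t => snd (f t)) a b (snd l).
Proof. apply (is_RInt_fct_extend_snd (U := R_NormedModule) (V := R_NormedModule)). Qed.

Lemma is_CInt_mult_l (c : C) (f : R -> C) (a b : R) (l : C) :
  is_RInt (V := C_R_NormedModule) f a b l ->
  is_RInt (V := C_R_NormedModule) (fun t => c * f t)%C a b (c * l)%C.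
Proof.
  intros H.
  pose proof (is_CInt_fst _ _ _ _ H) as H1. pose proof (is_CInt_snd _ _ _ _ H) as H2.
  apply (is_RInt_fct_extend_pair (U := R_NormedModule) (V := R_NormedModule)); simpl.
  - apply (is_RInt_minus (V := R_NormedModule));
      apply (is_RInt_scal (V := R_NormedModule)); assumption.
  - apply (is_RInt_plus (V := R_NormedModule));
      apply (is_RInt_scal (V := R_NormedModule)); assumption.
Qed.

Lemma CInt_mult_l (c : C) (f : R -> C) (a b : R) :
  ex_RInt (V := C_R_CompleteNormedModule) f a b ->
  CInt (fun t => c * f t)%C a b = (c * CInt f a b)%C.
Proof.
  intros H. apply (is_RInt_unique (V := C_R_CompleteNormedModule)).
  apply is_CInt_mult_l. now apply (RInt_correct (V := C_R_CompleteNormedModule)).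
Qed.

Lemma CInt_ext (f g : R -> C) (a b : R) :
  a <= b -> (forall x, a < x < b -> f x = g x) -> CInt f a b = CInt g a b.
Proof.
  intros Hab H. apply (RInt_ext (V := C_R_CompleteNormedModule)).
  rewrite Rmin_left, Rmax_right by lra. exact H.
Qed.

Lemma is_derive_pairC (f : R -> C) (x l1 l2 : R) :
  is_derive (fun t => fst (f t)) x l1 -> is_derive (fun t => snd (f t)) x l2 ->
  is_derive (K := R_AbsRing) (V := C_R_NormedModule) f x (l1, l2).
Proof.
  intros H1 H2.
  apply (filterdiff_ext (K := R_AbsRing) (U := R_NormedModule) (V := C_R_NormedModule)
     (fun t => (fst (f t), snd (f t)))).
  { intros t. now destruct (f t). }
  unfold is_derive.
  apply (filterdiff_comp'_2 (K := R_AbsRing) (T := R_NormedModule)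
     (U := R_NormedModule) (V := R_NormedModule) (W := C_R_NormedModule)
     (fun t => fst (f t)) (fun t => snd (f t)) (fun a b => (a, b)) x
     (fun y => scal y l1) (fun y => scal y l2) (fun a b => (a, b)) H1 H2).
  apply (filterdiff_ext (K := R_AbsRing)
    (U := prod_NormedModule R_AbsRing R_NormedModule R_NormedModule)
    (V := C_R_NormedModule) (fun t => t)).
  { now intros [u v]. }
  apply (filterdiff_ext_lin (K := R_AbsRing)
    (U := prod_NormedModule R_AbsRing R_NormedModule R_NormedModule)
    (V := C_R_NormedModule) (fun t => t) (fun t => t)).
  - apply filterdiff_id.
  - now intros [u v].
Qed.

Lemma is_derive_fstC (f : R -> C) (x : R) (l : C) :
  is_derive (K := R_AbsRing) (V := C_R_NormedModule) f x l ->
  is_derive (fun t => fst (f t)) x (fst l).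
Proof.
  intros H.
  apply (filterdiff_comp' (K := R_AbsRing) (U := R_NormedModule) (V := C_R_NormedModule)
    (W := R_NormedModule) f (fun z : C => fst z) x (fun y => scal y l) (fun z : C => fst z) H).
  apply (filterdiff_linear (K := R_AbsRing) (U := C_R_NormedModule) (V := R_NormedModule)).
  apply (is_linear_fst (K := R_AbsRing) (U := R_NormedModule) (V := R_NormedModule)).
Qed.

Lemma is_derive_sndC (f : R -> C) (x : R) (l : C) :
  is_derive (K := R_AbsRing) (V := C_R_NormedModule) f x l ->
  is_derive (fun t => snd (f t)) x (snd l).
Proof.
  intros H.
  apply (filterdiff_comp' (K := R_AbsRing) (U := R_NormedModule) (V := C_R_NormedModule)
    (W := R_NormedModule) f (fun z : C => snd z) x (fun y => scal y l) (fun z : C => snd z) H).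
  apply (filterdiff_linear (K := R_AbsRing) (U := C_R_NormedModule) (V := R_NormedModule)).
  apply (is_linear_snd (K := R_AbsRing) (U := R_NormedModule) (V := R_NormedModule)).
Qed.

Lemma CInt_derive (f df : R -> C) (a b : R) :
  a <= b ->
  (forall x, a <= x <= b ->
     is_derive (K := R_AbsRing) (V := C_R_NormedModule) f x (df x)) ->
  (forall x, a <= x <= b -> contC df x) ->
  CInt df a b = (f b - f a)%C.
Proof.
  intros Hab Hd Hc. apply (is_RInt_unique (V := C_R_CompleteNormedModule)).
  apply (is_RInt_derive (V := C_R_CompleteNormedModule));
    rewrite Rmin_left, Rmax_right by lra; assumption.
Qed.

(** * Oscillatory integrals with amplitudes of bounded variation *)
Definition dominated (F : R -> C) (W : R -> R) (a b : R) : Prop :=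
  forall s t, a <= s <= t -> t <= b -> Cmod (F t - F s) <= W t - W s.

(** The summand E (y - x) is of second order along a subdivision: telescoping
    over n equal pieces leaves it with a factor 1/n. *)
Lemma subdivision_bound (Q : R -> C) (W : R -> R) (a b M E : R) :
  a <= b -> 0 <= E ->
  (forall x y, a <= x <= y -> y <= b ->
     Cmod (Q y - Q x) <= (M + E * (y - x)) * (W y - W x)) ->
  Cmod (Q b - Q a) <= M * (W b - W a).
Proof.
  intros Hab HE H.
  assert (Hn : forall n : nat, (0 < n)%nat ->
    Cmod (Q b - Q a) <= (M + E * ((b - a) / INR n)) * (W b - W a)).
  { intros n Hn. assert (Hn' : 0 < INR n) by now apply lt_0_INR.
    set (h := (b - a) / INR n).
    assert (Hh : 0 <= h) by (apply Rmult_le_pos; [lra|left; now apply Rinv_0_lt_compat]).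
    assert (Hnh : INR n * h = b - a) by (unfold h; field; lra).
    assert (Hi : forall i : nat, (i <= n)%nat ->
      Cmod (Q (a + INR i * h) - Q a) <= (M + E * h) * (W (a + INR i * h) - W a)).
    { induction i as [|i IH]; intros Hi.
      - simpl. rewrite Rmult_0_l, Rplus_0_r.
        replace (Q a - Q a)%C with (RtoC 0) by ring. rewrite Cmod_0. lra.
      - assert (Hin : INR i + 1 <= INR n) by (rewrite <- S_INR; now apply le_INR).
        assert (Hi0 := pos_INR i).
        replace (Q (a + INR (S i) * h)%R - Q a)%C with
          ((Q (a + INR (S i) * h)%R - Q (a + INR i * h)%R) +
           (Q (a + INR i * h)%R - Q a))%C by ring.
        eapply Rle_trans; [apply Cmod_triangle|].
        assert (IH' := IH ltac:(lia)).
        assert (Hs := H (a + INR i * h) (a + INR (S i) * h)).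
        rewrite S_INR in *.
        replace (a + (INR i + 1) * h - (a + INR i * h)) with h in Hs by ring.
        assert (Hs' := Hs ltac:(nra) ltac:(nra)). lra. }
    specialize (Hi n (le_n n)). now replace (a + INR n * h) with b in Hi by lra. }
  apply le_epsilon. intros eps Heps.
  destruct (archimed_cor1 (eps / (E * (b - a) * Rabs (W b - W a) + 1))) as [n [Hn1 Hn2]].
  { apply Rdiv_lt_0_compat; [exact Heps|].
    assert (0 <= E * (b - a) * Rabs (W b - W a)); [|lra].
    apply Rmult_le_pos; [nra|apply Rabs_pos]. }
  eapply Rle_trans; [apply (Hn n Hn2)|].
  rewrite Rmult_plus_distr_r. apply Rplus_le_compat_l.
  set (P := E * (b - a) * Rabs (W b - W a)) in *.
  assert (HP : 0 <= P) by (apply Rmult_le_pos; [nra|apply Rabs_pos]).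
  assert (Hn0 : 0 < / INR n) by (apply Rinv_0_lt_compat, lt_0_INR; lia).
  assert (Hlt : / INR n * (P + 1) < eps).
  { apply (Rmult_lt_compat_r (P + 1)) in Hn1; [|lra].
    unfold Rdiv in Hn1. rewrite Rmult_assoc, Rinv_l in Hn1; lra. }
  assert (Ht : E * ((b - a) / INR n) * (W b - W a) <= / INR n * P).
  { unfold P, Rdiv.
    replace (E * ((b - a) * / INR n) * (W b - W a)) with
      ((/ INR n * (E * (b - a))) * (W b - W a)) by ring.
    rewrite <- (Rmult_assoc (/ INR n) (E * (b - a))).
    apply Rmult_le_compat_l; [|apply Rle_abs].
    apply Rmult_le_pos; [lra|nra]. }
  lra.
Qed.

(** Integration by parts against the variation of G, without Stieltjes
    integrals: the function Q below satisfies, up to a second-order term,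
    Q(y) - Q(x) = - (G(y) - G(x)) times the integral of e from y to b. *)
Lemma dominated_integral (G e : R -> C) (W : R -> R) (a b M E : R) :
  a <= b ->
  (forall t, a <= t <= b -> contC G t) -> (forall t, a <= t <= b -> contC e t) ->
  dominated G W a b ->
  (forall t, a <= t <= b -> Cmod (e t) <= E) ->
  (forall t, a <= t <= b -> Cmod (CInt e t b) <= M) ->
  Cmod (CInt (fun t => (G t - G a) * e t)%C a b) <= M * (W b - W a).
Proof.
  intros Hab HG He HW HE HM.
  set (Q := fun x => CInt (fun t => (G t - G x) * e t)%C x b).
  assert (Hc : forall x t, a <= t <= b -> contC (fun t => (G t - G x) * e t)%C t).
  { intros x t Ht. apply contC_mult; [|now apply He].
    apply contC_minus; [now apply HG|apply contC_const]. }
  assert (HE0 : 0 <= E) by (eapply Rle_trans; [apply Cmod_ge_0|apply (HE a); lra]).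
  replace (CInt (fun t => (G t - G a) * e t)%C a b) with (- (Q b - Q a))%C.
  2:{ unfold Q. rewrite (RInt_point (V := C_R_CompleteNormedModule) b).
      change (zero (G := C_R_CompleteNormedModule)) with (RtoC 0). ring. }
  rewrite Cmod_opp. apply (subdivision_bound Q W a b M E Hab HE0).
  intros x y Hxy Hyb.
  assert (Heq : (Q y - Q x)%C =
    (- (CInt (fun t => (G t - G x) * e t)%C x y + (G y - G x) * CInt e y b))%C).
  { unfold Q. rewrite (CInt_Chasles (fun t => (G t - G x) * e t)%C x y b).
    2: lra. 2: intros t Ht; apply Hc; lra.
    rewrite <- (CInt_mult_l (G y - G x)%C e y b).
    2: apply ex_CInt_le; [lra|]; intros; apply He; lra.
    replace (CInt (fun t => (G t - G y) * e t)%C y b) with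
      (CInt (fun t => (G t - G x) * e t)%C y b - CInt (fun t => (G y - G x) * e t)%C y b)%C.
    - ring.
    - rewrite <- CInt_minus; [|lra| |].
      + apply CInt_ext; [lra|]. intros. ring.
      + intros; apply Hc; lra.
      + intros; apply contC_mult; [apply contC_const|apply He; lra]. }
  rewrite Heq, Cmod_opp. eapply Rle_trans; [apply Cmod_triangle|].
  assert (HWxy := HW x y ltac:(lra) ltac:(lra)).
  (* The second-order term: G varies by at most W y - W x over a length y - x. *)
  assert (H1 : Cmod (CInt (fun t => (G t - G x) * e t)%C x y) <= ((W y - W x) * E) * (y - x)).
  { apply CInt_bound; [lra|intros; apply Hc; lra|].
    intros t Ht. rewrite Cmod_mult.
    assert (Hxt := HW x t ltac:(lra) ltac:(lra)).
    assert (Hty := HW t y ltac:(lra) ltac:(lra)).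
    assert (H0 := Cmod_ge_0 (G y - G t)).
    apply Rmult_le_compat; [apply Cmod_ge_0|apply Cmod_ge_0| |apply HE]; lra. }
  assert (H2 : Cmod ((G y - G x) * CInt e y b) <= (W y - W x) * M).
  { rewrite Cmod_mult. apply Rmult_le_compat; try apply Cmod_ge_0; [lra|apply HM; lra]. }
  lra.
Qed.

(** The kernel e stands for an oscillation with critical point 0, whose
    integrals over [s, t] are O(1/(r s)).  On [l/4^(n+1), l/4^n] the variation of
    H is O(2^(-n)) and the kernel integral is O(4^n/r), so that the pieces sum to
    O(2^n/r); on [0, l/4^n] the Hoelder bound gives 8^(-n).  The two balance when
    2^n is of the order of r^(1/4). *)
Lemma singular_oscillation (A Cw l : R) :
  0 < l -> 0 <= A -> 0 <= Cw ->
  exists M, forall (H e : R -> C) (W : R -> R) (r : R),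
  1 <= r ->
  (forall t, 0 <= t <= l -> contC H t) -> (forall t, 0 <= t <= l -> contC e t) ->
  dominated H W 0 l ->
  (forall t, 0 <= t <= l -> W t - W 0 <= Cw * sqrt t) ->
  (forall t, 0 <= t <= l -> Cmod (e t) <= 1) ->
  (forall s t, 0 < s <= t -> t <= l -> Cmod (CInt e s t) <= A / (r * s)) ->
  Cmod (CInt (fun t => (H t - H 0) * e t)%C 0 l) <= M * Rpower r (- (3 / 4)).
Proof.
  intros Hl HA HCw.
  set (K := 6 * A * Cw / sqrt l).
  exists (K + 8 * Cw * (l * sqrt l)).
  intros H e W r Hr HcH Hce HW HWs He HJ.
  assert (Hsl : 0 < sqrt l) by now apply sqrt_lt_R0.
  assert (HK : 0 <= K).
  { unfold K. apply Rmult_le_pos; [nra|left; now apply Rinv_0_lt_compat]. }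
  assert (Hc : forall x t, 0 <= t <= l -> contC (fun t => (H t - H x) * e t)%C t).
  { intros x t Ht. apply contC_mult; [|now apply Hce].
    apply contC_minus; [now apply HcH|apply contC_const]. }
  (* On each dyadic piece H is recentred at the left endpoint a. *)
  assert (Hdy : forall n : nat,
    Cmod (CInt (fun t => (H t - H 0) * e t)%C (l / 4 ^ n) l) <= K * 2 ^ n / r).
  { induction n as [|n IH].
    - simpl. replace (l / 1) with l by field.
      rewrite (RInt_point (V := C_R_CompleteNormedModule) l).
      change (zero (G := C_R_CompleteNormedModule)) with (RtoC 0). rewrite Cmod_0.
      apply Rmult_le_pos; [lra|left; apply Rinv_0_lt_compat; lra].
    - set (a := l / 4 ^ S n). set (b := l / 4 ^ n) in *.
      assert (H4 : 1 <= 4 ^ n) by (apply pow_R1_Rle; lra).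
      assert (Hab : b = 4 * a) by (unfold a, b; simpl; field; lra).
      assert (Ha : 0 < a) by (unfold a; apply Rdiv_lt_0_compat; simpl; lra).
      assert (Hbl : b <= l).
      { unfold b. apply Rmult_le_reg_r with (4 ^ n); [lra|].
        unfold Rdiv. rewrite Rmult_assoc, Rinv_l by lra. nra. }
      assert (Hsa : sqrt a = sqrt l / 2 ^ S n).
      { unfold a. replace (4 ^ S n) with (Rsqr (2 ^ S n)).
        2:{ unfold Rsqr. rewrite <- Rpow_mult_distr. replace (2 * 2) with 4 by ring. reflexivity. }
        rewrite sqrt_div_alt; [|apply Rlt_0_sqr, pow_nonzero; lra].
        rewrite sqrt_Rsqr; [reflexivity|apply pow_le; lra]. }
      assert (Hsb : sqrt b = 2 * sqrt a).
      { rewrite Hab, sqrt_mult by lra. f_equal. replace 4 with (2 * 2) by ring.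
        apply sqrt_square; lra. }
      assert (Hsa0 : 0 < sqrt a) by now apply sqrt_lt_R0.
      assert (Hsaa : sqrt a * sqrt a = a) by (apply sqrt_sqrt; lra).
      rewrite (CInt_Chasles _ a b l); [|lra|intros; apply Hc; lra].
      eapply Rle_trans; [apply Cmod_triangle|].
      assert (Hmid : Cmod (CInt (fun t => (H t - H 0) * e t)%C a b) <=
         3 * Cw * sqrt a * (A / (r * a))).
      { replace (CInt (fun t => (H t - H 0) * e t)%C a b) with
          (CInt (fun t => (H t - H a) * e t)%C a b + (H a - H 0) * CInt e a b)%C.
        2:{ rewrite <- CInt_mult_l; [|apply ex_CInt_le; [lra|]; intros; apply Hce; lra].
            replace (CInt (fun t => (H t - H a) * e t)%C a b) with
             (CInt (fun t => (H t - H 0) * e t)%C a b -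
              CInt (fun t => (H a - H 0) * e t)%C a b)%C.
            - ring.
            - rewrite <- CInt_minus; [|lra| |].
              + apply CInt_ext; [lra|]. intros. ring.
              + intros; apply Hc; lra.
              + intros; apply contC_mult; [apply contC_const|apply Hce; lra]. }
        assert (HJ0 : 0 <= A / (r * a)).
        { apply Rmult_le_pos; [lra|left; apply Rinv_0_lt_compat; nra]. }
        assert (Hwa := HWs a ltac:(lra)). assert (Hwb := HWs b ltac:(lra)).
        assert (Hd0 := HW 0 a ltac:(lra) ltac:(lra)).
        assert (Hm0 := Cmod_ge_0 (H a - H 0)).
        eapply Rle_trans; [apply Cmod_triangle|].
        assert (T1 : Cmod (CInt (fun t => (H t - H a) * e t)%C a b) <=
           A / (r * a) * (W b - W a)).
        { apply (dominated_integral H e W a b (A / (r * a)) 1).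
          - lra.
          - intros; apply HcH; lra.
          - intros; apply Hce; lra.
          - intros s t Hst Ht; apply HW; lra.
          - intros; apply He; lra.
          - intros t Ht. eapply Rle_trans; [apply HJ; lra|].
            apply Rmult_le_compat_l; [lra|]. apply Rinv_le_contravar; nra. }
        assert (T2 : Cmod ((H a - H 0) * CInt e a b) <= Cw * sqrt a * (A / (r * a))).
        { rewrite Cmod_mult. apply Rmult_le_compat; try apply Cmod_ge_0; [lra|].
          apply HJ; lra. }
        assert (T3 : A / (r * a) * (W b - W a) <= A / (r * a) * (2 * Cw * sqrt a)).
        { apply Rmult_le_compat_l; [exact HJ0|]. rewrite Hsb in Hwb. lra. }
        lra. }
      assert (Hmid' : 3 * Cw * sqrt a * (A / (r * a)) = K * 2 ^ n / r).
      { rewrite <- Hsaa at 2. rewrite Hsa. unfold K.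
        assert (2 ^ n <> 0) by (apply pow_nonzero; lra).
        simpl. field. repeat split; lra. }
      rewrite Hmid' in Hmid.
      replace (K * 2 ^ S n / r) with (K * 2 ^ n / r + K * 2 ^ n / r) by (simpl; field; lra).
      lra. }
  (* q = r^(1/4); the dyadic level n has 2^n <= q < 2^(n+1). *)
  set (q := Rpower r (1 / 4)).
  assert (Hq : 1 <= q).
  { unfold q. apply Rle_trans with (Rpower r 0); [rewrite Rpower_O; lra|].
    apply Rle_Rpower; lra. }
  assert (Hn : exists n : nat, 2 ^ n <= q < 2 ^ S n).
  { assert (Hex : exists N : nat, q < 2 ^ N).
    { destruct (Pow_x_infinity 2 ltac:(rewrite Rabs_pos_eq; lra) (q + 1)) as [N HN].
      exists N. specialize (HN N (le_n N)). rewrite Rabs_pos_eq in HN; [lra|apply pow_le; lra]. }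
    destruct Hex as [N HN]. revert HN. induction N as [|N IH]; intros HN.
    - simpl in HN. lra.
    - destruct (Rle_dec (2 ^ N) q) as [h|h]; [exists N; lra|apply IH; lra]. }
  destruct Hn as [n [Hn1 Hn2]].
  assert (Hq4 : q ^ 4 = r).
  { unfold q. rewrite <- Rpower_pow by apply exp_pos. rewrite Rpower_mult.
    replace (1 / 4 * INR 4) with 1 by (simpl; field). apply Rpower_1; lra. }
  assert (Hq3 : Rpower r (- (3 / 4)) = / q ^ 3).
  { unfold q. rewrite <- Rpower_pow by apply exp_pos. rewrite Rpower_mult, Rpower_Ropp.
    f_equal. f_equal. simpl; field. }
  assert (H2n : 1 <= 2 ^ n) by (apply pow_R1_Rle; lra).
  assert (H4n : 4 ^ n = 2 ^ n * 2 ^ n).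
  { rewrite <- Rpow_mult_distr. replace (2 * 2) with 4 by ring. reflexivity. }
  set (a := l / 4 ^ n) in *.
  assert (H4p : 1 <= 4 ^ n) by (apply pow_R1_Rle; lra).
  assert (Ha : 0 < a) by (unfold a; apply Rdiv_lt_0_compat; lra).
  assert (Hal : a <= l).
  { unfold a. apply Rmult_le_reg_r with (4 ^ n); [lra|].
    unfold Rdiv. rewrite Rmult_assoc, Rinv_l by lra. nra. }
  rewrite (CInt_Chasles _ 0 a l); [|lra|intros; apply Hc; lra].
  eapply Rle_trans; [apply Cmod_triangle|].
  specialize (Hdy n). fold a in Hdy.
  assert (Hsa : sqrt a = sqrt l / 2 ^ n).
  { unfold a. replace (4 ^ n) with (Rsqr (2 ^ n)) by (rewrite H4n; reflexivity).
    rewrite sqrt_div_alt; [|apply Rlt_0_sqr, Rgt_not_eq, pow_lt; lra].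
    rewrite sqrt_Rsqr; [reflexivity|apply pow_le; lra]. }
  assert (Hnear : Cmod (CInt (fun t => (H t - H 0) * e t)%C 0 a) <= (Cw * sqrt a) * (a - 0)).
  { apply CInt_bound; [lra|intros; apply Hc; lra|].
    intros t Ht. rewrite Cmod_mult.
    assert (Hd := HW 0 t ltac:(lra) ltac:(lra)). assert (Hw := HWs t ltac:(lra)).
    assert (Hs : sqrt t <= sqrt a) by (apply sqrt_le_1; lra).
    replace (Cw * sqrt a) with (Cw * sqrt a * 1) by ring.
    apply Rmult_le_compat; try apply Cmod_ge_0; [|apply He; lra]. nra. }
  rewrite Hq3.
  assert (Hq3p : 0 < q ^ 3) by (apply pow_lt; lra).
  assert (B1 : K * 2 ^ n / r <= K * / q ^ 3).
  { unfold Rdiv. rewrite Rmult_assoc. apply Rmult_le_compat_l; [exact HK|].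
    rewrite <- Hq4. replace (/ q ^ 3) with (q * / q ^ 4) by (field; lra).
    apply Rmult_le_compat_r; [|exact Hn1]. left; apply Rinv_0_lt_compat, pow_lt; lra. }
  assert (B2 : Cw * sqrt a * (a - 0) <= 8 * Cw * (l * sqrt l) * / q ^ 3).
  { rewrite Hsa. unfold a. rewrite H4n.
    replace (Cw * (sqrt l / 2 ^ n) * (l / (2 ^ n * 2 ^ n) - 0)) with
      (8 * Cw * (l * sqrt l) * / (2 * 2 ^ n) ^ 3) by (field; lra).
    apply Rmult_le_compat_l; [repeat apply Rmult_le_pos; lra|].
    apply Rinv_le_contravar; [exact Hq3p|]. apply pow_incr. simpl in Hn2; lra. }
  lra.
Qed.

(** * The Fresnel integral *)
Lemma sin_lipschitz (u v : R) : Rabs (sin u - sin v) <= Rabs (u - v).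
Proof.
  rewrite <- (Rmult_1_l (Rabs (u - v))).
  apply (bounded_variation sin cos 1 v u). intros t _. split.
  - auto_derive; [exact I|ring].
  - apply Rabs_le. generalize (COS_bound t); lra.
Qed.

Lemma cos_lipschitz (u v : R) : Rabs (cos u - cos v) <= Rabs (u - v).
Proof.
  rewrite <- (Rmult_1_l (Rabs (u - v))).
  apply (bounded_variation cos (fun t => - sin t) 1 v u). intros t _. split.
  - auto_derive; [exact I|ring].
  - apply Rabs_le. generalize (SIN_bound t); lra.
Qed.

Definition cis (t : R) : C := (cos t, sin t).

Lemma Cmod_cis (t : R) : Cmod (cis t) = 1.
Proof.
  unfold Cmod, cis; simpl fst; simpl snd. rewrite <- !Rsqr_pow2, Rplus_comm, sin2_cos2.
  apply sqrt_1.
Qed.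

Lemma cis_plus (s t : R) : cis (s + t) = (cis s * cis t)%C.
Proof.
  unfold cis, Cmult; simpl. rewrite cos_plus, sin_plus. f_equal; ring.
Qed.

Lemma contC_cis (f : R -> R) (x : R) : continuous f x -> contC (fun t => cis (f t)) x.
Proof.
  intros Hf. apply contC_pair; simpl.
  - apply (continuous_comp f cos); [exact Hf|]. apply continuous_derivable; auto_derive; auto.
  - apply (continuous_comp f sin); [exact Hf|]. apply continuous_derivable; auto_derive; auto.
Qed.

Definition fresnel (x : R) : C := CInt (fun t => cis (- t ^ 2)) 0 x.

Lemma contC_fresnel_kernel (x : R) : contC (fun t => cis (- t ^ 2)) x.
Proof. apply contC_cis, continuous_derivable. auto_derive; auto. Qed.

Lemma fresnel_diff (x y : R) : 0 <= x <= y ->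
  (fresnel y - fresnel x)%C = CInt (fun t => cis (- t ^ 2)) x y.
Proof.
  intros H. unfold fresnel.
  rewrite (CInt_Chasles _ 0 x y); [ring|lra|intros; apply contC_fresnel_kernel].
Qed.

(** Integration by parts: exp (- i t^2) is the derivative of
    i exp (- i t^2)/(2 t) plus q(t) with |q(t)| = 1/(2 t^2).  The constant 1 in
    the bound matters in [fresnel_re_pos]. *)
Lemma fresnel_tail (x y : R) : 0 < x <= y -> Cmod (fresnel y - fresnel x) <= / x.
Proof.
  intros H. rewrite fresnel_diff by lra.
  set (P := fun t => (RtoC (/ (2 * t)) * (Ci * cis (- t ^ 2)))%C).
  set (q := fun t => (RtoC (/ (2 * t ^ 2)) * (Ci * cis (- t ^ 2)))%C).
  assert (Hq : forall t, x <= t <= y -> contC q t).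
  { intros t Ht. apply contC_mult.
    - apply contC_RtoC, continuous_derivable. auto_derive. nra.
    - apply contC_mult; [apply contC_const|apply contC_fresnel_kernel]. }
  assert (HP : CInt (fun t => cis (- t ^ 2) - q t)%C x y = (P y - P x)%C).
  { apply CInt_derive; [lra| |].
    - intros t Ht.
      replace (cis (- t ^ 2) - q t)%C with
        (cos (- t ^ 2) + sin (- t ^ 2) / (2 * t ^ 2),
         sin (- t ^ 2) - cos (- t ^ 2) / (2 * t ^ 2)).
      2:{ unfold q, cis, Cminus, Cplus, Cmult, Copp, Ci, RtoC; simpl.
          f_equal; field; lra. }
      apply is_derive_pairC; unfold P, cis, Cmult, Ci, RtoC; simpl.
      + auto_derive; [lra|]. field. lra.
      + auto_derive; [lra|]. field. lra.
    - intros t Ht. apply contC_minus; [apply contC_fresnel_kernel|now apply Hq]. }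
  rewrite CInt_minus in HP; [|lra|intros; apply contC_fresnel_kernel|exact Hq].
  replace (CInt (fun t => cis (- t ^ 2)) x y) with (P y - P x + CInt q x y)%C
    by (rewrite <- HP; ring).
  assert (HmP : forall t, 0 < t -> Cmod (P t) = / (2 * t)).
  { intros t Ht. unfold P. rewrite !Cmod_mult, Cmod_Ci, Cmod_cis, Cmod_R, Rabs_pos_eq; [ring|].
    left; apply Rinv_0_lt_compat; lra. }
  assert (Hmq : Cmod (CInt q x y) <= / 2 * / x - / 2 * / y).
  { apply (CInt_bound_fun q (fun t => / (2 * t ^ 2))); [lra|exact Hq| |].
    - intros t Ht. unfold q. rewrite !Cmod_mult, Cmod_Ci, Cmod_cis, Cmod_R, Rabs_pos_eq; [lra|].
      left; apply Rinv_0_lt_compat; nra.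
    - replace (/ 2 * / x - / 2 * / y) with (- / (2 * y) - - / (2 * x)) by (field; lra).
      apply (is_RInt_derive (V := R_CompleteNormedModule) (fun t => - / (2 * t)));
        rewrite Rmin_left, Rmax_right by lra; intros t Ht.
      + auto_derive; [lra|]. field; lra.
      + apply continuous_derivable. auto_derive. nra. }
  eapply Rle_trans; [apply Cmod_triangle|].
  eapply Rle_trans; [apply Rplus_le_compat_r, Cmod_triangle|].
  rewrite Cmod_opp, !HmP by lra.
  replace (/ (2 * y)) with (/ 2 * / y) by (field; lra).
  replace (/ (2 * x)) with (/ 2 * / x) by (field; lra). lra.
Qed.

Lemma fresnel_bound (x : R) : 0 <= x -> Cmod (fresnel x) <= 2.
Proof.
  intros Hx.
  assert (H1 : forall y, 0 <= y -> Cmod (fresnel y) <= y).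
  { intros y Hy. unfold fresnel. replace y with (1 * (y - 0)) at 2 by ring.
    apply CInt_bound; [lra|intros; apply contC_fresnel_kernel|].
    intros; rewrite Cmod_cis; lra. }
  destruct (Rle_dec x 1) as [h|h]; [specialize (H1 x Hx); lra|].
  replace (fresnel x) with (fresnel x - fresnel 1 + fresnel 1)%C by ring.
  eapply Rle_trans; [apply Cmod_triangle|].
  generalize (fresnel_tail 1 x ltac:(lra)) (H1 1 ltac:(lra)). lra.
Qed.

Lemma cos_ge_parabola (u : R) : 1 - u ^ 2 / 2 <= cos u.
Proof.
  replace u with (2 * (u / 2)) at 2 by field. rewrite cos_2a_sin.
  assert (H := sin_lipschitz (u / 2) 0). rewrite sin_0, !Rminus_0_r in H.
  assert (H2 := Rsqr_le_abs_1 _ _ H). unfold Rsqr in H2. nra.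
Qed.

(** Selects the right square root in [fresnel_limit].  At 6/5 the real part is
    at least 6/5 - (6/5)^5/10 > 0.95, and by [fresnel_tail] it moves by at most
    5/6 afterwards. *)
Lemma fresnel_re_pos (x : R) : 6 / 5 <= x -> 0 <= fst (fresnel x).
Proof.
  intros Hx.
  assert (H1 : 9 / 10 <= fst (fresnel (6 / 5))).
  { assert (Hc := RInt_correct (V := C_R_CompleteNormedModule) (fun t => cis (- t ^ 2)) 0 (6 / 5)
      ltac:(apply ex_CInt; intros; apply contC_fresnel_kernel)).
    apply is_CInt_fst in Hc. simpl in Hc.
    (* Compare cos (t^2) with 1 - t^4/2. *)
    assert (Hp : is_RInt (fun t => 1 - (- t ^ 2) ^ 2 / 2) 0 (6 / 5)
       (6 / 5 - (6 / 5) ^ 5 / 10 - (0 - 0 ^ 5 / 10))).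
    { apply (is_RInt_derive (V := R_CompleteNormedModule) (fun t => t - t ^ 5 / 10)); intros t Ht.
      - auto_derive; [exact I|]. field.
      - apply continuous_derivable. auto_derive. exact I. }
    assert (Hle := is_RInt_le _ _ 0 (6 / 5) _ _ ltac:(lra) Hp Hc).
    eapply Rle_trans; [|apply Hle].
    - lra.
    - intros t Ht. apply cos_ge_parabola. }
  assert (H2 := fresnel_tail (6 / 5) x ltac:(lra)).
  assert (H3 := Re_le_Cmod (fresnel x - fresnel (6 / 5))).
  assert (H4 : fst (fresnel x - fresnel (6 / 5))%C = fst (fresnel x) - fst (fresnel (6 / 5)))
    by reflexivity.
  rewrite H4 in H3. apply Rabs_le_between in H3. lra.
Qed.

(** The square of [fresnel] is, up to constants, this integral, as for the
    classical evaluation of the Gaussian integral; see [fresnel_sqr]. *)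
Definition fresnel_aux (x : R) : C :=
  CInt (fun u => RtoC (/ (1 + u ^ 2)) * cis (- x ^ 2 * (1 + u ^ 2)))%C 0 1.

Lemma contC_fresnel_aux (x u : R) :
  contC (fun u => RtoC (/ (1 + u ^ 2)) * cis (- x ^ 2 * (1 + u ^ 2)))%C u.
Proof.
  apply contC_mult.
  - apply contC_RtoC, continuous_derivable. auto_derive. nra.
  - apply contC_cis, continuous_derivable. auto_derive. auto.
Qed.

Lemma fresnel_ex (x : R) : ex_RInt (V := C_R_CompleteNormedModule) (fun t => cis (- t ^ 2)) 0 x.
Proof. apply ex_CInt; intros; apply contC_fresnel_kernel. Qed.

Lemma fresnel_fst (x : R) : fst (fresnel x) = RInt (fun t => cos (- t ^ 2)) 0 x.
Proof.
  symmetry. apply (is_RInt_unique (V := R_CompleteNormedModule)).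
  apply (is_CInt_fst (fun t => cis (- t ^ 2))).
  apply (RInt_correct (V := C_R_CompleteNormedModule)), fresnel_ex.
Qed.

Lemma fresnel_snd (x : R) : snd (fresnel x) = RInt (fun t => sin (- t ^ 2)) 0 x.
Proof.
  symmetry. apply (is_RInt_unique (V := R_CompleteNormedModule)).
  apply (is_CInt_snd (fun t => cis (- t ^ 2))).
  apply (RInt_correct (V := C_R_CompleteNormedModule)), fresnel_ex.
Qed.

Lemma cos_sq_ex (x : R) : ex_RInt (fun t => cos (- t ^ 2)) 0 x.
Proof.
  apply (ex_RInt_continuous (V := R_CompleteNormedModule)). intros.
  apply continuous_derivable. auto_derive. auto.
Qed.

Lemma sin_sq_ex (x : R) : ex_RInt (fun t => sin (- t ^ 2)) 0 x.
Proof.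
  apply (ex_RInt_continuous (V := R_CompleteNormedModule)). intros.
  apply continuous_derivable. auto_derive. auto.
Qed.

Lemma is_derive_fresnel_fst (x : R) :
  is_derive (fun x => fst (fresnel x)) x (cos (- x ^ 2)).
Proof.
  apply (is_derive_ext (fun x => RInt (fun t => cos (- t ^ 2)) 0 x));
    [intros; now rewrite fresnel_fst|].
  apply (is_derive_RInt (V := R_NormedModule) (fun t => cos (- t ^ 2)) _ 0 x).
  - apply filter_forall. intros y. apply (RInt_correct (V := R_CompleteNormedModule)), cos_sq_ex.
  - apply continuous_derivable. auto_derive. auto.
Qed.

Lemma is_derive_fresnel_snd (x : R) :
  is_derive (fun x => snd (fresnel x)) x (sin (- x ^ 2)).
Proof.
  apply (is_derive_ext (fun x => RInt (fun t => sin (- t ^ 2)) 0 x));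
    [intros; now rewrite fresnel_snd|].
  apply (is_derive_RInt (V := R_NormedModule) (fun t => sin (- t ^ 2)) _ 0 x).
  - apply filter_forall. intros y. apply (RInt_correct (V := R_CompleteNormedModule)), sin_sq_ex.
  - apply continuous_derivable. auto_derive. auto.
Qed.

Lemma continuity_pt_derivable (f : R -> R) (x : R) : ex_derive f x -> continuity_pt f x.
Proof. intros H. apply continuity_pt_filterlim. now apply continuous_derivable. Qed.

Lemma continuity_2d_pt_phase (f : R -> R) (u v : R) :
  (forall t, continuity_pt f t) ->
  continuity_2d_pt (fun u v => f (- u ^ 2 * (1 + v ^ 2))) u v.
Proof.
  intros Hf. apply (continuity_1d_2d_pt_comp f (fun u v => - u ^ 2 * (1 + v ^ 2))); [apply Hf|].
  apply continuity_2d_pt_mult.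
  - apply continuity_2d_pt_opp. apply (continuity_1d_2d_pt_comp (fun t => t ^ 2) (fun u v => u)).
    + apply continuity_pt_derivable. auto_derive; auto.
    + apply continuity_2d_pt_id1.
  - apply (continuity_1d_2d_pt_comp (fun t => 1 + t ^ 2) (fun u v => v)).
    + apply continuity_pt_derivable. auto_derive; auto.
    + apply continuity_2d_pt_id2.
Qed.

(** Differentiation under the integral sign cancels the denominator 1 + u^2, and
    the substitution t = x u turns the rest into an integral up to x.  Here g is
    the derivative of f; the lemma serves for f = cos and f = sin. *)
Lemma is_derive_fresnel_aux (f g : R -> R) (x : R) :
  (forall t, is_derive f t (g t)) -> (forall t, continuous g t) ->
  is_derive (fun x => RInt (fun u => / (1 + u ^ 2) * f (- x ^ 2 * (1 + u ^ 2))) 0 1) x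
    (-2 * RInt (fun t => g (- x ^ 2 + - t ^ 2)) 0 x).
Proof.
  intros Hf Hg.
  assert (Hd : forall z v, is_derive (fun z => / (1 + v ^ 2) * f (- z ^ 2 * (1 + v ^ 2))) z
     (-2 * z * g (- z ^ 2 * (1 + v ^ 2)))).
  { intros z v.
    replace (-2 * z * g (- z ^ 2 * (1 + v ^ 2))) with
      (/ (1 + v ^ 2) * ((- (2 * z) * (1 + v ^ 2)) * g (- z ^ 2 * (1 + v ^ 2)))) by (field; nra).
    apply (is_derive_scal (fun z => f (- z ^ 2 * (1 + v ^ 2)))).
    apply (is_derive_comp (K := R_AbsRing) (V := R_NormedModule) f
      (fun z => - z ^ 2 * (1 + v ^ 2)) z (g (- z ^ 2 * (1 + v ^ 2))) (- (2 * z) * (1 + v ^ 2)));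
      [apply Hf|].
    auto_derive; [exact I|ring]. }
  assert (Hcf : forall t, continuous f t).
  { intros t. apply continuous_derivable. exists (g t). apply Hf. }
  replace (-2 * RInt (fun t => g (- x ^ 2 + - t ^ 2)) 0 x) with
    (RInt (fun u => Derive (fun z => / (1 + u ^ 2) * f (- z ^ 2 * (1 + u ^ 2))) x) 0 1).
  - apply (is_derive_RInt_param (fun z u => / (1 + u ^ 2) * f (- z ^ 2 * (1 + u ^ 2)))).
    + apply filter_forall. intros z t _. eexists. apply Hd.
    + intros t _. apply continuity_2d_pt_ext with (fun u v => -2 * u * g (- u ^ 2 * (1 + v ^ 2))).
      { intros u v. symmetry. apply is_derive_unique, Hd. }
      apply continuity_2d_pt_mult.
      * apply (continuity_1d_2d_pt_comp (fun t => -2 * t) (fun u v => u)).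
        -- apply continuity_pt_derivable. auto_derive; auto.
        -- apply continuity_2d_pt_id1.
      * apply continuity_2d_pt_phase. intros s. apply continuity_pt_filterlim, Hg.
    + apply filter_forall. intros z. apply (ex_RInt_continuous (V := R_CompleteNormedModule)).
      intros u _. apply (continuous_mult (K := R_AbsRing)).
      * apply continuous_derivable. auto_derive. nra.
      * apply (continuous_comp (fun u => - z ^ 2 * (1 + u ^ 2)) f); [|apply Hcf].
        apply continuous_derivable. auto_derive; auto.
  - assert (Hgx : forall t, continuous (fun t => g (- x ^ 2 + - t ^ 2)) t).
    { intros t. apply (continuous_comp (fun t => - x ^ 2 + - t ^ 2) g); [|apply Hg].
      apply continuous_derivable. auto_derive; auto. }
    rewrite (RInt_ext _ (fun u => scal (-2) (scal x (g (- x ^ 2 + - (x * u + 0) ^ 2))))).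
    2:{ intros u _. etransitivity; [apply is_derive_unique, Hd|].
        unfold scal; simpl; unfold mult; simpl.
        replace (- (x * (x * 1)) + - ((x * u + 0) * ((x * u + 0) * 1))) with
          (- (x * (x * 1)) * (1 + u * (u * 1))) by ring. ring. }
    rewrite (RInt_scal (V := R_CompleteNormedModule)).
    + apply (f_equal (Rmult (-2))). etransitivity.
      1: apply (RInt_comp_lin (V := R_CompleteNormedModule) (fun t => g (- x ^ 2 + - t ^ 2)) x 0 0 1).
      * apply (ex_RInt_continuous (V := R_CompleteNormedModule)). intros; apply Hgx.
      * replace (x * 0 + 0) with 0 by ring. replace (x * 1 + 0) with x by ring. reflexivity.
    + apply (ex_RInt_continuous (V := R_CompleteNormedModule)). intros u _.
      apply (continuous_mult (K := R_AbsRing) (fun _ => x)); [apply continuous_const|].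
      apply (continuous_comp (fun u => x * u + 0) (fun t => g (- x ^ 2 + - t ^ 2))); [|apply Hgx].
      apply continuous_derivable. auto_derive; auto.
Qed.

Lemma RInt_cos_shift (c x : R) :
  RInt (fun t => cos (c + - t ^ 2)) 0 x =
  cos c * fst (fresnel x) - sin c * snd (fresnel x).
Proof.
  rewrite fresnel_fst, fresnel_snd. apply (is_RInt_unique (V := R_CompleteNormedModule)).
  apply (is_RInt_ext (fun t => minus (scal (cos c) (cos (- t ^ 2))) (scal (sin c) (sin (- t ^ 2))))).
  { intros t _. now rewrite cos_plus. }
  apply (is_RInt_minus (V := R_NormedModule)); apply (is_RInt_scal (V := R_NormedModule));
    apply (RInt_correct (V := R_CompleteNormedModule)); [apply cos_sq_ex|apply sin_sq_ex].
Qed.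

Lemma RInt_sin_shift (c x : R) :
  RInt (fun t => sin (c + - t ^ 2)) 0 x =
  sin c * fst (fresnel x) + cos c * snd (fresnel x).
Proof.
  rewrite fresnel_fst, fresnel_snd. apply (is_RInt_unique (V := R_CompleteNormedModule)).
  apply (is_RInt_ext (fun t => plus (scal (sin c) (cos (- t ^ 2))) (scal (cos c) (sin (- t ^ 2))))).
  { intros t _. now rewrite sin_plus. }
  apply (is_RInt_plus (V := R_NormedModule)); apply (is_RInt_scal (V := R_NormedModule));
    apply (RInt_correct (V := R_CompleteNormedModule)); [apply cos_sq_ex|apply sin_sq_ex].
Qed.

Lemma fresnel_aux_is (x : R) : is_RInt (V := C_R_NormedModule)
  (fun u => RtoC (/ (1 + u ^ 2)) * cis (- x ^ 2 * (1 + u ^ 2)))%C 0 1 (fresnel_aux x).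
Proof.
  apply (RInt_correct (V := C_R_CompleteNormedModule)), ex_CInt.
  intros; apply contC_fresnel_aux.
Qed.

Lemma is_derive_fresnel_aux_fst (x : R) :
  is_derive (fun x => fst (fresnel_aux x)) x
    (2 * (sin (- x ^ 2) * fst (fresnel x) + cos (- x ^ 2) * snd (fresnel x))).
Proof.
  apply (is_derive_ext
    (fun x => RInt (fun u => / (1 + u ^ 2) * cos (- x ^ 2 * (1 + u ^ 2))) 0 1)).
  { intros t. apply (is_RInt_unique (V := R_CompleteNormedModule)).
    apply (is_RInt_ext (V := R_NormedModule) (fun u => fst
       (RtoC (/ (1 + u ^ 2)) * cis (- t ^ 2 * (1 + u ^ 2)))%C)).
    { intros u _. simpl. ring. }
    apply is_CInt_fst, fresnel_aux_is. }
  replace (2 * (sin (- x ^ 2) * fst (fresnel x) + cos (- x ^ 2) * snd (fresnel x))) with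
    (-2 * RInt (fun t => - sin (- x ^ 2 + - t ^ 2)) 0 x).
  - apply (is_derive_fresnel_aux cos (fun t => - sin t)).
    + intros t. auto_derive; [exact I|ring].
    + intros t. apply continuous_derivable. auto_derive; auto.
  - rewrite <- RInt_sin_shift.
    rewrite (RInt_opp (V := R_CompleteNormedModule) (fun t => sin (- x ^ 2 + - t ^ 2))).
    + change (opp (G := R_CompleteNormedModule)) with Ropp. ring.
    + apply (ex_RInt_continuous (V := R_CompleteNormedModule)). intros.
      apply continuous_derivable. auto_derive. auto.
Qed.

Lemma is_derive_fresnel_aux_snd (x : R) :
  is_derive (fun x => snd (fresnel_aux x)) x
    (-2 * (cos (- x ^ 2) * fst (fresnel x) - sin (- x ^ 2) * snd (fresnel x))).
Proof.
  apply (is_derive_ext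
    (fun x => RInt (fun u => / (1 + u ^ 2) * sin (- x ^ 2 * (1 + u ^ 2))) 0 1)).
  { intros t. apply (is_RInt_unique (V := R_CompleteNormedModule)).
    apply (is_RInt_ext (V := R_NormedModule) (fun u => snd
       (RtoC (/ (1 + u ^ 2)) * cis (- t ^ 2 * (1 + u ^ 2)))%C)).
    { intros u _. simpl. ring. }
    apply is_CInt_snd, fresnel_aux_is. }
  rewrite <- RInt_cos_shift.
  apply (is_derive_fresnel_aux sin cos).
  - intros t. auto_derive; [exact I|ring].
  - intros t. apply continuous_derivable. auto_derive; auto.
Qed.

Lemma fresnel_aux_0 : fresnel_aux 0 = (PI / 4, 0).
Proof.
  unfold fresnel_aux. rewrite <- atan_1.
  apply (is_RInt_unique (V := C_R_CompleteNormedModule)).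
  replace (atan 1, 0) with (minus (G := C_R_NormedModule) (RtoC (atan 1)) (RtoC (atan 0))).
  2:{ rewrite atan_0. unfold minus, plus, opp, RtoC; simpl. unfold prod_plus, prod_opp; simpl.
      unfold plus, opp; simpl. f_equal; ring. }
  apply (is_RInt_derive (V := C_R_CompleteNormedModule) (fun u => RtoC (atan u))).
  - intros u _.
    replace (RtoC (/ (1 + u ^ 2)) * cis (- 0 ^ 2 * (1 + u ^ 2)))%C with (/ (1 + u ^ 2), 0).
    2:{ unfold cis. replace (- 0 ^ 2 * (1 + u ^ 2)) with 0 by ring. rewrite cos_0, sin_0.
        unfold RtoC, Cmult; simpl. f_equal; ring. }
    apply is_derive_pairC; simpl.
    + auto_derive; [exact I|]. unfold Rsqr. field. nra.
    + apply (is_derive_const (K := R_AbsRing) (V := R_NormedModule)).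
  - intros u _. apply contC_fresnel_aux.
Qed.

Lemma const_of_derive_0 (f : R -> R) (x : R) : (forall t, is_derive f t 0) -> f x = f 0.
Proof.
  intros H. assert (Hb := bounded_variation f (fun _ => 0) 0 0 x).
  assert (Hle : Rabs (f x - f 0) <= 0 * Rabs (x - 0)).
  { apply Hb. intros t _. split; [apply H|]. rewrite Rabs_R0. lra. }
  assert (H0 := Rabs_pos (f x - f 0)). rewrite Rmult_0_l in Hle.
  assert (f x - f 0 = 0) by (apply Rabs_eq_0; lra). lra.
Qed.

Lemma fresnel_0 : fresnel 0 = RtoC 0.
Proof. apply (RInt_point (V := C_R_CompleteNormedModule)). Qed.

(** Both sides have the same derivative, 2 exp (- i x^2) times [fresnel] x, and
    they agree at 0 because the integral of 1/(1 + u^2) over [0, 1] is pi/4. *)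
Lemma fresnel_sqr (x : R) :
  (fresnel x * fresnel x)%C = (Ci * fresnel_aux x - Ci * RtoC (PI / 4))%C.
Proof.
  assert (H1 : fst (fresnel x) * fst (fresnel x) - snd (fresnel x) * snd (fresnel x)
     + snd (fresnel_aux x) = 0).
  { rewrite (const_of_derive_0 (fun x => fst (fresnel x) * fst (fresnel x)
       - snd (fresnel x) * snd (fresnel x) + snd (fresnel_aux x)) x).
    - rewrite fresnel_0, fresnel_aux_0. simpl. ring.
    - intros t.
      assert (D1 := is_derive_fresnel_fst t). assert (D2 := is_derive_fresnel_snd t).
      assert (D3 := is_derive_fresnel_aux_snd t).
      evar (l : R). replace 0 with l; unfold l.
      + apply (is_derive_plus (K := R_AbsRing) (V := R_NormedModule)); [|exact D3].
        apply (is_derive_minus (K := R_AbsRing) (V := R_NormedModule)).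
        * apply (is_derive_mult (fun x => fst (fresnel x)) (fun x => fst (fresnel x)) t _ _ D1 D1).
          intros; apply Rmult_comm.
        * apply (is_derive_mult (fun x => snd (fresnel x)) (fun x => snd (fresnel x)) t _ _ D2 D2).
          intros; apply Rmult_comm.
      + unfold plus, minus, opp, mult; simpl. unfold plus, mult; simpl. ring. }
  assert (H2 : 2 * (fst (fresnel x) * snd (fresnel x)) - fst (fresnel_aux x) = - (PI / 4)).
  { rewrite (const_of_derive_0 (fun x => 2 * (fst (fresnel x) * snd (fresnel x))
        - fst (fresnel_aux x)) x).
    - rewrite fresnel_0, fresnel_aux_0. simpl. ring.
    - intros t.
      assert (D1 := is_derive_fresnel_fst t). assert (D2 := is_derive_fresnel_snd t).
      assert (D3 := is_derive_fresnel_aux_fst t).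
      evar (l : R). replace 0 with l; unfold l.
      + apply (is_derive_minus (K := R_AbsRing) (V := R_NormedModule)); [|exact D3].
        apply (is_derive_scal (fun x => fst (fresnel x) * snd (fresnel x))).
        apply (is_derive_mult (fun x => fst (fresnel x)) (fun x => snd (fresnel x)) t _ _ D1 D2).
        intros; apply Rmult_comm.
      + unfold plus, minus, opp, mult; simpl. unfold plus, mult; simpl. ring. }
  destruct (fresnel x) as [p q], (fresnel_aux x) as [hr hi]; simpl in *.
  unfold Cmult, Cminus, Cplus, Copp, Ci, RtoC; simpl. f_equal; lra.
Qed.

Lemma CInt_comp (f : R -> C) (g dg : R -> R) (a b : R) :
  a <= b -> (forall x, contC f x) ->
  (forall x, a <= x <= b -> is_derive g x (dg x)) ->
  (forall x, a <= x <= b -> continuous dg x) ->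
  CInt (fun t => RtoC (dg t) * f (g t))%C a b = CInt f (g a) (g b).
Proof.
  intros Hab Hf Hg Hdg.
  rewrite <- (RInt_comp (V := C_R_CompleteNormedModule) f g dg a b).
  - apply CInt_ext; [exact Hab|]. intros x _.
    unfold scal; simpl. unfold prod_scal, scal; simpl. unfold mult; simpl.
    unfold RtoC, Cmult; simpl. destruct (f (g x)) as [u v]; simpl. f_equal; ring.
  - intros; apply Hf.
  - rewrite Rmin_left, Rmax_right by lra. intros; split; auto.
Qed.

(** The phase x^2 u^2 has integrals O(1/x) over subintervals of [0, 1], again by
    boundedness of [fresnel], and 1/(1 + u^2) has bounded variation. *)
Lemma fresnel_aux_bound (x : R) : 0 < x -> Cmod (fresnel_aux x) <= 6 / x.
Proof.
  intros Hx. unfold fresnel_aux.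
  set (G := fun u => RtoC (/ (1 + u ^ 2))). set (e := fun u => cis (- x ^ 2 * (1 + u ^ 2))).
  change (Cmod (CInt (fun u => G u * e u)%C 0 1) <= 6 / x).
  assert (HG : forall t, contC G t).
  { intros t. apply contC_RtoC, continuous_derivable. auto_derive. nra. }
  assert (He : forall t, contC e t).
  { intros t. apply contC_cis, continuous_derivable. auto_derive. auto. }
  assert (HJ : forall t, 0 <= t <= 1 -> Cmod (CInt e t 1) <= 4 / x).
  { intros t Ht.
    replace (CInt e t 1) with
      (RtoC (/ x) * cis (- x ^ 2) * (fresnel x - fresnel (x * t)))%C.
    - rewrite !Cmod_mult, Cmod_cis, Cmod_R, Rabs_pos_eq by (left; now apply Rinv_0_lt_compat).
      rewrite Rmult_1_r, Rmult_comm. unfold Rdiv.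
      apply Rmult_le_compat_r; [left; now apply Rinv_0_lt_compat|].
      eapply Rle_trans; [apply Cmod_triangle|]. rewrite Cmod_opp.
      generalize (fresnel_bound x ltac:(lra)) (fresnel_bound (x * t) ltac:(nra)). lra.
    - rewrite fresnel_diff by nra. rewrite <- (Rmult_1_r x) at 4.
      rewrite <- (CInt_comp (fun t => cis (- t ^ 2)) (fun t => x * t) (fun _ => x) t 1);
        [|lra|apply contC_fresnel_kernel|intros; auto_derive; [exact I|ring]
         |intros; apply continuous_const].
      rewrite <- CInt_mult_l.
      + apply CInt_ext; [lra|]. intros u _. unfold e.
        replace (- x ^ 2 * (1 + u ^ 2)) with (- x ^ 2 + - (x * u) ^ 2) by ring.
        rewrite cis_plus.
        replace (RtoC (/ x) * cis (- x ^ 2) * (RtoC x * cis (- (x * u) ^ 2)))%C with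
          (RtoC (/ x) * RtoC x * (cis (- x ^ 2) * cis (- (x * u) ^ 2)))%C by ring.
        rewrite <- RtoC_mult, Rinv_l by lra. ring.
      + apply ex_CInt. intros u _. apply contC_mult; [apply contC_const|].
        apply contC_cis, continuous_derivable. auto_derive; auto. }
  assert (Hd : dominated G (fun u => - / (1 + u ^ 2)) 0 1).
  { intros s t Hst Ht. unfold G. rewrite <- RtoC_minus, Cmod_R.
    assert (/ (1 + t ^ 2) <= / (1 + s ^ 2)) by (apply Rinv_le_contravar; nra).
    rewrite Rabs_minus_sym, Rabs_pos_eq; lra. }
  assert (H1 := dominated_integral G e _ 0 1 (4 / x) 1 ltac:(lra) ltac:(auto) ltac:(auto) Hd
    ltac:(intros; unfold e; rewrite Cmod_cis; lra) HJ).
  replace (CInt (fun u => G u * e u)%C 0 1) with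
    (CInt (fun t => (G t - G 0) * e t)%C 0 1 + G 0 * CInt e 0 1)%C.
  - eapply Rle_trans; [apply Cmod_triangle|]. rewrite Cmod_mult.
    assert (Hg0 : Cmod (G 0) = 1).
    { unfold G. rewrite Cmod_R, Rabs_pos_eq; [field|]. left; apply Rinv_0_lt_compat; lra. }
    rewrite Hg0. generalize (HJ 0 ltac:(lra)).
    replace (4 / x * (- / (1 + 1 ^ 2) - - / (1 + 0 ^ 2))) with (2 / x) in H1 by (field; lra).
    replace (6 / x) with (2 / x + 4 / x) by (field; lra). lra.
  - rewrite <- CInt_mult_l by (apply ex_CInt; auto).
    replace (CInt (fun t => (G t - G 0) * e t)%C 0 1) with
      (CInt (fun t => G t * e t)%C 0 1 - CInt (fun t => G 0%R * e t)%C 0 1)%C; [ring|].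
    rewrite <- CInt_minus; [|lra|intros; apply contC_mult; auto
      |intros; apply contC_mult; [apply contC_const|auto]].
    apply CInt_ext; [lra|]. intros; ring.
Qed.

(** (sqrt pi / 2) exp (- i pi / 4), the integral of exp (- i t^2) over the
    positive half-line. *)
Definition fresnel_inf : C := (sqrt (PI / 8), - sqrt (PI / 8)).

(** By [fresnel_sqr] and [fresnel_aux_bound], the product of
    [fresnel] x - [fresnel_inf] and [fresnel] x + [fresnel_inf] is O(1/x); the
    second factor stays away from 0 for large x by [fresnel_re_pos], the real
    part of [fresnel_inf] being positive. *)
Lemma fresnel_limit :
  exists B, 0 <= B /\ forall x, 0 < x -> Cmod (fresnel x - fresnel_inf) <= B / x.
Proof.
  set (l := sqrt (PI / 8)).
  assert (Hpi := PI_RGT_0).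
  assert (Hl : 0 < l) by (apply sqrt_lt_R0; lra).
  assert (Hl2 : l * l = PI / 8) by (apply sqrt_sqrt; lra).
  assert (Hm := Cmod_ge_0 fresnel_inf).
  assert (Hil : 0 < 6 / l) by (apply Rdiv_lt_0_compat; lra).
  exists (6 / l + (2 + Cmod fresnel_inf) * (6 / 5)). split; [nra|]. intros x Hx.
  assert (Hix : 0 < / x) by now apply Rinv_0_lt_compat.
  (* For small x boundedness suffices: there 1/x is bounded below. *)
  destruct (Rle_dec (6 / 5) x) as [h|h].
  - apply Rle_trans with (6 / l / x).
    2:{ apply Rmult_le_compat_r; [lra|nra]. }
    assert (Hprod : ((fresnel x - fresnel_inf) * (fresnel x + fresnel_inf) =
       Ci * fresnel_aux x)%C).
    { replace ((fresnel x - fresnel_inf) * (fresnel x + fresnel_inf))%C with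
       (fresnel x * fresnel x - fresnel_inf * fresnel_inf)%C by ring.
      rewrite fresnel_sqr.
      replace (fresnel_inf * fresnel_inf)%C with (- (Ci * RtoC (PI / 4)))%C; [ring|].
      unfold fresnel_inf, Cmult, Copp, Ci, RtoC; simpl. fold l. f_equal; lra. }
    apply (f_equal Cmod) in Hprod. rewrite !Cmod_mult, Cmod_Ci, Rmult_1_l in Hprod.
    assert (Hb := fresnel_aux_bound x Hx).
    assert (Hlow : l <= Cmod (fresnel x + fresnel_inf)).
    { eapply Rle_trans; [|apply Re_le_Cmod].
      change (l <= Rabs (fst (fresnel x) + l)).
      assert (H0 := fresnel_re_pos x h). rewrite Rabs_pos_eq; lra. }
    assert (H0 := Cmod_ge_0 (fresnel x - fresnel_inf)).
    apply Rmult_le_reg_r with l; [exact Hl|].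
    replace (6 / l / x * l) with (6 / x) by (field; lra). nra.
  - apply Rle_trans with (2 + Cmod fresnel_inf).
    + eapply Rle_trans; [apply Cmod_triangle|]. rewrite Cmod_opp.
      generalize (fresnel_bound x ltac:(lra)). lra.
    + change (2 + Cmod fresnel_inf <= (6 / l + (2 + Cmod fresnel_inf) * (6 / 5)) * / x).
      rewrite Rmult_plus_distr_r.
      assert (H5 : 1 <= 6 / 5 * / x).
      { apply Rmult_le_reg_r with x; [exact Hx|].
        rewrite Rmult_assoc, Rinv_l by lra. lra. }
      assert (0 <= 6 / l * / x) by (apply Rmult_le_pos; lra).
      nra.
Qed.

(** * Stationary phase at an endpoint *)
Lemma sin_half_lower (l t : R) : 0 <= t <= l -> l < PI -> t / 2 * cos (l / 2) <= sin (t / 2).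
Proof.
  intros Ht Hl.
  destruct (MVT_gen sin 0 (t / 2) cos) as [c [Hc Heq]].
  - intros x _. auto_derive; [exact I|ring].
  - intros x _. apply continuity_pt_derivable. auto_derive; auto.
  - rewrite Rmin_left, Rmax_right in Hc by lra. rewrite sin_0 in Heq.
    assert (Hcc : cos (l / 2) <= cos c) by (apply cos_decr_1; lra). nra.
Qed.

Lemma Rpower_inv_le (r p : R) : 1 <= r -> p <= 1 -> / r <= Rpower r (- p).
Proof.
  intros Hr Hp. replace (/ r) with (Rpower r (Ropp 1)).
  - apply Rle_Rpower; lra.
  - rewrite Rpower_Ropp, Rpower_1; lra.
Qed.

(** The factor cos (t/2) is the Jacobian of sin (t/2).  With it the phase
    r cos t = r - 2 r sin^2 (t/2) reduces exactly to the Fresnel integral, so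
    no approximation of the phase is involved. *)
Lemma stationary_phase_half (l Cw : R) (H : R -> C) (W : R -> R) :
  0 < l < PI -> 0 <= Cw ->
  (forall t, 0 <= t <= l -> contC H t) -> dominated H W 0 l ->
  (forall t, 0 <= t <= l -> W t - W 0 <= Cw * sqrt t) ->
  exists M, forall r, 1 <= r ->
  Cmod (CInt (fun t => H t * (RtoC (cos (t / 2)) * cis (r * cos t)))%C 0 l
        - H 0%R * cis r * RtoC (2 / sqrt (2 * r)) * fresnel_inf)%C
  <= M * Rpower r (- (3 / 4)).
Proof.
  intros Hl HCw HcH HW HWs.
  assert (Hpi := PI_RGT_0).
  assert (Hcl : 0 < cos (l / 2)) by (apply cos_gt_0; lra).
  assert (Hsl : 0 < sin (l / 2)) by (apply sin_gt_0; lra).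
  destruct fresnel_limit as [B [HB0 HB]].
  destruct (singular_oscillation (2 / cos (l / 2)) Cw l ltac:(lra)) as [M HM].
  { left; apply Rdiv_lt_0_compat; lra. }
  { exact HCw. }
  exists (M + Cmod (H 0) * (B / sin (l / 2))). intros r Hr.
  set (e := fun t => (RtoC (cos (t / 2)) * cis (- (sqrt (2 * r) * sin (t / 2)) ^ 2))%C).
  assert (Hs0 : 0 < sqrt (2 * r)) by (apply sqrt_lt_R0; lra).
  assert (Hss : sqrt (2 * r) * sqrt (2 * r) = 2 * r) by (apply sqrt_sqrt; lra).
  set (w := 2 / sqrt (2 * r)).
  assert (Hw : 0 < w) by (unfold w; apply Rdiv_lt_0_compat; lra).
  assert (Hww : w / sqrt (2 * r) = / r).
  { unfold w. apply Rmult_eq_reg_r with (sqrt (2 * r) * sqrt (2 * r)); [|nra].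
    rewrite Hss at 2. field_simplify; lra. }
  assert (Hce : forall t, contC e t).
  { intros t. apply contC_mult.
    - apply contC_RtoC, continuous_derivable. auto_derive; auto.
    - apply contC_cis, continuous_derivable. auto_derive; auto. }
  assert (Hint : forall s t, 0 <= s <= t -> t <= l -> CInt e s t =
     (RtoC w * (fresnel (sqrt (2 * r) * sin (t / 2)) - fresnel (sqrt (2 * r) * sin (s / 2))))%C).
  { intros s t Hst Htl.
    assert (Hs1 : sin (s / 2) <= sin (t / 2)) by (apply sin_incr_1; lra).
    assert (Hs2 : 0 <= sin (s / 2)) by (apply sin_ge_0; lra).
    rewrite fresnel_diff by nra.
    rewrite <- (CInt_comp (fun t => cis (- t ^ 2)) (fun t => sqrt (2 * r) * sin (t / 2))
       (fun t => sqrt (2 * r) / 2 * cos (t / 2)) s t);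
      [|lra|apply contC_fresnel_kernel|intros; auto_derive; [exact I|unfold Rdiv; ring]
       |intros; apply continuous_derivable; auto_derive; auto].
    rewrite <- CInt_mult_l.
    - apply CInt_ext; [lra|]. intros u _. unfold e.
      replace (RtoC (cos (u / 2))) with
        (RtoC w * RtoC (sqrt (2 * r) / 2 * cos (u / 2)))%C; [ring|].
      rewrite <- RtoC_mult. f_equal. unfold w. field. lra.
    - apply ex_CInt. intros u _. apply contC_mult.
      + apply contC_RtoC, continuous_derivable; auto_derive; auto.
      + apply contC_cis, continuous_derivable; auto_derive; auto. }
  assert (HJ : forall s t, 0 < s <= t -> t <= l ->
     Cmod (CInt e s t) <= 2 / cos (l / 2) / (r * s)).
  { intros s t Hst Htl. rewrite Hint by lra. rewrite Cmod_mult, Cmod_R, Rabs_pos_eq by lra.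
    assert (Hs1 : sin (s / 2) <= sin (t / 2)) by (apply sin_incr_1; lra).
    assert (Hs2 := sin_half_lower l s ltac:(lra) ltac:(lra)).
    assert (Hsc : 0 < s / 2 * cos (l / 2)) by (apply Rmult_lt_0_compat; lra).
    apply Rle_trans with (w * / (sqrt (2 * r) * sin (s / 2))).
    - apply Rmult_le_compat_l; [lra|]. apply fresnel_tail. split; nra.
    - rewrite Rinv_mult, <- Rmult_assoc. fold (w / sqrt (2 * r)). rewrite Hww.
      replace (2 / cos (l / 2) / (r * s)) with (/ r * / (s / 2 * cos (l / 2)))
        by (field; repeat split; lra).
      apply Rmult_le_compat_l; [left; apply Rinv_0_lt_compat; lra|].
      apply Rinv_le_contravar; lra. }
  specialize (HM H e W r Hr HcH ltac:(auto) HW HWs).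
  assert (He1 : forall t, 0 <= t <= l -> Cmod (e t) <= 1).
  { intros t _. unfold e. rewrite Cmod_mult, Cmod_cis, Cmod_R, Rmult_1_r.
    apply Rabs_le, COS_bound. }
  specialize (HM He1 HJ).
  (* Replacing l by infinity costs O(1/r). *)
  assert (HE0 : Cmod (CInt e 0 l - RtoC w * fresnel_inf)%C <= B / sin (l / 2) * / r).
  { rewrite Hint by lra. replace (0 / 2) with 0 by field. rewrite sin_0, Rmult_0_r, fresnel_0.
    set (x := sqrt (2 * r) * sin (l / 2)).
    assert (Hx : 0 < x) by (apply Rmult_lt_0_compat; lra).
    replace (RtoC w * (fresnel x - 0) - RtoC w * fresnel_inf)%C with
      (RtoC w * (fresnel x - fresnel_inf))%C by ring.
    rewrite Cmod_mult, Cmod_R, Rabs_pos_eq by lra.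
    replace (B / sin (l / 2) * / r) with (w * (B / x)).
    - apply Rmult_le_compat_l; [lra|]. now apply HB.
    - unfold x. rewrite <- Hww. field. split; lra. }
  assert (Hsplit : CInt (fun t => H t * (RtoC (cos (t / 2)) * cis (r * cos t)))%C 0 l =
    (cis r * (CInt (fun t => (H t - H 0%R) * e t)%C 0 l + H 0%R * CInt e 0 l))%C).
  { rewrite <- (CInt_mult_l (H 0)) by (apply ex_CInt; auto).
    assert (Hc1 : forall t, 0 <= t <= l -> contC (fun t => H t * e t)%C t)
      by (intros; apply contC_mult; auto).
    assert (Hc2 : forall t, 0 <= t <= l -> contC (fun t => H 0%R * e t)%C t)
      by (intros; apply contC_mult; [apply contC_const|auto]).
    replace (CInt (fun t => (H t - H 0%R) * e t)%C 0 l) with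
      (CInt (fun t => H t * e t)%C 0 l - CInt (fun t => H 0%R * e t)%C 0 l)%C.
    - assert (Hab : forall z z' : C, (z - z' + z')%C = z) by (intros; ring).
      rewrite Hab.
      rewrite <- CInt_mult_l by (apply ex_CInt_le; [lra|auto]).
      apply CInt_ext; [lra|]. intros t _. unfold e.
      replace (r * cos t) with (r + - (sqrt (2 * r) * sin (t / 2)) ^ 2).
      + rewrite cis_plus. ring.
      + replace t with (2 * (t / 2)) at 2 by field. rewrite cos_2a_sin.
        replace ((sqrt (2 * r) * sin (t / 2)) ^ 2) with
          ((sqrt (2 * r) * sqrt (2 * r)) * sin (t / 2) ^ 2) by ring.
        rewrite Hss. ring.
    - rewrite <- CInt_minus; [|lra|auto|auto]. apply CInt_ext; [lra|]. intros; ring. }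
  rewrite Hsplit. fold w.
  replace (cis r * (CInt (fun t => (H t - H 0%R) * e t) 0 l + H 0%R * CInt e 0 l)
     - H 0%R * cis r * RtoC w * fresnel_inf)%C with
    (cis r * (CInt (fun t => (H t - H 0%R) * e t) 0 l
       + H 0%R * (CInt e 0 l - RtoC w * fresnel_inf)))%C by ring.
  rewrite Cmod_mult, Cmod_cis, Rmult_1_l.
  eapply Rle_trans; [apply Cmod_triangle|]. rewrite Cmod_mult, Rmult_plus_distr_r.
  apply Rplus_le_compat; [exact HM|].
  rewrite Rmult_assoc. apply Rmult_le_compat_l; [apply Cmod_ge_0|].
  eapply Rle_trans; [exact HE0|]. apply Rmult_le_compat_l.
  - apply Rmult_le_pos; [lra|left; now apply Rinv_0_lt_compat].
  - apply Rpower_inv_le; lra.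
Qed.

(** * The complex exponential *)
Lemma cexp_cis (z : C) : cexp z = (RtoC (exp (fst z)) * cis (snd z))%C.
Proof. unfold cexp, cis, RtoC, Cmult, Re, Im; simpl. f_equal; ring. Qed.

Lemma cexp_plus (z w : C) : cexp (z + w) = (cexp z * cexp w)%C.
Proof. rewrite !cexp_cis; simpl. rewrite exp_plus, cis_plus, RtoC_mult. ring. Qed.

Lemma Cmod_cexp (z : C) : Cmod (cexp z) = exp (fst z).
Proof.
  rewrite cexp_cis, Cmod_mult, Cmod_cis, Cmod_R, Rabs_pos_eq; [ring|left; apply exp_pos].
Qed.

Lemma cexp_Ci (t : R) : cexp (Ci * RtoC t) = cis t.
Proof.
  rewrite cexp_cis. simpl. replace (0 * t - 1 * 0) with 0 by ring. replace (0 * 0 + 1 * t) with t by ring.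
  rewrite exp_0. ring.
Qed.

Lemma exp_le_1 (a : R) : a <= 0 -> exp a <= 1.
Proof.
  intros [H|H]; [|subst; rewrite exp_0; lra].
  rewrite <- exp_0. left. now apply exp_increasing.
Qed.

Lemma exp_lipschitz_neg (a b : R) : a <= 0 -> b <= 0 -> Rabs (exp a - exp b) <= Rabs (a - b).
Proof.
  assert (W : forall a b, a <= b -> b <= 0 -> Rabs (exp b - exp a) <= Rabs (b - a)).
  { clear. intros a b Hab Hb. rewrite <- (Rmult_1_l (Rabs (b - a))).
    apply (bounded_variation exp exp 1 a b). intros t Ht. split.
    - auto_derive; [exact I|ring].
    - rewrite Rabs_pos_eq by (left; apply exp_pos). apply exp_le_1.
      rewrite (Rabs_pos_eq (b - a)) in Ht by lra. apply Rabs_le_between in Ht. lra. }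
  intros Ha Hb. destruct (Rle_dec a b).
  - rewrite Rabs_minus_sym, (Rabs_minus_sym a b). now apply W.
  - apply W; lra.
Qed.

(** The constant is not sharp; the point is that it is uniform over the closed
    left half-plane, which is unbounded. *)
Lemma cexp_lipschitz (z w : C) : fst z <= 0 -> fst w <= 0 ->
  Cmod (cexp z - cexp w) <= 3 * Cmod (z - w).
Proof.
  intros Hz Hw. rewrite !cexp_cis.
  replace (RtoC (exp (fst z)) * cis (snd z) - RtoC (exp (fst w)) * cis (snd w))%C with
    (RtoC (exp (fst z) - exp (fst w)) * cis (snd z) +
     RtoC (exp (fst w)) * (cis (snd z) - cis (snd w)))%C by (rewrite RtoC_minus; ring).
  eapply Rle_trans; [apply Cmod_triangle|].
  rewrite !Cmod_mult, Cmod_cis, !Cmod_R, (Rabs_pos_eq (exp (fst w))) by (left; apply exp_pos).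
  assert (H1 := exp_lipschitz_neg _ _ Hz Hw).
  assert (H2 := Re_le_Cmod (z - w)). assert (H3 := Im_le_Cmod (z - w)).
  change (fst (z - w)%C) with (fst z - fst w) in H2.
  change (snd (z - w)%C) with (snd z - snd w) in H3.
  assert (H4 := Cmod_sum_bound (cis (snd z) - cis (snd w))). simpl in H4.
  assert (H5 := cos_lipschitz (snd z) (snd w)). assert (H6 := sin_lipschitz (snd z) (snd w)).
  unfold Rminus in *.
  assert (H7 := exp_le_1 _ Hw). assert (H8 := exp_pos (fst w)).
  assert (H9 := Cmod_ge_0 (cis (snd z) - cis (snd w))). nra.
Qed.

(** A remainder without an exponential factor: only points of the closed left
    half-plane are visited between t and t + h. *)
Lemma cexp_taylor (z : C) (t h : R) :
  (forall s, Rabs s <= Rabs h -> fst z * (t + s) <= 0) ->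
  Cmod (cexp (z * RtoC (t + h)) - cexp (z * RtoC t) - RtoC h * (z * cexp (z * RtoC t)))
  <= 6 * Cmod z ^ 2 * h ^ 2.
Proof.
  intros Hneg.
  set (psi := fun s => (cexp (z * RtoC (t + s)) - RtoC s * (z * cexp (z * RtoC t)))%C).
  set (dpsi := fun s => (z * (cexp (z * RtoC (t + s)) - cexp (z * RtoC t)))%C).
  assert (Hre : forall s, fst (z * RtoC s)%C = fst z * s) by (intros; simpl; ring).
  assert (H0 : Rabs 0 <= Rabs h) by (rewrite Rabs_R0; apply Rabs_pos).
  assert (Hb : forall s, Rabs (s - 0) <= Rabs (h - 0) -> Cmod (dpsi s) <= 3 * Cmod z ^ 2 * Rabs h).
  { intros s Hs. rewrite !Rminus_0_r in Hs. unfold dpsi. rewrite Cmod_mult.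
    assert (Hl := cexp_lipschitz (z * RtoC (t + s)) (z * RtoC t)).
    rewrite !Hre in Hl. specialize (Hl (Hneg s Hs)).
    assert (Ht := Hneg 0 H0). rewrite Rplus_0_r in Ht. specialize (Hl Ht).
    replace (z * RtoC (t + s) - z * RtoC t)%C with (z * RtoC s)%C in Hl
      by (rewrite RtoC_plus; ring).
    rewrite Cmod_mult, Cmod_R in Hl. assert (Hz := Cmod_ge_0 z). nra. }
  assert (Hd : forall s, is_derive (fun s => fst (psi s)) s (fst (dpsi s)) /\
                         is_derive (fun s => snd (psi s)) s (snd (dpsi s))).
  { intros s. destruct z as [u v]. unfold psi, dpsi, cexp, Re, Im. simpl. split.
    - auto_derive; [exact I|]. simpl. unfold Rminus. ring.
    - auto_derive; [exact I|]. simpl. unfold Rminus. ring. }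
  assert (B1 : Rabs (fst (psi h) - fst (psi 0)) <= 3 * Cmod z ^ 2 * Rabs h * Rabs (h - 0)).
  { apply (bounded_variation (fun s => fst (psi s)) (fun s => fst (dpsi s))). intros s Hs. split; [apply Hd|].
    eapply Rle_trans; [apply Re_le_Cmod|now apply Hb]. }
  assert (B2 : Rabs (snd (psi h) - snd (psi 0)) <= 3 * Cmod z ^ 2 * Rabs h * Rabs (h - 0)).
  { apply (bounded_variation (fun s => snd (psi s)) (fun s => snd (dpsi s))). intros s Hs. split; [apply Hd|].
    eapply Rle_trans; [apply Im_le_Cmod|now apply Hb]. }
  replace (cexp (z * RtoC (t + h)) - cexp (z * RtoC t) - RtoC h * (z * cexp (z * RtoC t)))%C
    with (psi h - psi 0)%C.
  2:{ unfold psi. rewrite Rplus_0_r. ring. }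
  eapply Rle_trans; [apply Cmod_sum_bound|].
  change (fst (psi h - psi 0)%C) with (fst (psi h) - fst (psi 0)).
  change (snd (psi h - psi 0)%C) with (snd (psi h) - snd (psi 0)).
  rewrite Rminus_0_r, Rmult_assoc, <- Rabs_mult, (Rabs_pos_eq (h * h)) in B1, B2 by nra.
  replace (h ^ 2) with (h * h) by ring. lra.
Qed.

(** * Exponentially decaying integrals over the real line *)
Lemma ball_of_Cmod (x y : C) (eps : R) : Cmod (y - x) < eps -> ball (M := C_R_NormedModule) x eps y.
Proof.
  intros H. split.
  - change (Rabs (fst y - fst x) < eps). eapply Rle_lt_trans; [|apply H].
    apply (Re_le_Cmod (y - x)).
  - change (Rabs (snd y - snd x) < eps). eapply Rle_lt_trans; [|apply H].
    apply (Im_le_Cmod (y - x)).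
Qed.

Lemma Cmod_of_ball (x y : C) (eps : R) : ball (M := C_R_NormedModule) x eps y -> Cmod (y - x) < 2 * eps.
Proof.
  intros [H1 H2]. change (Rabs (fst y - fst x) < eps) in H1.
  change (Rabs (snd y - snd x) < eps) in H2.
  eapply Rle_lt_trans; [apply Cmod_sum_bound|].
  change (Rabs (fst y - fst x) + Rabs (snd y - snd x) < 2 * eps). lra.
Qed.

Notation is_CInt_line f l :=
  (is_RInt_gen (V := C_R_NormedModule) f (Rbar_locally m_infty) (Rbar_locally p_infty) l).

Lemma exp_tail_integral (f : R -> C) (M eta K A : R) :
  (forall x, contC f x) -> 0 < eta -> 0 <= K <= A ->
  (forall x, K <= Rabs x -> Cmod (f x) <= M * exp (- eta * (Rabs x - K))) ->
  forall a b, a <= - A -> A <= b ->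
  Cmod (CInt f a b - CInt f (- A) A) <= 2 * M / eta * exp (- eta * (A - K)).
Proof.
  intros Hc Heta HK HM a b Ha Hb.
  assert (HM0 : 0 <= M).
  { assert (H := HM A ltac:(rewrite Rabs_pos_eq; lra)).
    assert (H1 := Cmod_ge_0 (f A)). assert (H2 := exp_pos (- eta * (Rabs A - K))). nra. }
  assert (HMe : 0 <= M / eta) by (apply Rmult_le_pos; [lra|left; now apply Rinv_0_lt_compat]).
  assert (HR : Cmod (CInt f A b) <= M / eta * exp (- eta * (A - K))).
  { apply Rle_trans with
      (- (M / eta) * exp (- eta * (b - K)) - - (M / eta) * exp (- eta * (A - K))).
    - apply (CInt_bound_fun f (fun x => M * exp (- eta * (x - K)))); [lra|auto| |].
      + intros x Hx. replace x with (Rabs x) at 2 by (apply Rabs_pos_eq; lra).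
        apply HM. rewrite Rabs_pos_eq; lra.
      + apply (is_RInt_derive (V := R_CompleteNormedModule)
          (fun x => - (M / eta) * exp (- eta * (x - K)))); intros x _.
        * auto_derive; [exact I|]. unfold Rminus. field. lra.
        * apply continuous_derivable. auto_derive; auto.
    - assert (H := exp_pos (- eta * (b - K))). nra. }
  assert (HL : Cmod (CInt f a (- A)) <= M / eta * exp (- eta * (A - K))).
  { apply Rle_trans with
      (M / eta * exp (- eta * (- - A - K)) - M / eta * exp (- eta * (- a - K))).
    - apply (CInt_bound_fun f (fun x => M * exp (- eta * (- x - K)))); [lra|auto| |].
      + intros x Hx. replace (- x) with (Rabs x) by (apply Rabs_left1; lra).
        apply HM. rewrite Rabs_left1; lra.
      + apply (is_RInt_derive (V := R_CompleteNormedModule)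
          (fun x => M / eta * exp (- eta * (- x - K)))); intros x _.
        * auto_derive; [exact I|]. unfold Rminus. field. lra.
        * apply continuous_derivable. auto_derive; auto.
    - rewrite Ropp_involutive. assert (H := exp_pos (- eta * (- a - K))). nra. }
  rewrite (CInt_Chasles f a (- A) b); [|lra|auto].
  rewrite (CInt_Chasles f (- A) A b); [|lra|auto].
  replace (CInt f a (- A) + (CInt f (- A) A + CInt f A b) - CInt f (- A) A)%C with
    (CInt f a (- A) + CInt f A b)%C by (set (z1 := CInt f a (- A)); set (z2 := CInt f A b); ring).
  eapply Rle_trans; [apply Cmod_triangle|].
  replace (2 * M / eta) with (M / eta + M / eta) by (field; lra). lra.
Qed.

Lemma line_integral_exists (f : R -> C) (M eta : R) :
  (forall x, contC f x) -> 0 < eta ->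
  (forall x, Cmod (f x) <= M * exp (- eta * Rabs x)) ->
  exists l : C, is_CInt_line f l.
Proof.
  intros Hc Heta HM.
  assert (Hb : forall A, 0 <= A -> forall a b, a <= - A -> A <= b ->
    Cmod (CInt f a b - CInt f (- A) A) <= 2 * M / eta * exp (- eta * A)).
  { intros A HA a b Ha Hb. replace A with (A - 0) at 3 by ring.
    apply (exp_tail_integral f M eta 0 A); auto; [lra|].
    intros x _. rewrite Rminus_0_r. apply HM. }
  assert (HF : ProperFilter (filter_prod (Rbar_locally m_infty) (Rbar_locally p_infty)))
    by apply filter_prod_proper.
  destruct (proj1 (filterlim_locally_cauchy (U := C_R_CompleteNormedModule)
    (F := filter_prod (Rbar_locally m_infty) (Rbar_locally p_infty))
    (fun ab => CInt f (fst ab) (snd ab)))) as [l Hl].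
  - intros eps.
    assert (HA : exists A, 0 <= A /\ 2 * M / eta * exp (- eta * A) < eps / 4).
    { set (Q := Rabs (2 * M / eta) + 1).
      assert (HQ : 0 < Q) by (unfold Q; generalize (Rabs_pos (2 * M / eta)); lra).
      assert (Heps := cond_pos eps).
      assert (He : 0 < eps / 4 / Q) by (apply Rdiv_lt_0_compat; lra).
      exists (Rmax 0 (- ln (eps / 4 / Q) / eta)). split; [apply Rmax_l|].
      apply Rle_lt_trans with (Rabs (2 * M / eta) * (eps / 4 / Q)).
      - apply Rle_trans with (Rabs (2 * M / eta) *
          exp (- eta * Rmax 0 (- ln (eps / 4 / Q) / eta))).
        + apply Rmult_le_compat_r; [left; apply exp_pos|apply Rle_abs].
        + apply Rmult_le_compat_l; [apply Rabs_pos|].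
          rewrite <- (exp_ln (eps / 4 / Q)) at 2 by exact He.
          assert (Hx : - eta * Rmax 0 (- ln (eps / 4 / Q) / eta) <= ln (eps / 4 / Q)).
          { assert (Hm := Rmax_r 0 (- ln (eps / 4 / Q) / eta)).
            apply (Rmult_le_compat_l eta) in Hm; [|lra].
            replace (eta * (- ln (eps / 4 / Q) / eta)) with (- ln (eps / 4 / Q)) in Hm
              by (field; lra). lra. }
          destruct Hx as [Hx|Hx]; [left; now apply exp_increasing|rewrite Hx; lra].
      - replace (eps / 4) with (Q * (eps / 4 / Q)) at 2 by (field; lra).
        apply Rmult_lt_compat_r; [exact He|]. unfold Q; lra. }
    destruct HA as [A [HA0 HA]].
    exists (fun ab => fst ab <= - A /\ A <= snd ab). split.
    + apply (Filter_prod _ _ _ (fun a => a <= - A) (fun b => A <= b)).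
      * exists (- A). intros x Hx; lra.
      * exists A. intros x Hx; lra.
      * intros; simpl; auto.
    + intros [a b] [a' b'] [H1 H2] [H3 H4]; simpl in *.
      apply ball_of_Cmod.
      set (z := CInt f (- A) A).
      replace (CInt f a' b' - CInt f a b)%C with
        ((CInt f a' b' - z) + - (CInt f a b - z))%C.
      * eapply Rle_lt_trans; [apply Cmod_triangle|]. rewrite Cmod_opp.
        generalize (Hb A HA0 a b H1 H2) (Hb A HA0 a' b' H3 H4). fold z.
        generalize (cond_pos eps). lra.
      * set (z1 := CInt f a' b'); set (z2 := CInt f a b). ring.
  - exists l. intros P HP. unfold filtermapi.
    assert (HlP := Hl P HP). unfold filtermap in HlP. revert HlP.
    apply filter_imp. intros [a b] Hab. simpl in *.
    exists (CInt f a b). split; [|exact Hab].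
    apply (RInt_correct (V := C_R_CompleteNormedModule)), ex_CInt; auto.
Qed.

(** Used with K the wave number, where it bounds the evanescent part of the
    field, and with K = 0, where the inner integral is empty and it bounds the
    whole integral. *)
Lemma line_integral_tail (f : R -> C) (M eta K : R) (l : C) :
  (forall x, contC f x) -> 0 < eta -> 0 <= K ->
  (forall x, K <= Rabs x -> Cmod (f x) <= M * exp (- eta * (Rabs x - K))) ->
  is_CInt_line f l -> Cmod (l - CInt f (- K) K) <= 2 * M / eta.
Proof.
  intros Hc Heta HK HM Hl. apply le_epsilon. intros eps Heps.
  assert (He2 : 0 < eps / 2) by lra.
  assert (H1 := Hl (ball (M := C_R_NormedModule) l (mkposreal _ He2)) (locally_ball _ _)).
  unfold filtermapi in H1.
  assert (H2 : filter_prod (Rbar_locally m_infty) (Rbar_locally p_infty)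
     (fun ab => fst ab <= - K /\ K <= snd ab)).
  { apply (Filter_prod _ _ _ (fun a => a <= - K) (fun b => K <= b)).
    - exists (- K). intros x Hx; lra.
    - exists K. intros x Hx; lra.
    - intros; simpl; auto. }
  assert (HF : ProperFilter (filter_prod (Rbar_locally m_infty) (Rbar_locally p_infty)))
    by apply filter_prod_proper.
  destruct (filter_ex _ (filter_and _ _ H1 H2)) as [[a b] [[y [Hy1 Hy2]] [Ha Hb]]].
  simpl in *.
  apply (is_RInt_unique (V := C_R_CompleteNormedModule)) in Hy1.
  apply Cmod_of_ball in Hy2.
  assert (Ht := exp_tail_integral f M eta K K Hc Heta ltac:(lra) HM a b Ha Hb).
  rewrite Hy1 in Ht. replace (- eta * (K - K)) with 0 in Ht by ring.
  rewrite exp_0, Rmult_1_r in Ht.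
  replace (l - CInt f (- K) K)%C with ((y - CInt f (- K) K) + - (y - l))%C
    by (set (z := CInt f (- K) K); ring).
  eapply Rle_trans; [apply Cmod_triangle|]. rewrite Cmod_opp.
  change (pos (mkposreal _ He2)) with (eps / 2) in Hy2. lra.
Qed.

Lemma is_derive_of_quadratic (F : R -> C) (t0 : R) (l : C) (d B : R) :
  0 < d ->
  (forall h, Rabs h < d -> Cmod (F (t0 + h)%R - F t0 - RtoC h * l) <= B * h ^ 2) ->
  is_derive (K := R_AbsRing) (V := C_R_NormedModule) F t0 l.
Proof.
  intros Hd HB.
  assert (Hreal : forall (f : R -> R) (l : R),
    (forall h, Rabs h < d -> Rabs (f (t0 + h) - f t0 - h * l) <= B * h ^ 2) ->
    is_derive f t0 l).
  { clear - Hd. intros f l H. apply is_derive_Reals. intros eps Heps.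
    assert (Hq : 0 < Rabs B + 1) by (generalize (Rabs_pos B); lra).
    assert (Hm : 0 < Rmin d (eps / (Rabs B + 1))).
    { apply Rmin_pos; [exact Hd|]. now apply Rdiv_lt_0_compat. }
    exists (mkposreal _ Hm). intros h Hh0 Hh. simpl in Hh.
    assert (Hh1 : Rabs h < d) by (eapply Rlt_le_trans; [apply Hh|apply Rmin_l]).
    assert (Hh2 : Rabs h < eps / (Rabs B + 1)) by (eapply Rlt_le_trans; [apply Hh|apply Rmin_r]).
    specialize (H h Hh1).
    replace ((f (t0 + h) - f t0) / h - l) with ((f (t0 + h) - f t0 - h * l) / h) by (field; exact Hh0).
    assert (Hah : 0 < Rabs h) by now apply Rabs_pos_lt.
    unfold Rdiv. rewrite Rabs_mult, Rabs_inv.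
    apply Rmult_lt_reg_r with (Rabs h); [exact Hah|].
    rewrite Rmult_assoc, Rinv_l, Rmult_1_r by lra.
    apply Rle_lt_trans with (Rabs B * (Rabs h * Rabs h)).
    - eapply Rle_trans; [apply H|]. rewrite <- Rabs_mult, (Rabs_pos_eq (h * h)) by nra.
      replace (h ^ 2) with (h * h) by ring. apply Rmult_le_compat_r; [nra|apply Rle_abs].
    - apply (Rmult_lt_compat_r (Rabs B + 1)) in Hh2; [|lra].
      unfold Rdiv in Hh2. rewrite Rmult_assoc, Rinv_l in Hh2 by lra.
      assert (H0 := Rabs_pos B). nra. }
  rewrite (surjective_pairing l). apply is_derive_pairC.
  - apply (Hreal (fun t => fst (F t)) (fst l)). intros h Hh. eapply Rle_trans; [|apply (HB h Hh)].
    eapply Rle_trans; [|apply Re_le_Cmod]. apply Req_le. f_equal. simpl. ring.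
  - apply (Hreal (fun t => snd (F t)) (snd l)). intros h Hh. eapply Rle_trans; [|apply (HB h Hh)].
    eapply Rle_trans; [|apply Im_le_Cmod]. apply Req_le. f_equal. simpl. ring.
Qed.

Notation LInt f :=
  (RInt_gen (V := C_R_CompleteNormedModule) f (Rbar_locally m_infty) (Rbar_locally p_infty)).

Lemma LInt_unique (f : R -> C) (l : C) : is_CInt_line f l -> LInt f = l.
Proof. apply (is_RInt_gen_unique (V := C_R_CompleteNormedModule)). Qed.

Lemma LInt_correct (f : R -> C) (M eta : R) :
  (forall x, contC f x) -> 0 < eta ->
  (forall x, Cmod (f x) <= M * exp (- eta * Rabs x)) -> is_CInt_line f (LInt f).
Proof.
  intros Hc He HM. destruct (line_integral_exists f M eta Hc He HM) as [l Hl].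
  now rewrite (LInt_unique _ _ Hl).
Qed.

(** The second-order Taylor bound, integrated in x, is a bound by a multiple of
    h^2 for the integrals. *)
Lemma derive_line_integral (F : R -> R -> C) (F1 : R -> C) (t0 d M eta : R) :
  0 < d -> 0 < eta ->
  (forall t, Rabs (t - t0) < d -> forall x, contC (F t) x) ->
  (forall t, Rabs (t - t0) < d -> forall x, Cmod (F t x) <= M * exp (- eta * Rabs x)) ->
  (forall x, contC F1 x) ->
  (forall x, Cmod (F1 x) <= M * exp (- eta * Rabs x)) ->
  (forall h, Rabs h < d -> forall x,
     Cmod (F (t0 + h)%R x - F t0 x - RtoC h * F1 x) <= M * exp (- eta * Rabs x) * h ^ 2) ->
  is_derive (K := R_AbsRing) (V := C_R_NormedModule) (fun t => LInt (F t)) t0 (LInt F1).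
Proof.
  intros Hd He HcF HF HcF1 HF1 HT.
  apply (is_derive_of_quadratic _ t0 _ d (2 * M / eta) Hd). intros h Hh.
  assert (Hin : forall h, Rabs h < d -> Rabs (t0 + h - t0) < d).
  { intros u Hu. now replace (t0 + u - t0) with u by ring. }
  assert (Hin0 : Rabs (t0 - t0) < d) by (rewrite Rminus_diag, Rabs_R0; exact Hd).
  assert (I1 := LInt_correct _ M eta (HcF _ (Hin h Hh)) He (HF _ (Hin h Hh))).
  assert (I0 := LInt_correct _ M eta (HcF _ Hin0) He (HF _ Hin0)).
  assert (I2 := LInt_correct _ M eta HcF1 He HF1).
  assert (HR : forall (u : R) (z : C), scal (V := C_R_NormedModule) u z = (RtoC u * z)%C).
  { intros u [z1 z2]. unfold scal; simpl. unfold prod_scal, scal; simpl. unfold mult; simpl.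
    unfold RtoC, Cmult; simpl. f_equal; ring. }
  assert (I : is_CInt_line (fun x => F (t0 + h)%R x - F t0 x - RtoC h * F1 x)%C
    (LInt (F (t0 + h)%R) - LInt (F t0) - RtoC h * LInt F1)%C).
  { assert (I3 := is_RInt_gen_scal (V := C_R_NormedModule) _ h _ I2).
    assert (I4 := is_RInt_gen_minus (V := C_R_NormedModule) _ _ _ _
      (is_RInt_gen_minus (V := C_R_NormedModule) _ _ _ _ I1 I0) I3).
    rewrite HR in I4.
    refine (is_RInt_gen_ext (V := C_R_NormedModule) _ _ _ _ I4).
    apply filter_forall. intros ab x _. rewrite HR. reflexivity. }
  assert (Hc : forall x, contC (fun x => F (t0 + h)%R x - F t0 x - RtoC h * F1 x)%C x).
  { intros x. apply contC_minus; [apply contC_minus|apply contC_mult].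
    - now apply HcF, Hin.
    - now apply HcF.
    - apply contC_const.
    - apply HcF1. }
  assert (Ht := line_integral_tail _ (M * h ^ 2) eta 0
    (LInt (F (t0 + h)%R) - LInt (F t0) - RtoC h * LInt F1)%C Hc He (Rle_refl 0)).
  replace (2 * M / eta * h ^ 2) with (2 * (M * h ^ 2) / eta) by (field; lra).
  eapply Rle_trans; [|apply Ht; [|exact I]].
  - apply Req_le. f_equal. rewrite Ropp_0, (RInt_point (V := C_R_CompleteNormedModule)).
    change (zero (G := C_R_CompleteNormedModule)) with (RtoC 0).
    set (z1 := LInt (F (t0 + h)%R)); set (z2 := LInt (F t0)); set (z3 := LInt F1).
    assert (Hz : forall z : C, z = (z - 0)%C) by (intros; ring). apply Hz.
  - intros x _. rewrite Rminus_0_r. eapply Rle_trans; [apply HT, Hh|]. apply Req_le. ring.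
Qed.

(** * Amplitudes *)

(** The modulus with respect to which amplitudes are Lipschitz.  The first
    condition makes Lipschitz functions admissible, the second one limits the
    singularities to square-root ones. *)
Definition holder_gauge (V : R -> R) : Prop :=
  (forall x y, x <= y -> y - x <= V y - V x) /\
  (forall K, exists Q, 0 <= Q /\ forall x y, Rabs x <= K -> Rabs y <= K -> x <= y ->
     V y - V x <= Q * sqrt (y - x)).

(** Growth that every kernel exp (- eta |x|) compensates; unlike a fixed
    polynomial degree it is stable under products. *)
Definition subexp (G : R -> R) : Prop :=
  forall eps, 0 < eps -> exists M, 0 <= M /\ forall x, G x <= M * exp (eps * Rabs x).

Definition amplitude (V : R -> R) (f : R -> C) : Prop :=
  (forall K, exists Q, 0 <= Q /\ forall x y, Rabs x <= K -> Rabs y <= K -> x <= y ->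
     Cmod (f y - f x) <= Q * (V y - V x)) /\
  subexp (fun x => Cmod (f x)).

Lemma linear_growth (f : R -> C) (A : R) :
  0 <= A -> (forall x, Cmod (f x) <= A * (1 + Rabs x)) -> subexp (fun x => Cmod (f x)).
Proof.
  intros HA Hf eps He. assert (Hi : 0 < / eps) by now apply Rinv_0_lt_compat.
  exists (A * (1 + / eps)). split; [nra|]. intros x.
  eapply Rle_trans; [apply Hf|]. rewrite Rmult_assoc. apply Rmult_le_compat_l; [exact HA|].
  assert (Hx := Rabs_pos x).
  assert (H1 : 1 + eps * Rabs x <= exp (eps * Rabs x)).
  { destruct (Req_dec (eps * Rabs x) 0) as [h|h].
    - rewrite h, exp_0. lra.
    - left. apply exp_ineq1. exact h. }
  assert (H2 : Rabs x = / eps * (eps * Rabs x)) by (field; lra).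
  assert (0 <= eps * Rabs x) by nra. nra.
Qed.

Lemma subexp_plus (F G : R -> R) : subexp F -> subexp G -> subexp (fun x => F x + G x).
Proof.
  intros HF HG eps He. destruct (HF eps He) as [P [HP Hf]], (HG eps He) as [Q [HQ Hg]].
  exists (P + Q). split; [lra|]. intros x. specialize (Hf x). specialize (Hg x). lra.
Qed.

Lemma amplitude_bounded (V : R -> R) (f : R -> C) (K : R) : amplitude V f ->
  exists M, 0 <= M /\ forall x, Rabs x <= K -> Cmod (f x) <= M.
Proof.
  intros [_ H]. destruct (H 1 Rlt_0_1) as [M [HM Hf]].
  exists (M * exp (1 * K)). split; [apply Rmult_le_pos; [exact HM|left; apply exp_pos]|].
  intros x Hx. eapply Rle_trans; [apply Hf|]. apply Rmult_le_compat_l; [exact HM|].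
  rewrite !Rmult_1_l. destruct Hx as [Hx|Hx]; [left; now apply exp_increasing|rewrite Hx; lra].
Qed.

Lemma amplitude_const (V : R -> R) (c : C) : holder_gauge V -> amplitude V (fun _ => c).
Proof.
  intros [HV _]. split.
  - intros K. exists 0. split; [lra|]. intros x y _ _ Hxy.
    replace (c - c)%C with (RtoC 0) by ring. rewrite Cmod_0. lra.
  - apply (linear_growth _ (Cmod c)); [apply Cmod_ge_0|]. intros x.
    generalize (Rabs_pos x) (Cmod_ge_0 c). nra.
Qed.

Lemma amplitude_id (V : R -> R) : holder_gauge V -> amplitude V RtoC.
Proof.
  intros [HV _]. split.
  - intros K. exists 1. split; [lra|]. intros x y _ _ Hxy.
    rewrite <- RtoC_minus, Cmod_R, Rabs_pos_eq by lra. specialize (HV x y Hxy). lra.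
  - apply (linear_growth _ 1); [lra|]. intros x. rewrite Cmod_R. lra.
Qed.

Lemma amplitude_plus (V : R -> R) (f g : R -> C) :
  amplitude V f -> amplitude V g -> amplitude V (fun x => f x + g x)%C.
Proof.
  intros [Lf Gf] [Lg Gg]. split.
  - intros K. destruct (Lf K) as [P [HP Hf]], (Lg K) as [Q [HQ Hg]].
    exists (P + Q). split; [lra|]. intros x y Hx Hy Hxy.
    replace (f y + g y - (f x + g x))%C with ((f y - f x) + (g y - g x))%C by ring.
    eapply Rle_trans; [apply Cmod_triangle|].
    specialize (Hf x y Hx Hy Hxy). specialize (Hg x y Hx Hy Hxy). lra.
  - intros eps He. destruct (Gf eps He) as [P [HP Hf]], (Gg eps He) as [Q [HQ Hg]].
    exists (P + Q). split; [lra|]. intros x. eapply Rle_trans; [apply Cmod_triangle|].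
    specialize (Hf x). specialize (Hg x). lra.
Qed.

Lemma amplitude_mult (V : R -> R) (f g : R -> C) :
  amplitude V f -> amplitude V g -> amplitude V (fun x => f x * g x)%C.
Proof.
  intros Af Ag. assert (Bf := fun K => amplitude_bounded V f K Af).
  assert (Bg := fun K => amplitude_bounded V g K Ag).
  destruct Af as [Lf Gf], Ag as [Lg Gg]. split.
  - intros K. destruct (Lf K) as [P [HP Hf]], (Lg K) as [Q [HQ Hg]].
    destruct (Bf K) as [Mf [HMf Hbf]], (Bg K) as [Mg [HMg Hbg]].
    exists (Mf * Q + Mg * P). split; [nra|]. intros x y Hx Hy Hxy.
    replace (f y * g y - f x * g x)%C with (f y * (g y - g x) + g x * (f y - f x))%C by ring.
    eapply Rle_trans; [apply Cmod_triangle|]. rewrite !Cmod_mult, Rmult_plus_distr_r.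
    apply Rplus_le_compat; rewrite Rmult_assoc; apply Rmult_le_compat; auto using Cmod_ge_0.
  - intros eps He. destruct (Gf (eps / 2) ltac:(lra)) as [P [HP Hf]].
    destruct (Gg (eps / 2) ltac:(lra)) as [Q [HQ Hg]].
    exists (P * Q). split; [nra|]. intros x. rewrite Cmod_mult.
    replace (eps * Rabs x) with (eps / 2 * Rabs x + eps / 2 * Rabs x) by field.
    rewrite exp_plus.
    replace (P * Q * (exp (eps / 2 * Rabs x) * exp (eps / 2 * Rabs x))) with
      (P * exp (eps / 2 * Rabs x) * (Q * exp (eps / 2 * Rabs x))) by ring.
    apply Rmult_le_compat; auto using Cmod_ge_0.
Qed.

Lemma amplitude_ext (V : R -> R) (f g : R -> C) :
  (forall x, f x = g x) -> amplitude V f -> amplitude V g.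
Proof.
  intros H [L G]. split.
  - intros K. destruct (L K) as [Q [HQ HL]]. exists Q. split; [exact HQ|].
    intros. rewrite <- !H. auto.
  - intros eps He. destruct (G eps He) as [M [HM HG]]. exists M. split; [exact HM|].
    intros. rewrite <- H. auto.
Qed.

Lemma amplitude_opp (V : R -> R) (f : R -> C) : holder_gauge V ->
  amplitude V f -> amplitude V (fun x => - f x)%C.
Proof.
  intros HV Hf. apply amplitude_ext with (fun x => RtoC (Ropp 1) * f x)%C.
  - intros x. rewrite RtoC_opp. ring.
  - apply amplitude_mult; [now apply amplitude_const|exact Hf].
Qed.

Lemma amplitude_minus (V : R -> R) (f g : R -> C) : holder_gauge V ->
  amplitude V f -> amplitude V g -> amplitude V (fun x => f x - g x)%C.
Proof. intros HV Hf Hg. apply amplitude_plus; [exact Hf|now apply amplitude_opp]. Qed.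

Lemma amplitude_inv (V : R -> R) (f : R -> C) (c : R) :
  0 < c -> (forall x, c <= Cmod (f x)) -> amplitude V f -> amplitude V (fun x => / f x)%C.
Proof.
  intros Hc Hcf [L G].
  assert (Hnz : forall x, f x <> RtoC 0).
  { intros x H. specialize (Hcf x). rewrite H, Cmod_0 in Hcf. lra. }
  assert (Hb : forall x, Cmod (/ f x) <= / c).
  { intros x. rewrite Cmod_inv by apply Hnz. apply Rinv_le_contravar; auto. }
  assert (Hic : 0 < / c) by now apply Rinv_0_lt_compat.
  split.
  - intros K. destruct (L K) as [Q [HQ HL]]. exists (/ c * / c * Q). split; [nra|].
    intros x y Hx Hy Hxy.
    replace (/ f y - / f x)%C with (/ f y * / f x * - (f y - f x))%C.
    2:{ field. split; apply Hnz. }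
    rewrite !Cmod_mult, Cmod_opp.
    apply Rle_trans with (/ c * / c * Cmod (f y - f x)).
    + apply Rmult_le_compat_r; [apply Cmod_ge_0|].
      apply Rmult_le_compat; auto using Cmod_ge_0.
    + rewrite (Rmult_assoc (/ c * / c)). apply Rmult_le_compat_l; [nra|auto].
  - apply (linear_growth _ (/ c)); [lra|]. intros x. specialize (Hb x).
    generalize (Rabs_pos x). nra.
Qed.

Lemma amplitude_cexp (V : R -> R) (f : R -> C) :
  (forall x, fst (f x) <= 0) -> amplitude V f -> amplitude V (fun x => cexp (f x)).
Proof.
  intros Hneg [L _]. split.
  - intros K. destruct (L K) as [Q [HQ HL]]. exists (3 * Q). split; [lra|].
    intros x y Hx Hy Hxy. eapply Rle_trans; [apply cexp_lipschitz; apply Hneg|].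
    specialize (HL x y Hx Hy Hxy). lra.
  - apply (linear_growth _ 1); [lra|]. intros x. rewrite Cmod_cexp.
    generalize (exp_le_1 _ (Hneg x)) (Rabs_pos x). lra.
Qed.

(** A Lipschitz function of a Hoelder function. *)
Lemma amplitude_cont (V : R -> R) (f : R -> C) (x : R) :
  holder_gauge V -> amplitude V f -> contC f x.
Proof.
  intros [_ HV] [L _].
  destruct (HV (Rabs x + 1)) as [P [HP HV']]. destruct (L (Rabs x + 1)) as [Q [HQ HL]].
  assert (Hloc : forall y, Rabs (y - x) < 1 -> Cmod (f y - f x) <= Q * P * sqrt (Rabs (y - x))).
  { intros y Hy.
    assert (Hx1 : Rabs x <= Rabs x + 1) by lra.
    assert (Hy1 : Rabs y <= Rabs x + 1).
    { replace y with (x + (y - x)) by ring. eapply Rle_trans; [apply Rabs_triang|]. lra. }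
    destruct (Rle_dec x y).
    - rewrite Rabs_pos_eq by lra. specialize (HL x y Hx1 Hy1 r). specialize (HV' x y Hx1 Hy1 r).
      nra.
    - rewrite Cmod_minus_sym, Rabs_left1 by lra.
      specialize (HL y x Hy1 Hx1 ltac:(lra)). specialize (HV' y x Hy1 Hx1 ltac:(lra)).
      replace (- (y - x)) with (x - y) by ring. nra. }
  unfold continuous. apply (filterlim_locally (U := C_R_NormedModule)). intros eps.
  assert (Heps := cond_pos eps).
  set (q := eps / (Q * P + 1)).
  assert (Hq : 0 < q) by (apply Rdiv_lt_0_compat; nra).
  assert (Hm : 0 < Rmin 1 (q * q)) by (apply Rmin_pos; nra).
  exists (mkposreal _ Hm). intros y Hy. change (Rabs (y - x) < Rmin 1 (q * q)) in Hy.
  apply ball_of_Cmod.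
  assert (Hy1 : Rabs (y - x) < 1) by (eapply Rlt_le_trans; [apply Hy|apply Rmin_l]).
  assert (Hy2 : Rabs (y - x) < q * q) by (eapply Rlt_le_trans; [apply Hy|apply Rmin_r]).
  eapply Rle_lt_trans; [apply Hloc, Hy1|].
  assert (Hs : sqrt (Rabs (y - x)) <= q).
  { rewrite <- (sqrt_square q) by lra. apply sqrt_le_1; [apply Rabs_pos|nra|lra]. }
  apply Rle_lt_trans with (Q * P * q); [apply Rmult_le_compat_l; nra|].
  replace (pos eps) with ((Q * P + 1) * q) by (unfold q; field; nra). nra.
Qed.

(** * Square-root branches *)

(** One of the two square roots of t, the one with nonpositive imaginary part;
    as the real square root vanishes on negative numbers, at most one component
    is nonzero. *)
Definition sroot (t : R) : C := (sqrt t, - sqrt (- t)).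
Definition signed_sqrt (t : R) : R := sqrt t - sqrt (- t).
Definition branch (kap x : R) : C := (sqrt (x ^ 2 - kap ^ 2), - sqrt (kap ^ 2 - x ^ 2)).
Definition branch_gauge (kap x : R) : R := signed_sqrt (x - kap) + signed_sqrt (x + kap).

Lemma sqrt_le_mono (s t : R) : s <= t -> sqrt s <= sqrt t.
Proof. apply sqrt_le_1_alt. Qed.

Lemma sroot_lipschitz (s t : R) : s <= t ->
  Cmod (sroot t - sroot s) <= signed_sqrt t - signed_sqrt s.
Proof.
  intros H. eapply Rle_trans; [apply Cmod_sum_bound|]. unfold sroot, signed_sqrt; simpl.
  assert (H1 := sqrt_le_mono s t H). assert (H2 := sqrt_le_mono (- t) (- s) ltac:(lra)).
  rewrite !Rabs_pos_eq by lra. lra.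
Qed.

Lemma sqrt_minus_le (s t : R) : s <= t -> sqrt t - sqrt s <= sqrt (t - s).
Proof.
  intros H. destruct (Rle_dec s 0) as [h|h].
  - rewrite (sqrt_neg_0 s) by exact h. rewrite Rminus_0_r. apply sqrt_le_mono. lra.
  - assert (Hs := sqrt_pos s). assert (Hd := sqrt_pos (t - s)).
    assert (sqrt t <= sqrt s + sqrt (t - s)); [|lra].
    rewrite <- (sqrt_square (sqrt s + sqrt (t - s))) by lra. apply sqrt_le_mono.
    assert (H1 := sqrt_sqrt s ltac:(lra)). assert (H2 := sqrt_sqrt (t - s) ltac:(lra)). nra.
Qed.

Lemma signed_sqrt_holder (s t : R) : s <= t ->
  0 <= signed_sqrt t - signed_sqrt s <= 2 * sqrt (t - s).
Proof.
  intros H. unfold signed_sqrt.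
  assert (H1 := sqrt_le_mono s t H). assert (H2 := sqrt_le_mono (- t) (- s) ltac:(lra)).
  assert (H3 := sqrt_minus_le s t H). assert (H4 := sqrt_minus_le (- t) (- s) ltac:(lra)).
  replace (- s - - t) with (t - s) in H4 by ring. lra.
Qed.

Lemma branch_gauge_holder (kap x y : R) : x <= y ->
  0 <= branch_gauge kap y - branch_gauge kap x <= 4 * sqrt (y - x).
Proof.
  intros H. unfold branch_gauge.
  assert (H1 := signed_sqrt_holder (x - kap) (y - kap) ltac:(lra)).
  assert (H2 := signed_sqrt_holder (x + kap) (y + kap) ltac:(lra)).
  replace (y - kap - (x - kap)) with (y - x) in H1 by ring.
  replace (y + kap - (x + kap)) with (y - x) in H2 by ring. lra.
Qed.

(** Each of the two factors has a single branch point; conjugating the second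
    one selects beta > 0 for x < - kap. *)
Lemma branch_factor (kap x : R) : 0 <= kap ->
  branch kap x = (sroot (x - kap) * Cconj (sroot (x + kap)))%C.
Proof.
  intros Hk. unfold branch, sroot, Cconj, Cmult; simpl.
  assert (Hs : forall u v, 0 <= u -> 0 <= v -> sqrt (u * v) = sqrt u * sqrt v) by (intros; now apply sqrt_mult).
  destruct (Rle_dec kap x); [|destruct (Rle_dec (- kap) x)].
  - rewrite (sqrt_neg_0 (- (x - kap))), (sqrt_neg_0 (- (x + kap))) by lra.
    rewrite (sqrt_neg_0 (kap * (kap * 1) - x * (x * 1))) by nra.
    replace (x * (x * 1) - kap * (kap * 1)) with ((x - kap) * (x + kap)) by ring.
    rewrite Hs by lra. f_equal; ring.
  - rewrite (sqrt_neg_0 (x - kap)), (sqrt_neg_0 (- (x + kap))) by lra.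
    rewrite (sqrt_neg_0 (x * (x * 1) - kap * (kap * 1))) by nra.
    replace (kap * (kap * 1) - x * (x * 1)) with (- (x - kap) * (x + kap)) by ring.
    rewrite Hs by lra. f_equal; ring.
  - rewrite (sqrt_neg_0 (x - kap)), (sqrt_neg_0 (x + kap)) by lra.
    rewrite (sqrt_neg_0 (kap * (kap * 1) - x * (x * 1))) by nra.
    replace (x * (x * 1) - kap * (kap * 1)) with (- (x - kap) * - (x + kap)) by ring.
    rewrite Hs by lra. f_equal; ring.
Qed.

Lemma Cmod_sroot (t : R) : Cmod (sroot t) <= 1 + Rabs t.
Proof.
  eapply Rle_trans; [apply Cmod_sum_bound|]. unfold sroot; simpl.
  assert (Hs : forall u, 0 <= u -> sqrt u <= 1 + u).
  { intros u Hu. rewrite <- (sqrt_square (1 + u)) by lra. apply sqrt_le_mono. nra. }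
  rewrite Rabs_Ropp, !(Rabs_pos_eq (sqrt _)) by apply sqrt_pos.
  destruct (Rle_dec 0 t).
  - rewrite (sqrt_neg_0 (- t)) by lra. rewrite Rabs_pos_eq by lra. generalize (Hs t r). lra.
  - rewrite (sqrt_neg_0 t) by lra. rewrite Rabs_left1 by lra. generalize (Hs (- t) ltac:(lra)). lra.
Qed.

Lemma amplitude_sroot (V : R -> R) (c : R) :
  (forall x y, x <= y -> signed_sqrt (y + c) - signed_sqrt (x + c) <= V y - V x) ->
  amplitude V (fun x => sroot (x + c)).
Proof.
  intros HV. split.
  - intros K. exists 1. split; [lra|]. intros x y _ _ Hxy.
    eapply Rle_trans; [apply sroot_lipschitz; lra|]. rewrite Rmult_1_l. now apply HV.
  - apply (linear_growth _ (1 + Rabs c)); [generalize (Rabs_pos c); lra|]. intros x.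
    eapply Rle_trans; [apply Cmod_sroot|].
    generalize (Rabs_triang x c) (Rabs_pos x) (Rabs_pos c). nra.
Qed.

Lemma amplitude_conj (V : R -> R) (f : R -> C) :
  amplitude V f -> amplitude V (fun x => Cconj (f x)).
Proof.
  intros [L G]. split.
  - intros K. destruct (L K) as [Q [HQ HL]]. exists Q. split; [exact HQ|].
    intros x y Hx Hy Hxy. rewrite <- Cminus_conj, Cmod_conj. auto.
  - intros eps He. destruct (G eps He) as [M [HM HG]]. exists M. split; [exact HM|].
    intros. rewrite Cmod_conj. auto.
Qed.

Lemma amplitude_branch (V : R -> R) (kap : R) :
  0 <= kap ->
  (forall x y, x <= y -> branch_gauge kap y - branch_gauge kap x <= V y - V x) ->
  amplitude V (branch kap).
Proof.
  intros Hk HV. apply amplitude_ext with (fun x => sroot (x - kap) * Cconj (sroot (x + kap)))%C.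
  - intros x. now rewrite branch_factor.
  - apply amplitude_mult; [|apply amplitude_conj];
      (apply amplitude_sroot; intros x y Hxy; eapply Rle_trans; [|apply HV, Hxy]; unfold branch_gauge).
    + generalize (signed_sqrt_holder (x + kap) (y + kap) ltac:(lra)). unfold Rminus. lra.
    + generalize (signed_sqrt_holder (x - kap) (y - kap) ltac:(lra)). lra.
Qed.

(** * Asymptotics for one wave in the lower half-plane *)
Definition kern (kap th r x : R) : C :=
  (cexp (branch kap x * RtoC (r * sin th)) * cis (r * cos th * x))%C.

Lemma sin_neg_below (th : R) : PI < th < 2 * PI -> sin th < 0.
Proof. intros H. apply sin_lt_0; lra. Qed.

(** Because sqrt (x^2 - kap^2) >= |x| - kap, also for |x| <= kap, where the left
    side is 0. *)
Lemma Cmod_kern (kap th r x : R) :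
  0 <= kap -> 0 <= r -> PI < th < 2 * PI ->
  Cmod (kern kap th r x) <= exp (r * sin th * (Rabs x - kap)).
Proof.
  intros Hk Hr Hth. assert (Hs := sin_neg_below th Hth).
  unfold kern. rewrite Cmod_mult, Cmod_cis, Cmod_cexp, Rmult_1_r.
  replace (fst (branch kap x * RtoC (r * sin th))%C) with (r * sin th * sqrt (x ^ 2 - kap ^ 2))
    by (unfold branch; simpl; ring).
  assert (H : Rabs x - kap <= sqrt (x ^ 2 - kap ^ 2)).
  { destruct (Rle_dec (Rabs x) kap) as [h|h].
    - generalize (sqrt_pos (x ^ 2 - kap ^ 2)). lra.
    - rewrite <- (sqrt_square (Rabs x - kap)) by lra. apply sqrt_le_mono.
      rewrite <- (pow2_abs x). nra. }
  assert (H' : r * sin th * sqrt (x ^ 2 - kap ^ 2) <= r * sin th * (Rabs x - kap)).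
  { assert (0 <= r * - sin th) by nra. nra. }
  destruct H' as [H'|H']; [left; now apply exp_increasing|rewrite H'; lra].
Qed.

Lemma branch_cos (kap phi : R) : 0 < kap -> 0 <= phi <= PI ->
  branch kap (kap * cos phi) = (0, - (kap * sin phi)).
Proof.
  intros Hk Hphi. assert (Hs : 0 <= sin phi) by (apply sin_ge_0; lra).
  assert (H1 := sin2_cos2 phi). unfold Rsqr in H1. unfold branch.
  rewrite sqrt_neg_0 by nra.
  replace (kap ^ 2 - (kap * cos phi) ^ 2) with ((kap * sin phi) * (kap * sin phi)).
  - rewrite sqrt_square by nra. reflexivity.
  - replace (sin phi * sin phi) with (1 - cos phi * cos phi) by lra.
    replace (kap * sin phi * (kap * sin phi)) with (kap * kap * (sin phi * sin phi)) by ring.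
    replace (sin phi * sin phi) with (1 - cos phi * cos phi) by lra. ring.
Qed.

Lemma kern_cos (kap th r phi : R) : 0 < kap -> 0 <= phi <= PI ->
  kern kap th r (kap * cos phi) = cis (kap * r * cos (phi + th)).
Proof.
  intros Hk Hphi. unfold kern. rewrite branch_cos by assumption.
  set (z := ((0, (- (kap * sin phi))%R) * RtoC (r * sin th))%C).
  assert (H1 : fst z = 0) by (unfold z; simpl; ring).
  assert (H2 : snd z = - (kap * r * (sin phi * sin th))) by (unfold z; simpl; ring).
  rewrite cexp_cis, H1, H2, exp_0, cos_plus.
  replace (kap * r * (cos phi * cos th - sin phi * sin th)) with
    (- (kap * r * (sin phi * sin th)) + r * cos th * (kap * cos phi)) by ring.
  rewrite cis_plus. ring.
Qed.

Lemma contC_kern (V : R -> R) (kap th r x : R) :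
  holder_gauge V -> amplitude V (branch kap) -> contC (kern kap th r) x.
Proof.
  intros HV HB. apply contC_mult.
  - apply contC_cexp, contC_mult; [now apply (amplitude_cont V)|apply contC_const].
  - apply contC_cis, continuous_derivable. auto_derive; auto.
Qed.

Lemma kern_decay (kap th r : R) (G : R -> R) :
  0 < kap -> PI < th < 2 * PI -> 0 < r -> subexp G ->
  exists M eta, 0 <= M /\ 0 < eta /\
    forall x g, g <= G x -> 0 <= g -> g * Cmod (kern kap th r x) <= M * exp (- eta * Rabs x).
Proof.
  intros Hk Hth Hr HG. assert (Hs := sin_neg_below th Hth).
  (* Half of the decay of the kernel is spent on the growth of G. *)
  set (eta := r * - sin th / 2). assert (He : 0 < eta) by (unfold eta; nra).
  destruct (HG eta He) as [M [HM HGx]].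
  exists (M * exp (2 * eta * kap)), eta. split; [|split; [exact He|]].
  - apply Rmult_le_pos; [exact HM|left; apply exp_pos].
  - intros x g Hg Hg0.
    eapply Rle_trans; [apply Rmult_le_compat; [exact Hg0|apply Cmod_ge_0
      |eapply Rle_trans; [exact Hg|apply HGx]|apply Cmod_kern; lra]|].
    rewrite !Rmult_assoc, <- !exp_plus. apply Req_le. f_equal. f_equal. unfold eta. field.
Qed.

(** The amplitude of the stationary phase integral after xi =
    kap cos (phi0 + sg t): the second factor is d xi / dt divided by the
    cos (t/2) which [stationary_phase_half] keeps apart.  On [0, pi] the cosine
    is monotone, so the modulus V in xi becomes one in t, increasing after the
    sign - sg. *)
Lemma half_range_dominated (V : R -> R) (kap phi0 sg l : R) (c : R -> C) :
  holder_gauge V -> amplitude V c -> 0 < kap -> (sg = 1 \/ sg = -1) ->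
  0 < l < PI -> 0 <= phi0 <= PI -> 0 <= phi0 + sg * l <= PI ->
  exists W Cw, 0 <= Cw /\
    (forall t, 0 <= t <= l -> W t - W 0 <= Cw * sqrt t) /\
    dominated (fun t => c (kap * cos (phi0 + sg * t))%R
      * RtoC (- kap * sg * sin (phi0 + sg * t) / cos (t / 2)))%C W 0 l.
Proof.
  intros HV Hc Hk Hsg Hl Hp0 Hpl.
  assert (Hsg1 : Rabs sg = 1) by (destruct Hsg; subst; [apply Rabs_R1|rewrite Rabs_left; lra]).
  set (g := fun t => kap * cos (phi0 + sg * t)).
  set (q := fun t => - kap * sg * sin (phi0 + sg * t) / cos (t / 2)).
  set (mu := cos (l / 2)).
  assert (Hpi := PI_RGT_0).
  assert (Hmu : 0 < mu) by (apply cos_gt_0; lra).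
  assert (Hcos : forall t, 0 <= t <= l -> mu <= cos (t / 2)).
  { intros t Ht. unfold mu. apply cos_decr_1; lra. }
  assert (Hrange : forall t, 0 <= t <= l -> 0 <= phi0 + sg * t <= PI).
  { intros t Ht. destruct Hsg; subst sg; lra. }
  assert (Hg : forall t, Rabs (g t) <= kap).
  { intros t. unfold g. rewrite Rabs_mult, (Rabs_pos_eq kap) by lra.
    assert (Rabs (cos (phi0 + sg * t)) <= 1) by (apply Rabs_le, COS_bound). nra. }
  assert (Hglip : forall s t, Rabs (g t - g s) <= kap * Rabs (t - s)).
  { intros s t. unfold g. rewrite <- Rmult_minus_distr_l, Rabs_mult, (Rabs_pos_eq kap) by lra.
    apply Rmult_le_compat_l; [lra|]. eapply Rle_trans; [apply cos_lipschitz|].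
    replace (phi0 + sg * t - (phi0 + sg * s)) with (sg * (t - s)) by ring.
    rewrite Rabs_mult, Hsg1. lra. }
  assert (Hsinlip : forall s t, Rabs (- kap * sg * sin (phi0 + sg * t) - - kap * sg * sin (phi0 + sg * s))
      <= kap * Rabs (t - s)).
  { intros s t. rewrite <- Rmult_minus_distr_l, Rabs_mult, Rabs_mult, Rabs_Ropp, Hsg1,
      (Rabs_pos_eq kap), Rmult_1_r by lra.
    apply Rmult_le_compat_l; [lra|]. eapply Rle_trans; [apply sin_lipschitz|].
    replace (phi0 + sg * t - (phi0 + sg * s)) with (sg * (t - s)) by ring.
    rewrite Rabs_mult, Hsg1. lra. }
  assert (Hsinb : forall t, Rabs (- kap * sg * sin (phi0 + sg * t)) <= kap).
  { intros t. rewrite Rabs_mult, Rabs_mult, Rabs_Ropp, Hsg1, (Rabs_pos_eq kap), Rmult_1_r by lra.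
    assert (Rabs (sin (phi0 + sg * t)) <= 1) by (apply Rabs_le, SIN_bound). nra. }
  assert (Himu : 0 < / mu) by now apply Rinv_0_lt_compat.
  assert (Hic : forall t, 0 <= t <= l -> 0 < / cos (t / 2) <= / mu).
  { intros t Ht. specialize (Hcos t Ht). split; [apply Rinv_0_lt_compat; lra|].
    apply Rinv_le_contravar; lra. }
  set (Mq := kap * / mu).
  assert (HMq : 0 <= Mq) by (unfold Mq; nra).
  assert (Hqb : forall t, 0 <= t <= l -> Rabs (q t) <= Mq).
  { intros t Ht. specialize (Hic t Ht).
    change (Rabs (- kap * sg * sin (phi0 + sg * t) * / cos (t / 2)) <= Mq). rewrite Rabs_mult.
    rewrite (Rabs_pos_eq (/ cos (t / 2))) by lra.
    apply Rmult_le_compat; try apply Rabs_pos; try lra. apply Hsinb. }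
  set (Lq := kap * / mu + kap * (/ mu * / mu)).
  assert (HLq : 0 <= Lq) by (unfold Lq; assert (0 < / mu * / mu) by nra; nra).
  assert (Hqlip : forall s t, 0 <= s <= t -> t <= l -> Rabs (q t - q s) <= Lq * (t - s)).
  { intros s t Hst Htl. assert (Hct := Hcos t ltac:(lra)). assert (Hcs := Hcos s ltac:(lra)).
    set (a := fun t => - kap * sg * sin (phi0 + sg * t)).
    replace (q t - q s) with ((a t - a s) * / cos (t / 2) +
      a s * ((cos (s / 2) - cos (t / 2)) * (/ cos (s / 2) * / cos (t / 2))))
      by (unfold q, a; field; lra).
    eapply Rle_trans; [apply Rabs_triang|]. rewrite !Rabs_mult.
    assert (I1 := Hic t ltac:(lra)). assert (I2 := Hic s ltac:(lra)).
    rewrite (Rabs_pos_eq (/ cos (t / 2))), (Rabs_pos_eq (/ cos (s / 2))) by lra.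
    assert (T1 := Hsinlip s t). fold (a t) (a s) in T1. rewrite (Rabs_pos_eq (t - s)) in T1 by lra.
    assert (T2 : Rabs (cos (s / 2) - cos (t / 2)) <= t - s).
    { eapply Rle_trans; [apply cos_lipschitz|]. rewrite Rabs_left1; lra. }
    assert (T3 := Hsinb s). fold (a s) in T3.
    unfold Lq. rewrite Rmult_plus_distr_r. apply Rplus_le_compat.
    - replace (kap * / mu * (t - s)) with (kap * (t - s) * / mu) by ring.
      apply Rmult_le_compat; try apply Rabs_pos; lra.
    - replace (kap * (/ mu * / mu) * (t - s)) with (kap * ((t - s) * (/ mu * / mu))) by ring.
      apply Rmult_le_compat; try apply Rabs_pos; [|exact T3|].
      + apply Rmult_le_pos; [apply Rabs_pos|]. apply Rmult_le_pos; lra.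
      + apply Rmult_le_compat; try apply Rabs_pos; [|exact T2|].
        * apply Rmult_le_pos; lra.
        * apply Rmult_le_compat; lra. }
  destruct (amplitude_bounded V c kap Hc) as [Mc [HMc Hcb]].
  destruct Hc as [Lc _]. destruct (Lc kap) as [Q [HQ HL]].
  destruct HV as [HV1 HV2]. destruct (HV2 kap) as [P [HP HVP]].
  assert (Hmono : forall s t, 0 <= s <= t -> t <= l ->
    Cmod (c (g t) - c (g s)) <= Q * (- sg * V (g t) - - sg * V (g s)) /\
    - sg * V (g t) - - sg * V (g s) <= P * sqrt (Rabs (g t - g s))).
  { intros s t Hst Htl. assert (Rs := Hrange s ltac:(lra)). assert (Rt := Hrange t ltac:(lra)).
    destruct Hsg; subst sg.
    - assert (Hts : g t <= g s).
      { unfold g. apply Rmult_le_compat_l; [lra|]. apply cos_decr_1; lra. }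
      split.
      + rewrite Cmod_minus_sym. eapply Rle_trans; [apply (HL (g t) (g s)); auto|]. apply Req_le; ring.
      + rewrite Rabs_left1 by lra. replace (- (g t - g s)) with (g s - g t) by ring.
        eapply Rle_trans; [|apply (HVP (g t) (g s)); auto]. lra.
    - assert (Hts : g s <= g t).
      { unfold g. apply Rmult_le_compat_l; [lra|]. apply cos_decr_1; lra. }
      split.
      + eapply Rle_trans; [apply (HL (g s) (g t)); auto|]. apply Req_le; ring.
      + rewrite Rabs_pos_eq by lra.
        eapply Rle_trans; [|apply (HVP (g s) (g t)); auto]. lra. }
  exists (fun t => Mq * Q * (- sg * V (g t)) + Mc * Lq * t).
  exists (Mq * Q * (P * sqrt kap) + Mc * Lq * sqrt l). split; [|split].
  - assert (Hsk := sqrt_pos kap). assert (Hsl := sqrt_pos l).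
    apply Rplus_le_le_0_compat; repeat apply Rmult_le_pos; lra.
  - intros t Ht. destruct (Hmono 0 t ltac:(lra) ltac:(lra)) as [_ H2].
    assert (Hgt := Hglip 0 t). rewrite Rminus_0_r, (Rabs_pos_eq t) in Hgt by lra.
    apply sqrt_le_mono in Hgt. rewrite sqrt_mult in Hgt by lra.
    assert (Ht2 : t <= sqrt l * sqrt t).
    { rewrite <- (sqrt_sqrt t) at 1 by lra. apply Rmult_le_compat_r; [apply sqrt_pos|].
      apply sqrt_le_mono; lra. }
    assert (E1 : - sg * V (g t) - - sg * V (g 0) <= P * sqrt kap * sqrt t).
    { eapply Rle_trans; [exact H2|]. rewrite Rmult_assoc. apply Rmult_le_compat_l; assumption. }
    assert (E2 : Mq * Q * (- sg * V (g t) - - sg * V (g 0)) <= Mq * Q * (P * sqrt kap * sqrt t)).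
    { apply Rmult_le_compat_l; [nra|exact E1]. }
    assert (E3 : Mc * Lq * t <= Mc * Lq * (sqrt l * sqrt t)).
    { apply Rmult_le_compat_l; [nra|exact Ht2]. }
    lra.
  - intros s t Hst Htl. fold (g t) (g s) (q t) (q s).
    replace (c (g t) * RtoC (q t) - c (g s) * RtoC (q s))%C with
      (RtoC (q t) * (c (g t) - c (g s)) + c (g s) * RtoC (q t - q s))%C
      by (rewrite RtoC_minus; ring).
    eapply Rle_trans; [apply Cmod_triangle|]. rewrite !Cmod_mult, !Cmod_R.
    destruct (Hmono s t Hst Htl) as [H1 _].
    assert (F1 : Rabs (q t) * Cmod (c (g t) - c (g s)) <=
      Mq * (Q * (- sg * V (g t) - - sg * V (g s)))).
    { apply Rmult_le_compat; auto using Rabs_pos, Cmod_ge_0. apply Hqb; lra. }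
    assert (F2 : Cmod (c (g s)) * Rabs (q t - q s) <= Mc * (Lq * (t - s))).
    { apply Rmult_le_compat; auto using Rabs_pos, Cmod_ge_0. }
    lra.
Qed.

(** The contribution of one side, sg = 1 or sg = -1, of the critical point
    phi0 = 2 pi - th. *)
Lemma kern_half_range (V : R -> R) (kap th sg l : R) (c : R -> C) :
  holder_gauge V -> amplitude V (branch kap) -> amplitude V c -> 0 < kap ->
  PI < th < 2 * PI -> (sg = 1 \/ sg = -1) ->
  0 < l < PI -> 0 <= 2 * PI - th + sg * l <= PI ->
  exists M, forall r, 1 <= kap * r ->
  Cmod (CInt (fun x => c x * kern kap th r x)%C (kap * cos (2 * PI - th))
          (kap * cos (2 * PI - th + sg * l))
        - c (kap * cos (2 * PI - th))%R * RtoC (- kap * sg * sin (2 * PI - th))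
          * cis (kap * r) * RtoC (2 / sqrt (2 * (kap * r))) * fresnel_inf)%C
  <= M * Rpower (kap * r) (- (3 / 4)).
Proof.
  intros HV HB Hc Hk Hth Hsg Hl Hpl.
  set (phi0 := 2 * PI - th) in *.
  assert (Hp0 : 0 <= phi0 <= PI) by (unfold phi0; lra).
  destruct (half_range_dominated V kap phi0 sg l c HV Hc Hk Hsg Hl Hp0 Hpl)
    as [W [Cw [HCw [HWs HW]]]].
  set (H := fun t => (c (kap * cos (phi0 + sg * t))%R
      * RtoC (- kap * sg * sin (phi0 + sg * t) / cos (t / 2)))%C) in HW.
  assert (Hcos : forall t, 0 <= t <= l -> 0 < cos (t / 2)).
  { intros t Ht. apply cos_gt_0; lra. }
  assert (HcH : forall t, 0 <= t <= l -> contC H t).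
  { intros t Ht. specialize (Hcos t Ht). apply contC_mult.
    - apply (continuous_comp (fun t => kap * cos (phi0 + sg * t)) c).
      + apply continuous_derivable. auto_derive; auto.
      + apply (amplitude_cont V c _ HV Hc).
    - apply contC_RtoC, continuous_derivable. auto_derive.
      change (cos (t / 2) <> 0). lra. }
  destruct (stationary_phase_half l Cw H W Hl HCw HcH HW HWs) as [M HM].
  exists M. intros r Hr. specialize (HM (kap * r) Hr).
  replace (H 0) with (c (kap * cos phi0)%R * RtoC (- kap * sg * sin phi0))%C in HM.
  2:{ unfold H. rewrite !Rmult_0_r, !Rplus_0_r. replace (0 / 2) with 0 by field. rewrite cos_0.
      f_equal. f_equal. field. }
  assert (Hcf : forall x, contC (fun x => c x * kern kap th r x)%C x).
  { intros x. apply contC_mult; [apply (amplitude_cont V c _ HV Hc)|].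
    apply (contC_kern V); assumption. }
  replace (CInt (fun x => c x * kern kap th r x)%C (kap * cos phi0) (kap * cos (phi0 + sg * l)))
    with (CInt (fun t => H t * (RtoC (cos (t / 2)) * cis (kap * r * cos t)))%C 0 l); [exact HM|].
  replace (kap * cos phi0) with (kap * cos (phi0 + sg * 0)) by (f_equal; f_equal; ring).
  rewrite <- (CInt_comp (fun x => c x * kern kap th r x)%C (fun t => kap * cos (phi0 + sg * t))
    (fun t => - kap * sg * sin (phi0 + sg * t)) 0 l);
    [|lra|exact Hcf|intros; auto_derive; [exact I|ring]
     |intros; apply continuous_derivable; auto_derive; auto].
  apply CInt_ext; [lra|]. intros t Ht. specialize (Hcos t ltac:(lra)).
  rewrite kern_cos; [|exact Hk|destruct Hsg; subst sg; lra].
  replace (cos (phi0 + sg * t + th)) with (cos t).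
  - unfold H.
    replace (RtoC (- kap * sg * sin (phi0 + sg * t))) with
      (RtoC (- kap * sg * sin (phi0 + sg * t) / cos (t / 2)) * RtoC (cos (t / 2)))%C; [ring|].
    rewrite <- RtoC_mult. f_equal. field. lra.
  - unfold phi0. replace (2 * PI - th + sg * t + th) with (sg * t + 2 * PI) by ring.
    rewrite cos_plus, cos_2PI, sin_2PI.
    destruct Hsg; subst sg.
    + rewrite Rmult_1_l. ring.
    + replace (-1 * t) with (- t) by ring. rewrite cos_neg. ring.
Qed.

(** Both sides of the critical point give the same leading term.  As xi
    decreases with phi, the side sg = 1 comes with the reversed orientation,
    which its sign in [kern_half_range] compensates. *)
Lemma kern_inner (V : R -> R) (kap th : R) (c : R -> C) :
  holder_gauge V -> amplitude V (branch kap) -> amplitude V c -> 0 < kap ->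
  PI < th < 2 * PI ->
  exists M, forall r, 1 <= kap * r ->
  Cmod (CInt (fun x => c x * kern kap th r x)%C (- kap) kap
        - RtoC (- 2 * kap * sin th) * c (kap * cos th)%R
          * cis (kap * r) * RtoC (2 / sqrt (2 * (kap * r))) * fresnel_inf)%C
  <= M * Rpower (kap * r) (- (3 / 4)).
Proof.
  intros HV HB Hc Hk Hth.
  destruct (kern_half_range V kap th 1 (th - PI) c HV HB Hc Hk Hth (or_introl eq_refl)
    ltac:(lra) ltac:(lra)) as [M1 HM1].
  destruct (kern_half_range V kap th (-1) (2 * PI - th) c HV HB Hc Hk Hth (or_intror eq_refl)
    ltac:(lra) ltac:(lra)) as [M2 HM2].
  exists (M1 + M2). intros r Hr. specialize (HM1 r Hr). specialize (HM2 r Hr).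
  replace (2 * PI - th + 1 * (th - PI)) with PI in HM1 by ring.
  replace (2 * PI - th + -1 * (2 * PI - th)) with 0 in HM2 by ring.
  rewrite cos_PI in HM1. rewrite cos_0 in HM2.
  assert (Ec : cos (2 * PI - th) = cos th).
  { rewrite cos_minus, cos_2PI, sin_2PI. ring. }
  assert (Es : sin (2 * PI - th) = - sin th).
  { rewrite sin_minus, cos_2PI, sin_2PI. ring. }
  rewrite Ec, Es in HM1, HM2.
  replace (kap * -1) with (- kap) in HM1 by ring. replace (kap * 1) with kap in HM2 by ring.
  set (f := fun x => (c x * kern kap th r x)%C) in *.
  assert (Hcf : forall x, contC f x).
  { intros x. apply contC_mult; [apply (amplitude_cont V c _ HV Hc)|].
    apply (contC_kern V); assumption. }
  assert (Hb := COS_bound th).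
  rewrite (CInt_Chasles f (- kap) (kap * cos th) kap); [|split; nra|auto].
  assert (Hsw : CInt f (kap * cos th) (- kap) = (- CInt f (- kap) (kap * cos th))%C).
  { symmetry. apply (opp_RInt_swap (V := C_R_CompleteNormedModule)), ex_CInt; auto. }
  rewrite Hsw in HM1.
  set (z1 := CInt f (- kap) (kap * cos th)) in *. set (z2 := CInt f (kap * cos th) kap) in *.
  set (w := (cis (kap * r) * RtoC (2 / sqrt (2 * (kap * r))) * fresnel_inf)%C).
  replace (z1 + z2 - RtoC (- 2 * kap * sin th) * c (kap * cos th)%R
          * cis (kap * r) * RtoC (2 / sqrt (2 * (kap * r))) * fresnel_inf)%C with
    (- (- z1 - c (kap * cos th)%R * RtoC (- kap * 1 * - sin th)
       * cis (kap * r) * RtoC (2 / sqrt (2 * (kap * r))) * fresnel_inf)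
     + (z2 - c (kap * cos th)%R * RtoC (- kap * -1 * - sin th)
       * cis (kap * r) * RtoC (2 / sqrt (2 * (kap * r))) * fresnel_inf))%C.
  - eapply Rle_trans; [apply Cmod_triangle|]. rewrite Cmod_opp. lra.
  - replace (RtoC (- kap * 1 * - sin th)) with (RtoC kap * RtoC (sin th))%C
      by (rewrite <- RtoC_mult; f_equal; ring).
    replace (RtoC (- kap * -1 * - sin th)) with (- (RtoC kap * RtoC (sin th)))%C
      by (rewrite <- RtoC_mult, <- RtoC_opp; f_equal; ring).
    replace (RtoC (- 2 * kap * sin th)) with (- (RtoC kap * RtoC (sin th) + RtoC kap * RtoC (sin th)))%C
      by (rewrite <- RtoC_mult, <- RtoC_plus, <- RtoC_opp; f_equal; ring).
    ring.
Qed.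

Lemma kern_asymptotics (V : R -> R) (kap th : R) (c : R -> C) :
  holder_gauge V -> amplitude V (branch kap) -> amplitude V c -> 0 < kap ->
  PI < th < 2 * PI ->
  exists M r0, 0 < r0 /\ forall r, r0 <= r ->
  Cmod (LInt (fun x => c x * kern kap th r x)%C
        - RtoC (- 2 * kap * sin th) * c (kap * cos th)%R
          * cis (kap * r) * RtoC (2 / sqrt (2 * (kap * r))) * fresnel_inf)%C
  <= M * Rpower r (- (3 / 4)).
Proof.
  intros HV HB Hc Hk Hth. assert (Hs := sin_neg_below th Hth).
  destruct (kern_inner V kap th c HV HB Hc Hk Hth) as [M HM].
  assert (G := proj2 Hc).
  set (s := - sin th). assert (Hs0 : 0 < s) by (unfold s; lra).
  (* Growth rate s/2, so that half of the decay rate r s survives for r >= 1. *)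
  destruct (G (s / 2) ltac:(lra)) as [N [HN HG]].
  set (N' := N * exp (s / 2 * kap)).
  assert (HN' : 0 <= N') by (apply Rmult_le_pos; [exact HN|left; apply exp_pos]).
  exists (Rpower kap (- (3 / 4)) * M + 4 * N' / s), (Rmax 1 (/ kap)).
  split; [eapply Rlt_le_trans; [|apply Rmax_l]; lra|]. intros r Hr.
  assert (Hr1 : 1 <= r) by (eapply Rle_trans; [apply Rmax_l|exact Hr]).
  assert (Hkr : 1 <= kap * r).
  { assert (H : / kap <= r) by (eapply Rle_trans; [apply Rmax_r|exact Hr]).
    apply (Rmult_le_compat_l kap) in H; [|lra]. rewrite Rinv_r in H; lra. }
  specialize (HM r Hkr).
  assert (Hcf : forall x, contC (fun x => c x * kern kap th r x)%C x).
  { intros x. apply contC_mult; [apply (amplitude_cont V c _ HV Hc)|].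
    apply (contC_kern V); assumption. }
  destruct (kern_decay kap th r _ Hk Hth ltac:(lra) (proj2 Hc)) as [M' [eta [_ [He Hdec']]]].
  assert (Hdec : forall x, Cmod (c x * kern kap th r x) <= M' * exp (- eta * Rabs x)).
  { intros x. rewrite Cmod_mult. apply Hdec'; [lra|apply Cmod_ge_0]. }
  assert (HL := LInt_correct _ M' eta Hcf He Hdec).
  assert (HA : forall x, kap <= Rabs x ->
    Cmod (c x * kern kap th r x) <= N' * exp (- (r * s / 2) * (Rabs x - kap))).
  { intros x Hx. rewrite Cmod_mult.
    eapply Rle_trans; [apply Rmult_le_compat; [apply Cmod_ge_0|apply Cmod_ge_0|apply HG|
      apply Cmod_kern; lra]|].
    unfold N'. rewrite !(Rmult_assoc N), <- !exp_plus. apply Rmult_le_compat_l; [exact HN|].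
    assert (Hexp : s / 2 * Rabs x + r * sin th * (Rabs x - kap) <=
      s / 2 * kap + - (r * s / 2) * (Rabs x - kap)).
    { replace (sin th) with (- s) by (unfold s; ring).
      assert (0 <= (r - 1) * (s * (Rabs x - kap))); [|lra].
      apply Rmult_le_pos; [lra|]. apply Rmult_le_pos; lra. }
    destruct Hexp as [Hexp|Hexp]; [left; now apply exp_increasing|rewrite Hexp; lra]. }
  assert (Ht := line_integral_tail _ N' (r * s / 2) kap _ Hcf ltac:(nra) ltac:(lra) HA HL).
  set (z := LInt (fun x => c x * kern kap th r x)%C) in *.
  set (z' := CInt (fun x => c x * kern kap th r x)%C (- kap) kap) in *.
  match goal with |- Cmod (_ - ?w) <= _ => set (main := w) in * end.
  replace (z - main)%C with ((z - z') + (z' - main))%C by ring.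
  eapply Rle_trans; [apply Cmod_triangle|].
  rewrite <- Rpower_mult_distr in HM by lra.
  assert (Hinv := Rpower_inv_le r (3 / 4) Hr1 ltac:(lra)).
  replace (2 * N' / (r * s / 2)) with (4 * N' / s * / r) in Ht by (field; lra).
  change (Cmod (z - z') <= 4 * N' / s * / r) in Ht.
  assert (H4 : 0 <= 4 * N' / s) by (apply Rmult_le_pos; [lra|left; now apply Rinv_0_lt_compat]).
  assert (H5 : 4 * N' / s * / r <= 4 * N' / s * Rpower r (- (3 / 4)))
    by (apply Rmult_le_compat_l; assumption).
  lra.
Qed.

(** * The two-layer medium *)
Lemma k_pos (m : medium) (a : wave) (sg : side) : admissible m -> 0 < k m a sg.
Proof.
  intros [Hmu [Hlm [Hrho [_ Hom]]]]. specialize (Hrho sg).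
  destruct a; simpl; apply Rmult_lt_0_compat; auto; apply sqrt_lt_R0;
    apply Rdiv_lt_0_compat; lra.
Qed.

(** The elastic modulus governing the wave: k^2 = omega^2 rho / modulus.  It is
    common to both half-planes, which is why delta_p and delta_s have the same
    sign. *)
Definition modulus (m : medium) (a : wave) : R :=
  match a with Pw => 2 * mu m + lam m | Sw => mu m end.

Lemma modulus_pos (m : medium) (a : wave) : admissible m -> 0 < modulus m a.
Proof. intros [Hmu [Hlm _]]. destruct a; simpl; lra. Qed.

Lemma k_sqr (m : medium) (a : wave) (sg : side) : admissible m ->
  k m a sg ^ 2 = omega m ^ 2 * (rho m sg / modulus m a).
Proof.
  intros Hm. assert (HM := modulus_pos m a Hm).
  destruct Hm as [Hmu [Hlm [Hrho [_ Hom]]]]. specialize (Hrho sg).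
  assert (Hq : 0 <= rho m sg / modulus m a) by (left; now apply Rdiv_lt_0_compat).
  replace (k m a sg) with (omega m * sqrt (rho m sg / modulus m a)) by (destruct a; reflexivity).
  rewrite Rpow_mult_distr. f_equal. rewrite <- Rsqr_pow2. now apply Rsqr_sqrt.
Qed.

Lemma km2_eq (m : medium) (a : wave) (sg : side) : admissible m ->
  km2 m a sg = modulus m a / (omega m ^ 2 * rho m sg).
Proof.
  intros Hm. unfold km2. rewrite k_sqr by exact Hm. assert (HM := modulus_pos m a Hm).
  destruct Hm as [_ [_ [Hrho [_ Hom]]]]. specialize (Hrho sg). field. repeat split; lra.
Qed.

Lemma delta_eq (m : medium) (a : wave) : admissible m -> delta m a = modulus m a * C0 m.
Proof.
  intros Hm. unfold delta, C0. rewrite !km2_eq by exact Hm.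
  destruct Hm as [_ [_ [Hrho [_ Hom]]]]. assert (H1 := Hrho Up). assert (H2 := Hrho Lo).
  field. repeat split; lra.
Qed.

Lemma C0_neq_0 (m : medium) : admissible m -> C0 m <> 0.
Proof.
  intros [_ [_ [Hrho [Hne Hom]]]] H. assert (H1 := Hrho Up). assert (H2 := Hrho Lo).
  apply Hne. unfold C0 in H.
  assert (E : C0 m * (rho m Up * rho m Lo * omega m ^ 2) = rho m Lo - rho m Up).
  { unfold C0. field. repeat split; lra. }
  unfold C0 in E. rewrite H in E. lra.
Qed.

Lemma beta_branch (m : medium) (a : wave) (sg : side) (x : R) : admissible m ->
  beta m a sg x = branch (k m a sg) x.
Proof.
  intros Hm. assert (Hk := k_pos m a sg Hm). unfold beta, branch.
  rewrite <- (pow2_abs x). assert (Hx := Rabs_pos x).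
  destruct (Rle_dec (k m a sg) (Rabs x)) as [h|h].
  - rewrite (sqrt_neg_0 (k m a sg ^ 2 - Rabs x ^ 2)) by nra.
    unfold RtoC. f_equal. ring.
  - rewrite (sqrt_neg_0 (Rabs x ^ 2 - k m a sg ^ 2)) by nra.
    unfold RtoC, Ci, Cmult, Copp; simpl. f_equal; ring.
Qed.

Definition medium_gauge (m : medium) (x : R) : R :=
  x + branch_gauge (k m Pw Up) x + branch_gauge (k m Pw Lo) x
    + branch_gauge (k m Sw Up) x + branch_gauge (k m Sw Lo) x.

Lemma medium_gauge_holder (m : medium) : holder_gauge (medium_gauge m).
Proof.
  assert (B := fun a sg x y H => branch_gauge_holder (k m a sg) x y H).
  split.
  - intros x y H. unfold medium_gauge.
    generalize (B Pw Up x y H) (B Pw Lo x y H) (B Sw Up x y H) (B Sw Lo x y H). lra.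
  - intros K. exists (sqrt (2 * K) + 16). split; [generalize (sqrt_pos (2 * K)); lra|].
    intros x y Hx Hy H. unfold medium_gauge.
    generalize (B Pw Up x y H) (B Pw Lo x y H) (B Sw Up x y H) (B Sw Lo x y H).
    assert (Hxy : y - x <= sqrt (2 * K) * sqrt (y - x)).
    { rewrite <- (sqrt_sqrt (y - x)) at 1 by lra. apply Rmult_le_compat_r; [apply sqrt_pos|].
      apply sqrt_le_mono. apply Rabs_le_between in Hx. apply Rabs_le_between in Hy. lra. }
    lra.
Qed.

Lemma amplitude_medium_branch (m : medium) (a : wave) (sg : side) : admissible m ->
  amplitude (medium_gauge m) (branch (k m a sg)).
Proof.
  intros Hm. apply amplitude_branch; [left; now apply k_pos|].
  intros x y H. unfold medium_gauge.
  generalize (branch_gauge_holder (k m Pw Up) x y H) (branch_gauge_holder (k m Pw Lo) x y H)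
    (branch_gauge_holder (k m Sw Up) x y H) (branch_gauge_holder (k m Sw Lo) x y H).
  destruct a, sg; lra.
Qed.

Lemma amplitude_beta (m : medium) (a : wave) (sg : side) : admissible m ->
  amplitude (medium_gauge m) (beta m a sg).
Proof.
  intros Hm. apply amplitude_ext with (branch (k m a sg)).
  - intros x. now rewrite beta_branch.
  - now apply amplitude_medium_branch.
Qed.

Lemma amplitude_Lambda (m : medium) (a : wave) : admissible m ->
  amplitude (medium_gauge m) (Lambda m a).
Proof.
  intros Hm. assert (HV := medium_gauge_holder m).
  apply amplitude_plus; apply amplitude_mult;
    try (now apply amplitude_const); now apply amplitude_beta.
Qed.

Lemma amplitude_Ddet (m : medium) : admissible m -> amplitude (medium_gauge m) (Ddet m).
Proof.
  intros Hm. assert (HV := medium_gauge_holder m).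
  apply amplitude_ext with (fun x => - (Lambda m Pw x * Lambda m Sw x)
    + RtoC (delta m Pw * delta m Sw) * (RtoC x * RtoC x))%C.
  { intros x. unfold Ddet. rewrite <- RtoC_mult, <- RtoC_mult. do 3 f_equal. ring. }
  apply amplitude_plus.
  - apply amplitude_opp; [exact HV|]. apply amplitude_mult; now apply amplitude_Lambda.
  - apply amplitude_mult; [now apply amplitude_const|].
    apply amplitude_mult; now apply amplitude_id.
Qed.

(** Lambda = Lambda_re - i Lambda_nim with both parts nonnegative. *)
Definition Lambda_re (m : medium) (a : wave) (x : R) : R :=
  km2 m a Up * sqrt (x ^ 2 - k m a Up ^ 2) + km2 m a Lo * sqrt (x ^ 2 - k m a Lo ^ 2).
Definition Lambda_nim (m : medium) (a : wave) (x : R) : R :=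
  km2 m a Up * sqrt (k m a Up ^ 2 - x ^ 2) + km2 m a Lo * sqrt (k m a Lo ^ 2 - x ^ 2).

Lemma Lambda_parts (m : medium) (a : wave) (x : R) : admissible m ->
  Lambda m a x = (Lambda_re m a x, - Lambda_nim m a x).
Proof.
  intros Hm. unfold Lambda. rewrite !beta_branch by exact Hm.
  unfold Lambda_re, Lambda_nim, branch, RtoC, Cmult, Cplus; simpl. f_equal; ring.
Qed.

Lemma km2_pos (m : medium) (a : wave) (sg : side) : admissible m -> 0 < km2 m a sg.
Proof. intros Hm. apply Rinv_0_lt_compat, pow_lt, k_pos, Hm. Qed.

Lemma Lambda_re_pos (m : medium) (a : wave) (x : R) : admissible m -> 0 <= Lambda_re m a x.
Proof.
  intros Hm. generalize (km2_pos m a Up Hm) (km2_pos m a Lo Hm).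
  intros. apply Rplus_le_le_0_compat; apply Rmult_le_pos; try lra; apply sqrt_pos.
Qed.

Lemma Lambda_nim_pos (m : medium) (a : wave) (x : R) : admissible m -> 0 <= Lambda_nim m a x.
Proof.
  intros Hm. generalize (km2_pos m a Up Hm) (km2_pos m a Lo Hm).
  intros. apply Rplus_le_le_0_compat; apply Rmult_le_pos; try lra; apply sqrt_pos.
Qed.

Lemma k_sqr_neq (m : medium) (a : wave) : admissible m -> k m a Up ^ 2 <> k m a Lo ^ 2.
Proof.
  intros Hm H. assert (HM := modulus_pos m a Hm). rewrite !k_sqr in H by exact Hm.
  destruct Hm as [_ [_ [Hrho [Hne Hom]]]].
  apply Hne. apply (Rmult_eq_reg_l (omega m ^ 2 * / modulus m a)).
  - unfold Rdiv in H. lra.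
  - apply Rgt_not_eq, Rmult_lt_0_compat; [apply pow_lt; lra|now apply Rinv_0_lt_compat].
Qed.

Lemma Lambda_parts_neq_0 (m : medium) (a : wave) (x : R) : admissible m ->
  ~ (Lambda_re m a x = 0 /\ Lambda_nim m a x = 0).
Proof.
  intros Hm [H1 H2]. assert (P := km2_pos m a Up Hm). assert (Q := km2_pos m a Lo Hm).
  unfold Lambda_re in H1. unfold Lambda_nim in H2.
  assert (Z : forall u v p q, 0 < p -> 0 < q -> p * sqrt u + q * sqrt v = 0 -> u <= 0 /\ v <= 0).
  { clear. intros u v p q Hp Hq H. assert (Hu := sqrt_pos u). assert (Hv := sqrt_pos v).
    assert (Pu : 0 <= p * sqrt u) by (apply Rmult_le_pos; lra).
    assert (Pv : 0 <= q * sqrt v) by (apply Rmult_le_pos; lra).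
    split; apply Rnot_lt_le; intros h; apply sqrt_lt_R0 in h.
    - assert (0 < p * sqrt u) by (apply Rmult_lt_0_compat; lra). lra.
    - assert (0 < q * sqrt v) by (apply Rmult_lt_0_compat; lra). lra. }
  apply (k_sqr_neq m a Hm).
  generalize (Z _ _ _ _ P Q H1) (Z _ _ _ _ P Q H2). lra.
Qed.

(** The square of the sum exceeds (A - B)^2 x2 by at least 2 A B x2 - A - B,
    where A x2 >= 1 and B x2 >= 1. *)
Lemma sum_sqrt_lower (A B a2 b2 x2 : R) :
  0 < A -> 0 < B -> A * a2 = 1 -> B * b2 = 1 -> a2 <= x2 -> b2 <= x2 ->
  (A - B) ^ 2 * x2 + Rabs (A - B) <= (A * sqrt (x2 - a2) + B * sqrt (x2 - b2)) ^ 2.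
Proof.
  intros HA HB Ha Hb Hax Hbx.
  assert (S1 := sqrt_pos (x2 - a2)). assert (S2 := sqrt_pos (x2 - b2)).
  assert (E1 := sqrt_sqrt (x2 - a2) ltac:(lra)). assert (E2 := sqrt_sqrt (x2 - b2) ltac:(lra)).
  set (s := sqrt (x2 - a2)) in *. set (t := sqrt (x2 - b2)) in *.
  assert (Hst : 0 <= A * B * (s * t)) by (repeat apply Rmult_le_pos; lra).
  replace ((A * s + B * t) ^ 2) with (A * A * (s * s) + B * B * (t * t) + 2 * (A * B * (s * t))) by ring.
  rewrite E1, E2.
  replace (A * A * (x2 - a2)) with (A * A * x2 - A) by (rewrite Rmult_minus_distr_l, Rmult_assoc, (Rmult_assoc A A a2), Ha; ring).
  replace (B * B * (x2 - b2)) with (B * B * x2 - B) by (rewrite Rmult_minus_distr_l, Rmult_assoc, (Rmult_assoc B B b2), Hb; ring).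
  assert (K1 : 1 <= A * x2) by (rewrite <- Ha; apply Rmult_le_compat_l; lra).
  assert (K2 : 1 <= B * x2) by (rewrite <- Hb; apply Rmult_le_compat_l; lra).
  assert (J1 : B <= A * B * x2) by nra. assert (J2 : A <= A * B * x2) by nra.
  unfold Rabs; destruct (Rcase_abs (A - B)); nra.
Qed.

Lemma Lambda_re_lower (m : medium) (a : wave) (x : R) : admissible m ->
  (forall sg, k m a sg <= Rabs x) ->
  delta m a ^ 2 * x ^ 2 + Rabs (delta m a) <= Lambda_re m a x ^ 2.
Proof.
  intros Hm Hx. unfold Lambda_re, delta.
  assert (H2 : forall sg, k m a sg ^ 2 <= x ^ 2).
  { intros sg. rewrite <- (pow2_abs x). apply pow_incr.
    split; [left; now apply k_pos|apply Hx]. }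
  assert (H1 : forall sg, km2 m a sg * k m a sg ^ 2 = 1).
  { intros sg. unfold km2. apply Rinv_l, Rgt_not_eq, pow_lt, k_pos, Hm. }
  apply sum_sqrt_lower; auto using km2_pos.
Qed.

Lemma Lambda_nim_evanescent (m : medium) (a : wave) (x : R) : admissible m ->
  (forall sg, k m a sg <= Rabs x) -> Lambda_nim m a x = 0.
Proof.
  intros Hm Hx.
  assert (H2 : forall sg, k m a sg ^ 2 <= x ^ 2).
  { intros sg. rewrite <- (pow2_abs x). apply pow_incr.
    split; [left; now apply k_pos|apply Hx]. }
  unfold Lambda_nim. rewrite !sqrt_neg_0; [ring| |]; generalize (H2 Up) (H2 Lo); lra.
Qed.

Lemma k_Pw_le_Sw (m : medium) (sg : side) : admissible m -> k m Pw sg <= k m Sw sg.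
Proof.
  intros Hm. destruct Hm as [Hmu [Hlm [Hrho [_ Hom]]]]. specialize (Hrho sg). simpl.
  apply Rmult_le_compat_l; [lra|]. apply sqrt_le_mono.
  apply Rmult_le_compat_l; [lra|]. apply Rinv_le_contravar; lra.
Qed.

Lemma Ddet_parts (m : medium) (x : R) : admissible m ->
  Ddet m x = (- (Lambda_re m Pw x * Lambda_re m Sw x - Lambda_nim m Pw x * Lambda_nim m Sw x) + delta m Pw * delta m Sw * x ^ 2,
     Lambda_re m Pw x * Lambda_nim m Sw x + Lambda_nim m Pw x * Lambda_re m Sw x).
Proof.
  intros Hm. unfold Ddet. rewrite !Lambda_parts by exact Hm.
  unfold RtoC, Cmult, Cplus, Copp; simpl. f_equal; ring.
Qed.

Lemma delta_prod_pos (m : medium) : admissible m -> 0 < delta m Pw * delta m Sw.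
Proof.
  intros Hm. rewrite !delta_eq by exact Hm. assert (H1 := modulus_pos m Pw Hm).
  assert (H2 := modulus_pos m Sw Hm). assert (H3 := C0_neq_0 m Hm).
  assert (H4 : 0 < C0 m * C0 m) by (rewrite <- Rsqr_def; now apply Rlt_0_sqr).
  replace (modulus m Pw * C0 m * (modulus m Sw * C0 m)) with
    (modulus m Pw * modulus m Sw * (C0 m * C0 m)) by ring.
  apply Rmult_lt_0_compat; [now apply Rmult_lt_0_compat|exact H4].
Qed.

(** With a = |delta_p|, b = |delta_s| and g = sqrt (a b), [Lambda_re_lower] and
    the arithmetic-geometric mean inequality give
    (Lambda_p Lambda_s)^2 >= (a^2 xi^2 + a)(b^2 xi^2 + b) >= (g^2 xi^2 + g)^2. *)
Lemma Ddet_evanescent (m : medium) (x : R) : admissible m ->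
  (forall sg, k m Sw sg <= Rabs x) ->
  sqrt (delta m Pw * delta m Sw) <= Cmod (Ddet m x).
Proof.
  intros Hm Hx.
  assert (Hxp : forall sg, k m Pw sg <= Rabs x).
  { intros sg. eapply Rle_trans; [now apply k_Pw_le_Sw|apply Hx]. }
  assert (Hp := Lambda_re_lower m Pw x Hm Hxp). assert (Hs := Lambda_re_lower m Sw x Hm Hx).
  eapply Rle_trans; [|apply Re_le_Cmod]. rewrite Ddet_parts by exact Hm.
  rewrite !Lambda_nim_evanescent by assumption. cbn [fst].
  assert (Hd := delta_prod_pos m Hm).
  assert (P1 := Lambda_re_pos m Pw x Hm). assert (P2 := Lambda_re_pos m Sw x Hm).
  set (g := sqrt (delta m Pw * delta m Sw)).
  assert (Hg0 : 0 <= g) by apply sqrt_pos.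
  assert (Hg : g * g = delta m Pw * delta m Sw) by (apply sqrt_sqrt; lra).
  set (a := Rabs (delta m Pw)) in *. set (b := Rabs (delta m Sw)) in *.
  assert (Ha0 : 0 <= a) by apply Rabs_pos. assert (Hb0 : 0 <= b) by apply Rabs_pos.
  assert (Hab : a * b = g * g).
  { unfold a, b. rewrite <- Rabs_mult, Hg. apply Rabs_pos_eq; lra. }
  rewrite <- (pow2_abs (delta m Pw)) in Hp. rewrite <- (pow2_abs (delta m Sw)) in Hs.
  fold a in Hp. fold b in Hs.
  rewrite <- Hg.
  assert (Hx2 : 0 <= x ^ 2) by apply pow2_ge_0.
  set (X := x ^ 2) in *. set (P := Lambda_re m Pw x) in *. set (S := Lambda_re m Sw x) in *.
  assert (Hprod : (g * g * X + g) ^ 2 <= (P * S) ^ 2).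
  { apply Rle_trans with ((a ^ 2 * X + a) * (b ^ 2 * X + b)).
    - assert (Hamgm : 2 * g <= a + b).
      { assert (H0 : (2 * g) ^ 2 <= (a + b) ^ 2).
        { replace ((2 * g) ^ 2) with (4 * (a * b)) by (rewrite Hab; ring).
          assert (0 <= (a - b) ^ 2) by apply pow2_ge_0. lra. }
        apply Rsqr_incr_0; [|lra|lra]. unfold Rsqr. lra. }
      replace ((a ^ 2 * X + a) * (b ^ 2 * X + b)) with
        ((a * b) ^ 2 * X ^ 2 + (a * b) * X * (a + b) + a * b) by ring.
      rewrite Hab.
      replace ((g * g * X + g) ^ 2) with ((g * g) ^ 2 * X ^ 2 + (g * g) * X * (2 * g) + g * g) by ring.
      assert (g * g * X * (2 * g) <= g * g * X * (a + b)); [|lra].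
      apply Rmult_le_compat_l; [|exact Hamgm]. apply Rmult_le_pos; [nra|exact Hx2].
    - rewrite Rpow_mult_distr. apply Rmult_le_compat; try assumption.
      + apply Rplus_le_le_0_compat; [|exact Ha0]. apply Rmult_le_pos; [apply pow2_ge_0|exact Hx2].
      + apply Rplus_le_le_0_compat; [|exact Hb0]. apply Rmult_le_pos; [apply pow2_ge_0|exact Hx2]. }
  assert (HPS : g * g * X + g <= P * S).
  { apply Rsqr_incr_0; unfold Rsqr.
    - lra.
    - apply Rplus_le_le_0_compat; [|exact Hg0]. apply Rmult_le_pos; [nra|exact Hx2].
    - apply Rmult_le_pos; assumption. }
  rewrite Rabs_left1; lra.
Qed.

(** If a shear branch oscillates, then Lambda_nim is positive for the shear
    wave.  Since delta_p delta_s xi^2 is real and nonnegative, D = 0 forces first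
    the real and then the imaginary part of Lambda_p to vanish. *)
Lemma Ddet_neq_0 (m : medium) (x : R) : admissible m -> Ddet m x <> RtoC 0.
Proof.
  intros Hm H.
  destruct (Rle_dec (k m Sw Up) (Rabs x)) as [h1|h1];
    [destruct (Rle_dec (k m Sw Lo) (Rabs x)) as [h2|h2]|].
  { assert (He := Ddet_evanescent m x Hm ltac:(intros []; assumption)).
    rewrite H, Cmod_0 in He. generalize (sqrt_lt_R0 _ (delta_prod_pos m Hm)). lra. }
  all: assert (HL : 0 < Lambda_nim m Sw x).
  1, 3: assert (K1 := km2_pos m Sw Up Hm); assert (K2 := km2_pos m Sw Lo Hm);
    assert (S3 := sqrt_pos (k m Sw Up ^ 2 - x ^ 2)); assert (S4 := sqrt_pos (k m Sw Lo ^ 2 - x ^ 2));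
    assert (Hx := Rabs_pos x); unfold Lambda_nim.
  { assert (0 < sqrt (k m Sw Lo ^ 2 - x ^ 2)); [|nra].
    apply sqrt_lt_R0. rewrite <- (pow2_abs x). nra. }
  { assert (0 < sqrt (k m Sw Up ^ 2 - x ^ 2)); [|nra].
    apply sqrt_lt_R0. rewrite <- (pow2_abs x). nra. }
  all: rewrite Ddet_parts in H by exact Hm; injection H as H1 H2;
    assert (P1 := Lambda_re_pos m Pw x Hm); assert (P2 := Lambda_re_pos m Sw x Hm);
    assert (Q1 := Lambda_nim_pos m Pw x Hm); assert (Hd := delta_prod_pos m Hm);
    assert (Hx2 : 0 <= x ^ 2) by apply pow2_ge_0;
    assert (T1 : 0 <= Lambda_re m Pw x * Lambda_nim m Sw x) by (apply Rmult_le_pos; lra);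
    assert (T2 : 0 <= Lambda_nim m Pw x * Lambda_re m Sw x) by (apply Rmult_le_pos; lra);
    assert (Z1 : Lambda_re m Pw x = 0)
      by (apply (Rmult_eq_reg_r (Lambda_nim m Sw x)); [lra|apply Rgt_not_eq; lra]);
    rewrite Z1 in H1;
    assert (T3 : 0 <= delta m Pw * delta m Sw * x ^ 2) by (apply Rmult_le_pos; lra);
    assert (T4 : 0 <= Lambda_nim m Pw x * Lambda_nim m Sw x) by (apply Rmult_le_pos; lra);
    assert (T5 : Lambda_nim m Pw x * Lambda_nim m Sw x = 0) by (unfold Rminus in *; simpl in *; lra);
    assert (Z2 : Lambda_nim m Pw x = 0)
      by (apply (Rmult_eq_reg_r (Lambda_nim m Sw x)); [lra|apply Rgt_not_eq; lra]);
    exact (Lambda_parts_neq_0 m Pw x Hm (conj Z1 Z2)).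
Qed.

(** Compactness; it provides the hypothesis of [amplitude_inv]. *)
Lemma lower_bound_of_nonvanishing (f : R -> C) (K c : R) :
  (forall x, contC f x) -> (forall x, f x <> RtoC 0) -> 0 < c ->
  (forall x, K <= Rabs x -> c <= Cmod (f x)) ->
  exists c', 0 < c' /\ forall x, c' <= Cmod (f x).
Proof.
  intros Hc Hnz Hc0 HK. set (K' := Rmax 0 K).
  assert (HK' : 0 <= K' /\ K <= K') by (split; [apply Rmax_l|apply Rmax_r]).
  assert (Hcont : forall x, continuity_pt (fun x => Cmod (f x)) x).
  { intros x. apply continuity_pt_filterlim.
    apply (continuous_ext (fun x => sqrt (fst (f x) * fst (f x) + snd (f x) * snd (f x)))).
    { intros y. unfold Cmod. f_equal. ring. }
    assert (C1 := contC_fst _ _ (Hc x)). assert (C2 := contC_snd _ _ (Hc x)).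
    apply (continuous_comp (fun x => fst (f x) * fst (f x) + snd (f x) * snd (f x)) sqrt).
    - apply (continuous_plus (V := R_NormedModule)); apply (continuous_mult (K := R_AbsRing)); assumption.
    - apply continuous_sqrt. }
  destruct (continuity_ab_min (fun x => Cmod (f x)) (- K') K' ltac:(lra) (fun x _ => Hcont x))
    as [x0 [Hmin _]].
  assert (Hx0 : 0 < Cmod (f x0)) by (apply Cmod_gt_0, Hnz).
  exists (Rmin c (Cmod (f x0))). split; [now apply Rmin_pos|]. intros x.
  destruct (Rle_dec K' (Rabs x)) as [h|h].
  - eapply Rle_trans; [apply Rmin_l|]. apply HK. lra.
  - eapply Rle_trans; [apply Rmin_r|]. apply Hmin. apply Rabs_le_between. lra.
Qed.

Lemma amplitude_inv_Lambda (m : medium) (a : wave) : admissible m ->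
  amplitude (medium_gauge m) (fun x => / Lambda m a x)%C.
Proof.
  intros Hm. assert (HL := amplitude_Lambda m a Hm).
  assert (Hd0 : 0 < Rabs (delta m a)).
  { apply Rabs_pos_lt. rewrite delta_eq by exact Hm.
    apply Rmult_integral_contrapositive. split; [|now apply C0_neq_0].
    apply Rgt_not_eq. now apply modulus_pos. }
  destruct (lower_bound_of_nonvanishing (Lambda m a) (Rmax (k m a Up) (k m a Lo))
    (sqrt (Rabs (delta m a)))) as [c [Hc Hcb]].
  - intros x. apply (amplitude_cont _ _ x (medium_gauge_holder m) HL).
  - intros x H. rewrite Lambda_parts in H by exact Hm. injection H as H1 H2.
    apply (Lambda_parts_neq_0 m a x Hm). split; lra.
  - now apply sqrt_lt_R0.
  - intros x Hx.
    assert (Hx' : forall sg, k m a sg <= Rabs x).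
    { intros []; (eapply Rle_trans; [|exact Hx]); [apply Rmax_l|apply Rmax_r]. }
    assert (Hlow := Lambda_re_lower m a x Hm Hx').
    eapply Rle_trans; [|apply Re_le_Cmod]. rewrite Lambda_parts by exact Hm. cbn [fst].
    rewrite <- (sqrt_Rsqr_abs (Lambda_re m a x)). apply sqrt_le_mono. unfold Rsqr.
    assert (0 <= delta m a ^ 2 * x ^ 2) by (apply Rmult_le_pos; apply pow2_ge_0). lra.
  - now apply (amplitude_inv _ _ c).
Qed.

Lemma amplitude_inv_Ddet (m : medium) : admissible m ->
  amplitude (medium_gauge m) (fun x => / Ddet m x)%C.
Proof.
  intros Hm. assert (HD := amplitude_Ddet m Hm).
  destruct (lower_bound_of_nonvanishing (Ddet m) (Rmax (k m Sw Up) (k m Sw Lo))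
    (sqrt (delta m Pw * delta m Sw))) as [c [Hc Hcb]].
  - intros x. apply (amplitude_cont _ _ x (medium_gauge_holder m) HD).
  - intros x. now apply Ddet_neq_0.
  - now apply sqrt_lt_R0, delta_prod_pos.
  - intros x Hx. apply Ddet_evanescent; [exact Hm|].
    intros []; (eapply Rle_trans; [|exact Hx]); [apply Rmax_l|apply Rmax_r].
  - now apply (amplitude_inv _ _ c).
Qed.

(** * Amplitudes of a point source *)
Definition side_sign (sg : side) : R := match sg with Up => 1 | Lo => - (1) end.

(** The formulas for both half-planes at once, linear in the exponentials Ep
    and Es of the pressure and shear waves: passing from one side to the other
    changes the sign of each beta. *)
Definition amp_form (m : medium) (a : wave) (j : coord) (sg : side) (Ep Es : C) (xi : R) : C :=
  let bp := beta m Pw sg xi in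
  let bs := beta m Sw sg xi in
  let kp := RtoC (km2 m Pw sg) in
  let ks := RtoC (km2 m Sw sg) in
  let dp := RtoC (delta m Pw) in
  let ds := RtoC (delta m Sw) in
  let e := RtoC (side_sign sg) in
  let Lp := (/ Lambda m Pw xi)%C in
  let Ls := (/ Lambda m Sw xi)%C in
  let x := RtoC xi in
  let c := (RtoC (C0 m) * x * / Ddet m xi)%C in
  match a, j with
  | Pw, X1 => c * Ci * (e * ks * bs * Es - ds * kp * (x * x) * Lp * Ep)
  | Sw, X1 => c * (- (e * dp * ks * bs * x * Ls) * Es + kp * x * Ep)
  | Pw, X2 => c * (ks * x * Es - e * ds * kp * bp * x * Lp * Ep)
  | Sw, X2 => c * Ci * (dp * ks * (x * x) * Ls * Es - e * kp * bp * Ep)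
  end%C.

Definition decay_rate (m : medium) (a : wave) (sg : side) (xi : R) : C :=
  (RtoC (- side_sign sg) * beta m a sg xi)%C.

Lemma amp_form_linear (m : medium) (a : wave) (j : coord) (sg : side) (Ep Es : C) (xi : R) :
  amp_form m a j sg Ep Es xi =
  (amp_form m a j sg 1 0 xi * Ep + amp_form m a j sg 0 1 xi * Es)%C.
Proof. unfold amp_form. destruct a, j; ring. Qed.

Lemma amp_eq_form (m : medium) (a : wave) (j : coord) (sg : side) (t xi : R) :
  0 < side_sign sg * t ->
  amp m a j xi t = amp_form m a j sg (cexp (decay_rate m Pw sg xi * RtoC t))
     (cexp (decay_rate m Sw sg xi * RtoC t)) xi.
Proof.
  intros Ht. unfold amp, decay_rate.
  destruct sg; simpl side_sign in *; destruct (Rlt_dec 0 t) as [h|h]; try lra;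
    unfold ampA, ampB, amp_form, side_sign; rewrite RtoC_mult; unfold Cdiv.
  - rewrite RtoC_opp.
    replace (- RtoC 1 * beta m Pw Up xi * RtoC t)%C with (- beta m Pw Up xi * RtoC t)%C by ring.
    replace (- RtoC 1 * beta m Sw Up xi * RtoC t)%C with (- beta m Sw Up xi * RtoC t)%C by ring.
    destruct a, j; ring.
  - rewrite !RtoC_opp.
    replace (- - RtoC 1 * beta m Pw Lo xi * RtoC t)%C with (beta m Pw Lo xi * RtoC t)%C by ring.
    replace (- - RtoC 1 * beta m Sw Lo xi * RtoC t)%C with (beta m Sw Lo xi * RtoC t)%C by ring.
    destruct a, j; ring.
Qed.

Ltac amplitude_tac :=
  repeat first
    [ assumption
    | apply amplitude_inv_Lambda; assumption
    | apply amplitude_inv_Ddet; assumption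
    | apply amplitude_beta; assumption
    | apply amplitude_const; assumption
    | apply amplitude_id; assumption
    | apply amplitude_opp; [assumption|]
    | apply amplitude_minus; [assumption| |]
    | apply amplitude_plus
    | apply amplitude_mult ].

Lemma amplitude_amp_form (m : medium) (a : wave) (j : coord) (sg : side) (Ep Es : C) :
  admissible m -> amplitude (medium_gauge m) (amp_form m a j sg Ep Es).
Proof.
  intros Hm. assert (HV := medium_gauge_holder m).
  unfold amp_form. destruct a, j; amplitude_tac.
Qed.

Lemma amplitude_decay_rate (m : medium) (a : wave) (sg : side) :
  admissible m -> amplitude (medium_gauge m) (decay_rate m a sg).
Proof.
  intros Hm. assert (HV := medium_gauge_holder m). unfold decay_rate. amplitude_tac.
Qed.

Lemma decay_rate_neg (m : medium) (a : wave) (sg : side) (xi t : R) :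
  admissible m -> 0 < side_sign sg * t -> fst (decay_rate m a sg xi) * t <= 0.
Proof.
  intros Hm Ht. unfold decay_rate. rewrite beta_branch by exact Hm.
  replace (fst (RtoC (- side_sign sg) * branch (k m a sg) xi)%C) with
    (- side_sign sg * sqrt (xi ^ 2 - k m a sg ^ 2)) by (unfold branch; simpl; ring).
  assert (H := sqrt_pos (xi ^ 2 - k m a sg ^ 2)). nra.
Qed.

(** A family of amplitudes g t with derivative g1 at t0, where the Taylor
    remainder is controlled uniformly enough in x to be integrated against a
    kernel.  It yields the derivatives both of the field (by integration) and of
    the far-field pattern (by evaluation at one frequency). *)
Definition smooth_family (V : R -> R) (g : R -> R -> C) (g1 : R -> C) (t0 d : R) : Prop :=
  (forall t, Rabs (t - t0) < d -> amplitude V (g t)) /\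
  amplitude V g1 /\
  exists G, subexp G /\
    (forall t, Rabs (t - t0) < d -> forall x, Cmod (g t x) <= G x) /\
    (forall x, Cmod (g1 x) <= G x) /\
    (forall h, Rabs h < d -> forall x,
       Cmod (g (t0 + h)%R x - g t0 x - RtoC h * g1 x) <= G x * h ^ 2).

Lemma smooth_family_plus (V : R -> R) (f g : R -> R -> C) (f1 g1 : R -> C) (t0 d : R) :
  smooth_family V f f1 t0 d -> smooth_family V g g1 t0 d ->
  smooth_family V (fun t x => f t x + g t x)%C (fun x => f1 x + g1 x)%C t0 d.
Proof.
  intros [Af [Af1 [F [HF [Bf [Bf1 Tf]]]]]] [Ag [Ag1 [G [HG [Bg [Bg1 Tg]]]]]].
  split; [|split].
  - intros t Ht. apply amplitude_plus; auto.
  - now apply amplitude_plus.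
  - exists (fun x => F x + G x). split; [now apply subexp_plus|split; [|split]].
    + intros t Ht x. eapply Rle_trans; [apply Cmod_triangle|]. apply Rplus_le_compat; auto.
    + intros x. eapply Rle_trans; [apply Cmod_triangle|]. apply Rplus_le_compat; auto.
    + intros h Hh x.
      replace (f (t0 + h)%R x + g (t0 + h)%R x - (f t0 x + g t0 x) - RtoC h * (f1 x + g1 x))%C with
        ((f (t0 + h)%R x - f t0 x - RtoC h * f1 x) + (g (t0 + h)%R x - g t0 x - RtoC h * g1 x))%C
        by ring.
      eapply Rle_trans; [apply Cmod_triangle|]. rewrite Rmult_plus_distr_r.
      apply Rplus_le_compat; auto.
Qed.

Lemma smooth_family_ext (V : R -> R) (f g : R -> R -> C) (g1 : R -> C) (t0 d : R) :
  (forall t, Rabs (t - t0) < d -> forall x, f t x = g t x) ->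
  smooth_family V f g1 t0 d -> smooth_family V g g1 t0 d.
Proof.
  intros H [Af [Af1 [F [HF [Bf [Bf1 Tf]]]]]].
  split; [|split; [exact Af1|]].
  - intros t Ht. apply amplitude_ext with (f t); auto.
  - exists F. split; [exact HF|split; [|split; [exact Bf1|]]].
    + intros t Ht x. rewrite <- H by exact Ht. auto.
    + intros h Hh x. rewrite <- !H; auto.
      * rewrite Rminus_diag, Rabs_R0. eapply Rle_lt_trans; [apply Rabs_pos|exact Hh].
      * replace (t0 + h - t0) with h by ring. exact Hh.
Qed.

Lemma smooth_family_exp (V : R -> R) (c z : R -> C) (t0 d : R) :
  holder_gauge V -> amplitude V c -> amplitude V z -> 0 < d ->
  (forall t, Rabs (t - t0) < d -> forall x, fst (z x) * t <= 0) ->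
  smooth_family V (fun t x => c x * cexp (z x * RtoC t))%C
    (fun x => c x * z x * cexp (z x * RtoC t0))%C t0 d.
Proof.
  intros HV Hc Hz Hd Hneg.
  assert (H0 : Rabs (t0 - t0) < d) by (rewrite Rminus_diag, Rabs_R0; exact Hd).
  assert (Hre : forall (w : C) (s : R), fst (w * RtoC s)%C = fst w * s) by (intros; simpl; ring).
  assert (He : forall t, Rabs (t - t0) < d -> forall x, Cmod (cexp (z x * RtoC t)) <= 1).
  { intros t Ht x. rewrite Cmod_cexp, Hre. apply exp_le_1. now apply Hneg. }
  assert (Ae : forall t, Rabs (t - t0) < d -> amplitude V (fun x => cexp (z x * RtoC t))).
  { intros t Ht. apply amplitude_cexp.
    - intros x. rewrite Hre. now apply Hneg.
    - apply amplitude_mult; [exact Hz|now apply amplitude_const]. }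
  assert (Acz := amplitude_mult V _ _ Hc Hz).
  split; [|split].
  - intros t Ht. apply amplitude_mult; auto.
  - apply amplitude_mult; auto.
  - exists (fun x => Cmod (c x) + Cmod (c x * z x) + Cmod (RtoC 6 * (c x * z x * z x))).
    split; [|split; [|split]].
    + apply subexp_plus; [apply subexp_plus; [apply Hc|apply Acz]|].
      apply (amplitude_mult V (fun _ => RtoC 6)); [now apply amplitude_const|].
      now apply amplitude_mult.
    + intros t Ht x. rewrite Cmod_mult.
      assert (K1 := Cmod_ge_0 (c x)). assert (K2 := Cmod_ge_0 (c x * z x)).
      assert (K3 := Cmod_ge_0 (RtoC 6 * (c x * z x * z x))).
      assert (K4 := He t Ht x). assert (K5 := Cmod_ge_0 (cexp (z x * RtoC t))). nra.
    + intros x. rewrite (Cmod_mult (c x * z x)).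
      assert (K1 := Cmod_ge_0 (c x)). assert (K2 := Cmod_ge_0 (c x * z x)).
      assert (K3 := Cmod_ge_0 (RtoC 6 * (c x * z x * z x))).
      assert (K4 := He t0 H0 x). assert (K5 := Cmod_ge_0 (cexp (z x * RtoC t0))). nra.
    + intros h Hh x.
      replace (c x * cexp (z x * RtoC (t0 + h)) - c x * cexp (z x * RtoC t0)
         - RtoC h * (c x * z x * cexp (z x * RtoC t0)))%C with
        (c x * (cexp (z x * RtoC (t0 + h)) - cexp (z x * RtoC t0)
         - RtoC h * (z x * cexp (z x * RtoC t0))))%C by ring.
      rewrite Cmod_mult.
      assert (Ht := cexp_taylor (z x) t0 h).
      assert (Hs : forall s, Rabs s <= Rabs h -> fst (z x) * (t0 + s) <= 0).
      { intros s Hs. apply Hneg. replace (t0 + s - t0) with s by ring. lra. }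
      specialize (Ht Hs).
      apply Rle_trans with (Cmod (c x) * (6 * Cmod (z x) ^ 2 * h ^ 2)).
      * apply Rmult_le_compat_l; [apply Cmod_ge_0|exact Ht].
      * rewrite (Cmod_mult (RtoC 6)), Cmod_R, (Rabs_pos_eq 6), (Cmod_mult (c x * z x)), Cmod_mult by lra.
        assert (K1 := Cmod_ge_0 (c x)). assert (K2 := Cmod_ge_0 (z x)).
        assert (Hh2 : 0 <= h ^ 2) by apply pow2_ge_0.
        assert (K3 : 0 <= (Cmod (c x) + Cmod (c x) * Cmod (z x)) * h ^ 2).
        { apply Rmult_le_pos; [|exact Hh2]. nra. }
        lra.
Qed.

Lemma smooth_family_derive_point (V : R -> R) (g : R -> R -> C) (g1 : R -> C) (t0 d x : R) :
  0 < d -> smooth_family V g g1 t0 d ->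
  is_derive (K := R_AbsRing) (V := C_R_NormedModule) (fun t => g t x) t0 (g1 x).
Proof.
  intros Hd [_ [_ [G [_ [_ [_ HT]]]]]].
  apply (is_derive_of_quadratic _ t0 _ d (G x) Hd). intros h Hh. now apply HT.
Qed.

Lemma smooth_family_derive_kern (V : R -> R) (g : R -> R -> C) (g1 : R -> C)
  (t0 d kap th r : R) :
  holder_gauge V -> amplitude V (branch kap) -> 0 < kap -> PI < th < 2 * PI -> 0 < r ->
  0 < d -> smooth_family V g g1 t0 d ->
  is_derive (K := R_AbsRing) (V := C_R_NormedModule)
    (fun t => LInt (fun x => g t x * kern kap th r x)%C) t0
    (LInt (fun x => g1 x * kern kap th r x)%C).
Proof.
  intros HV HB Hk Hth Hr Hd [Ag [Ag1 [G [HG [Bg [Bg1 HT]]]]]].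
  destruct (kern_decay kap th r G Hk Hth Hr HG) as [M [eta [HM [He Hdec]]]].
  assert (Hcont : forall c : R -> C, amplitude V c -> forall x,
    contC (fun x => c x * kern kap th r x)%C x).
  { intros c Hc x. apply contC_mult; [now apply (amplitude_cont V)|now apply (contC_kern V)]. }
  apply (derive_line_integral (fun t x => g t x * kern kap th r x)%C
    (fun x => g1 x * kern kap th r x)%C t0 d M eta Hd He); auto.
  - intros t Ht x. rewrite Cmod_mult. apply Hdec; [now apply Bg|apply Cmod_ge_0].
  - intros x. rewrite Cmod_mult. apply Hdec; [apply Bg1|apply Cmod_ge_0].
  - intros h Hh x.
    replace (g (t0 + h)%R x * kern kap th r x - g t0 x * kern kap th r x
      - RtoC h * (g1 x * kern kap th r x))%C with
      ((g (t0 + h)%R x - g t0 x - RtoC h * g1 x) * kern kap th r x)%C by ring.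
    rewrite Cmod_mult.
    assert (HG0 : 0 <= G x) by (eapply Rle_trans; [apply Cmod_ge_0|apply Bg1]).
    assert (D := Hdec x (G x) (Rle_refl _) HG0).
    apply Rle_trans with (G x * h ^ 2 * Cmod (kern kap th r x)).
    + apply Rmult_le_compat_r; [apply Cmod_ge_0|now apply HT].
    + replace (G x * h ^ 2 * Cmod (kern kap th r x)) with (G x * Cmod (kern kap th r x) * h ^ 2) by ring.
      apply Rmult_le_compat_r; [apply pow2_ge_0|exact D].
Qed.

Definition source_amp (m : medium) (a : wave) (j : coord) (y : R * R) (xi : R) : C :=
  (amp m a j xi (snd y) * cexp (- Ci * RtoC xi * RtoC (fst y)))%C.

Definition ray (th r : R) : R * R := (r * cos th, r * sin th).

(** * The far field *)
Lemma Uintegrand_kern (m : medium) (a : wave) (j : coord) (th r : R) (y : R * R) :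
  admissible m -> PI < th < 2 * PI -> 0 < r ->
  Uintegrand m a j (ray th r) y = (fun xi => source_amp m a j y xi * kern (k m a Lo) th r xi)%C.
Proof.
  intros Hm Hth Hr. assert (Hs := sin_neg_below th Hth).
  apply functional_extensionality. intros xi.
  unfold Uintegrand, Uhat, source_amp, kern, ray; cbn [fst snd].
  destruct (Rlt_dec 0 (r * sin th)) as [h|h]; [nra|].
  rewrite beta_branch by exact Hm. rewrite <- cexp_Ci.
  replace (Ci * RtoC ((r * cos th - fst y) * xi))%C with
    (- Ci * RtoC xi * RtoC (fst y) + Ci * RtoC (r * cos th * xi))%C.
  - rewrite cexp_plus. ring.
  - rewrite !RtoC_mult, RtoC_minus, RtoC_mult. ring.
Qed.

Lemma U_kern (m : medium) (a : wave) (j : coord) (th r : R) (y : R * R) :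
  admissible m -> PI < th < 2 * PI -> 0 < r ->
  U m a j (ray th r) y = (RtoC (1 / (2 * PI)) *
     LInt (fun xi => source_amp m a j y xi * kern (k m a Lo) th r xi))%C.
Proof. intros. unfold U. rewrite Uintegrand_kern by assumption. reflexivity. Qed.

Definition farfield_factor (kap th : R) : C :=
  (cexp (Ci * RtoC (3 * PI / 4)) * RtoC (sqrt (kap / (2 * PI))) * RtoC (sin th))%C.

Lemma Uinf_source (m : medium) (a : wave) (j : coord) (th : R) (y : R * R) :
  Uinf m a j (dir th) y =
  (farfield_factor (k m a Lo) th * source_amp m a j y (k m a Lo * cos th))%C.
Proof.
  unfold Uinf, farfield_factor, source_amp, dir; cbn [fst snd].
  replace (- Ci * RtoC (k m a Lo * fst y * cos th))%C with
    (- Ci * RtoC (k m a Lo * cos th) * RtoC (fst y))%C by (rewrite !RtoC_mult; ring).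
  ring.
Qed.

Definition set_coord (i : coord) (y : R * R) (t : R) : R * R :=
  match i with X1 => (t, snd y) | X2 => (fst y, t) end.

Lemma slice_set_coord (f : R * R -> C) (i : coord) (y : R * R) (t : R) :
  slice f i y t = f (set_coord i y t).
Proof. destruct i; reflexivity. Qed.

Lemma set_coord_pt (i : coord) (y : R * R) : set_coord i y (pt i y) = y.
Proof. destruct y, i; reflexivity. Qed.

(** In y_1 the amplitude is a multiple of exp (- i xi y_1).  In y_2 it is a sum
    of two exponentials, as long as t stays on the side of y_2, whence d = |y_2|
    and the choice of sg. *)
Lemma source_family (m : medium) (a : wave) (j : coord) (y : R * R) (i : coord) :
  admissible m -> 0 < snd y \/ snd y < 0 ->
  exists g1 d, 0 < d /\
    smooth_family (medium_gauge m) (fun t => source_amp m a j (set_coord i y t)) g1 (pt i y) d.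
Proof.
  intros Hm Hy. assert (HV := medium_gauge_holder m).
  assert (Hsg : exists sg, 0 < side_sign sg * snd y).
  { destruct Hy; [exists Up|exists Lo]; simpl; lra. }
  destruct Hsg as [sg Hsg].
  set (V := medium_gauge m) in *.
  assert (Aid : amplitude V (fun xi => - Ci * RtoC xi)%C) by amplitude_tac.
  assert (Haxis : forall x t, fst (- Ci * RtoC x)%C * t <= 0) by (intros; simpl; lra).
  assert (Af := fun Ep Es => amplitude_amp_form m a j sg Ep Es Hm). fold V in Af.
  assert (Az := fun b => amplitude_decay_rate m b sg Hm). fold V in Az.
  assert (Hz : forall b t x, 0 < side_sign sg * t -> fst (decay_rate m b sg x) * t <= 0)
    by (intros; now apply decay_rate_neg).
  assert (Hre : forall (w : C) (s : R), fst (w * RtoC s)%C = fst w * s) by (intros; simpl; ring).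
  assert (Ae : forall (z : R -> C) t, amplitude V z -> (forall x, fst (z x) * t <= 0) ->
    amplitude V (fun x => cexp (z x * RtoC t))).
  { intros z t Haz Hneg. apply amplitude_cexp; [intros; rewrite Hre; apply Hneg|].
    apply amplitude_mult; [exact Haz|now apply amplitude_const]. }
  assert (Hform : forall t xi, 0 < side_sign sg * t -> amp m a j xi t =
    (amp_form m a j sg 1 0 xi * cexp (decay_rate m Pw sg xi * RtoC t) +
     amp_form m a j sg 0 1 xi * cexp (decay_rate m Sw sg xi * RtoC t))%C).
  { intros t xi Ht. rewrite (amp_eq_form m a j sg t xi Ht). apply amp_form_linear. }
  destruct i.
  - eexists. exists 1. split; [lra|].
    apply (smooth_family_exp V (fun xi => amp m a j xi (snd y)) (fun xi => - Ci * RtoC xi)%C);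
      [exact HV| |exact Aid|lra|intros; apply Haxis].
    eapply amplitude_ext; [intros xi; symmetry; apply Hform, Hsg|].
    apply amplitude_plus; apply amplitude_mult; auto.
  - set (d := Rabs (snd y)).
    assert (Hd : 0 < d) by (apply Rabs_pos_lt; lra).
    assert (Hnear : forall t, Rabs (t - snd y) < d -> 0 < side_sign sg * t).
    { intros t Ht. unfold d in Ht. destruct sg; simpl in *.
      - rewrite (Rabs_pos_eq (snd y)) in Ht by lra. apply Rabs_lt_between in Ht. lra.
      - rewrite (Rabs_left (snd y)) in Ht by lra. apply Rabs_lt_between in Ht. lra. }
    eexists. exists d. split; [exact Hd|].
    set (w := fun xi => cexp (- Ci * RtoC xi * RtoC (fst y))).
    assert (Aw : amplitude V w) by (apply Ae; [exact Aid|intros; apply Haxis]).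
    apply (smooth_family_ext V (fun t xi =>
      amp_form m a j sg 1 0 xi * w xi * cexp (decay_rate m Pw sg xi * RtoC t) +
      amp_form m a j sg 0 1 xi * w xi * cexp (decay_rate m Sw sg xi * RtoC t))%C).
    { intros t Ht xi. unfold source_amp; cbn [set_coord fst snd].
      rewrite Hform by now apply Hnear. fold (w xi). ring. }
    apply smooth_family_plus; apply smooth_family_exp; auto; apply amplitude_mult; auto.
Qed.

(** Here [fresnel_inf] has argument - pi/4, and exp (3 i pi/4) is
    - exp (- i pi/4): the sign is that of the Jacobian - 2 kap sin th. *)
Lemma farfield_constant (kap th r : R) (z : C) : 0 < kap -> 0 < r ->
  (RtoC (1 / (2 * PI)) * (RtoC (- 2 * kap * sin th) * z * cis (kap * r)
     * RtoC (2 / sqrt (2 * (kap * r))) * fresnel_inf))%C =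
  (cexp (Ci * RtoC (kap * r)) / RtoC (sqrt r) * (farfield_factor kap th * z))%C.
Proof.
  intros Hk Hr. assert (Hpi := PI_RGT_0).
  assert (Hsr : 0 < sqrt r) by now apply sqrt_lt_R0.
  assert (Hsk : 0 < sqrt kap) by now apply sqrt_lt_R0.
  assert (Hsp : 0 < sqrt PI) by now apply sqrt_lt_R0.
  assert (Hs2 : 0 < sqrt 2) by (apply sqrt_lt_R0; lra).
  assert (E2 : sqrt 2 * sqrt 2 = 2) by (apply sqrt_sqrt; lra).
  assert (Ek : sqrt kap * sqrt kap = kap) by (apply sqrt_sqrt; lra).
  assert (Ep : sqrt PI * sqrt PI = PI) by (apply sqrt_sqrt; lra).
  assert (F1 : sqrt (2 * (kap * r)) = sqrt 2 * (sqrt kap * sqrt r)).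
  { rewrite sqrt_mult by nra. f_equal. apply sqrt_mult; lra. }
  assert (F2 : sqrt (PI / 8) = sqrt PI / (2 * sqrt 2)).
  { rewrite sqrt_div_alt by lra. f_equal. replace 8 with ((2 * 2) * 2) by ring.
    rewrite sqrt_mult by lra. rewrite sqrt_square by lra. reflexivity. }
  assert (F3 : sqrt (kap / (2 * PI)) = sqrt kap / (sqrt 2 * sqrt PI)).
  { rewrite sqrt_div_alt by lra. f_equal. apply sqrt_mult; lra. }
  assert (C3 : cos (3 * PI / 4) = - / sqrt 2).
  { replace (3 * PI / 4) with (PI - PI / 4) by field. rewrite cos_minus, cos_PI, sin_PI, cos_PI4.
    field. lra. }
  assert (S3 : sin (3 * PI / 4) = / sqrt 2).
  { replace (3 * PI / 4) with (PI - PI / 4) by field. rewrite sin_minus, cos_PI, sin_PI, sin_PI4.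
    field. lra. }
  assert (Hinf : fresnel_inf = (RtoC (- (sqrt PI / 2)) * cis (3 * PI / 4))%C).
  { unfold fresnel_inf, cis. rewrite F2, C3, S3. unfold RtoC, Cmult; simpl. f_equal; field; lra. }
  unfold farfield_factor. rewrite Hinf, !cexp_Ci, F1, F3. unfold Cdiv.
  rewrite <- RtoC_inv by lra.
  assert (Hconst : (RtoC (1 / (2 * PI)) * RtoC (- 2 * kap * sin th) * RtoC (2 / (sqrt 2 * (sqrt kap * sqrt r)))
     * RtoC (- (sqrt PI / 2)))%C = (RtoC (/ sqrt r) * RtoC (sqrt kap / (sqrt 2 * sqrt PI)) * RtoC (sin th))%C).
  { rewrite <- !RtoC_mult. f_equal. rewrite <- Ek at 1. rewrite <- Ep at 1. field.
    repeat split; lra. }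
  replace (cis (kap * r) * RtoC (/ sqrt r) *
     (cis (3 * PI / 4) * RtoC (sqrt kap / (sqrt 2 * sqrt PI)) * RtoC (sin th) * z))%C with
    ((RtoC (/ sqrt r) * RtoC (sqrt kap / (sqrt 2 * sqrt PI)) * RtoC (sin th))
      * cis (kap * r) * cis (3 * PI / 4) * z)%C by ring.
  rewrite <- Hconst. ring.
Qed.

Lemma farfield_asymptotics (V : R -> R) (kap th : R) (c : R -> C) :
  holder_gauge V -> amplitude V (branch kap) -> amplitude V c -> 0 < kap ->
  PI < th < 2 * PI ->
  exists M, Rbar_locally p_infty (fun r => Cmod (
    RtoC (1 / (2 * PI)) * LInt (fun x => c x * kern kap th r x)%C
    - cexp (Ci * RtoC (kap * r)) / RtoC (sqrt r) * (farfield_factor kap th * c (kap * cos th)%R))%C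
    <= M * Rabs (Rpower r (- (3 / 4)))).
Proof.
  intros HV HB Hc Hk Hth.
  destruct (kern_asymptotics V kap th c HV HB Hc Hk Hth) as [M [r0 [Hr0 HM]]].
  exists (1 / (2 * PI) * M), r0. intros r Hr. specialize (HM r ltac:(lra)).
  rewrite <- (farfield_constant kap th r (c (kap * cos th)) Hk ltac:(lra)).
  set (z := LInt (fun x => c x * kern kap th r x)%C) in *.
  match goal with |- Cmod (?u * _ - ?u * ?w)%C <= _ =>
    replace (u * z - u * w)%C with (u * (z - w))%C by ring end.
  assert (Hp : 0 < 1 / (2 * PI)) by (apply Rdiv_lt_0_compat; generalize PI_RGT_0; lra).
  rewrite Cmod_mult, Cmod_R, (Rabs_pos_eq (1 / (2 * PI))), (Rmult_assoc _ M) by lra.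
  apply Rmult_le_compat_l; [lra|].
  rewrite Rabs_pos_eq by (left; apply exp_pos). exact HM.
Qed.

Lemma is_derive_Cmult_l (c : C) (f : R -> C) (t : R) (l : C) :
  is_derive (K := R_AbsRing) (V := C_R_NormedModule) f t l ->
  is_derive (K := R_AbsRing) (V := C_R_NormedModule) (fun t => c * f t)%C t (c * l)%C.
Proof.
  intros H. assert (H1 := is_derive_fstC f t l H). assert (H2 := is_derive_sndC f t l H).
  apply (is_derive_pairC (fun t => c * f t)%C).
  - apply (is_derive_minus (K := R_AbsRing) (V := R_NormedModule));
      apply (is_derive_scal (fun t => _)); assumption.
  - apply (is_derive_plus (K := R_AbsRing) (V := R_NormedModule));
      apply (is_derive_scal (fun t => _)); assumption.
Qed.

Lemma grad_of_derive (f : R * R -> C) (y : R * R) (i : coord) (l : C) :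
  is_derive (K := R_AbsRing) (V := C_R_NormedModule) (slice f i y) (pt i y) l ->
  grad f y i = l.
Proof.
  intros H. unfold grad. rewrite (surjective_pairing l). f_equal; apply is_derive_unique.
  - now apply is_derive_fstC.
  - now apply is_derive_sndC.
Qed.

Theorem theorem3p3 (m : medium) (Hm : admissible m) (a : wave) (j : coord)
    (y : R * R) (Hy : 0 < snd y \/ snd y < 0)
    (theta : R) (Htheta : PI < theta < 2 * PI) :
  let xhat := dir theta in
  let x := fun r : R => (r * fst xhat, r * snd xhat) in
  let osc := fun r : R => (cexp (Ci * RtoC (k m a Lo * r)) / RtoC (sqrt r))%C in
  (* the integral and the gradients in y exist *)
  (forall r, 0 < r ->
     U_converges m a j (x r) y /\ ex_grad (fun y' => U m a j (x r) y') y) /\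
  ex_grad (fun y' => Uinf m a j xhat y') y /\
  bigO_infty
    (fun r => U m a j (x r) y - osc r * Uinf m a j xhat y)%C
    (fun r => Rpower r (- (3 / 4))) /\
  (forall i : coord,
     bigO_infty
       (fun r => grad (fun y' => U m a j (x r) y') y i
                 - osc r * grad (fun y' => Uinf m a j xhat y') y i)%C
       (fun r => Rpower r (- (3 / 4)))).
Proof.
  intros xhat x osc.
  assert (Hk := k_pos m a Lo Hm). set (kap := k m a Lo) in *.
  set (V := medium_gauge m).
  assert (HV : holder_gauge V) by apply medium_gauge_holder.
  assert (HB : amplitude V (branch kap)) by now apply amplitude_medium_branch.
  assert (Hs : amplitude V (source_amp m a j y)).
  { destruct (source_family m a j y X1 Hm Hy) as [g1 [d [Hd [Hg _]]]].
    rewrite <- (set_coord_pt X1 y). apply Hg. now rewrite Rminus_diag, Rabs_R0. }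
  assert (HU : forall i g1 d r, 0 < d -> 0 < r ->
    smooth_family V (fun t => source_amp m a j (set_coord i y t)) g1 (pt i y) d ->
    is_derive (K := R_AbsRing) (V := C_R_NormedModule)
      (slice (fun y' => U m a j (x r) y') i y) (pt i y)
      (RtoC (1 / (2 * PI)) * LInt (fun xi => g1 xi * kern kap theta r xi))%C).
  { intros i g1 d r Hd Hr Hg.
    eapply is_derive_ext; [|apply is_derive_Cmult_l,
      (smooth_family_derive_kern V _ g1 (pt i y) d kap theta r HV HB Hk Htheta Hr Hd Hg)].
    intros t. rewrite slice_set_coord. symmetry. now apply U_kern. }
  assert (HUinf : forall i g1 d, 0 < d ->
    smooth_family V (fun t => source_amp m a j (set_coord i y t)) g1 (pt i y) d ->
    is_derive (K := R_AbsRing) (V := C_R_NormedModule)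
      (slice (fun y' => Uinf m a j xhat y') i y) (pt i y)
      (farfield_factor kap theta * g1 (kap * cos theta)%R)%C).
  { intros i g1 d Hd Hg.
    eapply is_derive_ext; [|apply is_derive_Cmult_l,
      (smooth_family_derive_point V _ g1 (pt i y) d (kap * cos theta) Hd Hg)].
    intros t. rewrite slice_set_coord. symmetry. apply Uinf_source. }
  split; [|split; [|split]].
  - intros r Hr. split.
    + unfold U_converges.
      change (x r) with (ray theta r). rewrite Uintegrand_kern by assumption. fold kap.
      destruct (kern_decay kap theta r _ Hk Htheta Hr (proj2 Hs)) as [M [eta [_ [He Hdec]]]].
      apply (line_integral_exists _ M eta).
      * intros xi. apply contC_mult; [now apply (amplitude_cont V)|now apply (contC_kern V)].
      * exact He.
      * intros xi. rewrite Cmod_mult. apply Hdec; [apply Rle_refl|apply Cmod_ge_0].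
    + intros i. destruct (source_family m a j y i Hm Hy) as [g1 [d [Hd Hg]]].
      eexists. now apply (HU i g1 d r).
  - intros i. destruct (source_family m a j y i Hm Hy) as [g1 [d [Hd Hg]]].
    eexists. now apply (HUinf i g1 d).
  - destruct (farfield_asymptotics V kap theta _ HV HB Hs Hk Htheta) as [M [r0 HM]].
    exists M, (Rmax 0 r0). intros r Hr.
    assert (Hr0 : 0 < r) by (eapply Rle_lt_trans; [apply Rmax_l|exact Hr]).
    assert (Hr1 : r0 < r) by (eapply Rle_lt_trans; [apply Rmax_r|exact Hr]).
    change (x r) with (ray theta r). rewrite U_kern by assumption.
    unfold xhat. rewrite Uinf_source. exact (HM r Hr1).
  - intros i. destruct (source_family m a j y i Hm Hy) as [g1 [d [Hd Hg]]].
    destruct (farfield_asymptotics V kap theta g1 HV HB (proj1 (proj2 Hg)) Hk Htheta)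
      as [M [r0 HM]].
    exists M, (Rmax 0 r0). intros r Hr.
    assert (Hr0 : 0 < r) by (eapply Rle_lt_trans; [apply Rmax_l|exact Hr]).
    assert (Hr1 : r0 < r) by (eapply Rle_lt_trans; [apply Rmax_r|exact Hr]).
    rewrite (grad_of_derive _ _ _ _ (HU i g1 d r Hd Hr0 Hg)).
    rewrite (grad_of_derive _ _ _ _ (HUinf i g1 d Hd Hg)).
    exact (HM r Hr1).
Qed.
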